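(* Let $L$ be a finite graph such that the join $L*[3]$, where $[3]=\{1,2,3\}$ (i.e. the union of three cones over $L$ along their common base $L$), admits a piecewise linear (PL) embedding into $\mathbb{R}^4$. Then $L$ admits a PL embedding $f:L\to\mathbb{R}^3$ such that for any two disjoint cycles $\beta,\gamma$ in $L$ the linking number of $f(\beta)$ and $f(\gamma)$ in $\mathbb{R}^3$ is zero.
   Context: A graph is regarded as a 1-dimensional simplicial complex, and $[3]=\{1,2,3\}$ as a 0-dimensional complex with three points. The join $L*[3]$ is the simplicial complex whose simplices are the simplices $\sigma$ of $L$, the vertices $i\in\{1,2,3\}$, and the joins $\sigma*i$ for $\sigma$ a simplex of $L$ and $i\in\{1,2,3\}$. The linking number is the integer linking number of two disjoint oriented closed polygonal lines in $\mathbb{R}^3$ (its vanishing does not depend on the orientations). *)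

(* Defs.v *)
From mathcomp Require Import all_boot all_order all_algebra.
From mathcomp Require Import all_classical reals.

Set Implicit Arguments.
Unset Strict Implicit.
Unset Printing Implicit Defensive.

Import Order.TTheory GRing.Theory Num.Theory.
Local Open Scope classical_set_scope.
Local Open Scope ring_scope.

(* Abstract finite simplicial complexes are sets of nonempty simplices.  A     *)
(* point of V that does not form a simplex by itself is not a vertex.          *)
Definition is_complex (V : finType) (K : {set {set V}}) : Prop :=
  finset.set0 \notin K /\
  forall s t : {set V}, s \in K -> t \subset s -> t != finset.set0 -> t \in K.

Definition graph_complex (V : finType) (e : rel V) : {set {set V}} :=
  [set [set v]%SET | v : V]%SET :|:
  [set [set uv.1; uv.2]%SET | uv : V * V & e uv.1 uv.2]%SET.

Definition points_complex (n : nat) : {set {set 'I_n}} :=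
  [set [set i]%SET | i : 'I_n]%SET.

Definition join_complex (V W : finType) (K : {set {set V}})
    (M : {set {set W}}) : {set {set (V + W)%type}} :=
  [set s : {set (V + W)%type} | [&& s != finset.set0,
     inl @^-1: s \in (finset.set0 |: K)%SET &
     inr @^-1: s \in (finset.set0 |: M)%SET]]%SET.

Section Realization.
Variable R : realType.

(* R^o is R seen as a module over itself; {ffun V -> R^o} is the space R^V.    *)
Definition supp (V : finType) (x : {ffun V -> R^o}) : {set V} :=
  [set v | x v != 0]%SET.

(* Points of |K| are given by their barycentric coordinates.                   *)
Definition realization (V : finType) (K : {set {set V}}) :
    set {ffun V -> R^o} :=
  [set x : {ffun V -> R^o} | [/\ forall v, 0 <= x v, \sum_v x v = 1 & supp x \in K]].

Definition barycenter (W : finType) (E : lmodType R) (p : W -> E)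
    (y : {ffun W -> R^o}) : E := \sum_w y w *: p w.

(* Continuity of the bijection and of its inverse is automatic: it is affine   *)
(* on each of the finitely many closed simplices.                              *)
Definition subdivision (V W : finType) (K : {set {set V}})
    (K' : {set {set W}}) (p : W -> {ffun V -> R^o}) : Prop :=
  [/\ is_complex K',
      set_bij (realization K') (realization K) (barycenter p) &
      forall s, s \in K' ->
        exists2 t, t \in K & forall w, w \in s -> supp (p w) \subset t].

(* Only the values of f on |K| matter.                                         *)
Definition PL_map (V : finType) (K : {set {set V}}) (d : nat)
    (f : {ffun V -> R^o} -> 'rV[R]_d) : Prop :=
  exists (W : finType) (K' : {set {set W}}) (p : W -> {ffun V -> R^o}),
    subdivision K K' p /\
    forall y, realization K' y ->
      f (barycenter p y) = barycenter (f \o p) y.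

(* |K| is compact, so an injective PL map is a homeomorphism onto its image.   *)
Definition PL_embedding (V : finType) (K : {set {set V}}) (d : nat)
    (f : {ffun V -> R^o} -> 'rV[R]_d) : Prop :=
  PL_map K f /\ set_inj (realization K) f.

Definition PL_embeddable (V : finType) (K : {set {set V}}) (d : nat) : Prop :=
  exists f : {ffun V -> R^o} -> 'rV[R]_d, PL_embedding K f.

(* An oriented cycle of a simple graph, listed by its distinct vertices.       *)
Definition graph_cycle (V : finType) (e : rel V) (c : seq V) : bool :=
  ucycleb e c && (2 < size c)%N.

Definition edge_point (V : finType) (u v : V) (t : R) : {ffun V -> R^o} :=
  [ffun w => (1 - t) * (w == u)%:R + t * (w == v)%:R].

Definition affine_between (V : finType) (d : nat)
    (f : {ffun V -> R^o} -> 'rV[R]_d) (u v : V) (t t' : R) : Prop :=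
  forall s : R, 0 <= s <= 1 ->
    f (edge_point u v ((1 - s) * t + s * t')) =
    (1 - s) *: f (edge_point u v t) + s *: f (edge_point u v t').

(* A closed polygonal line is the cyclic list of its vertices.  P is a list of *)
(* vertices of the oriented closed polygonal line f(c) : the edge of c that    *)
(* starts at u is cut at the parameters ts u into pieces on which f is affine. *)
Definition polygon_of_cycle (V : finType) (d : nat)
    (f : {ffun V -> R^o} -> 'rV[R]_d) (c : seq V) (P : seq 'rV[R]_d) : Prop :=
  exists ts : V -> seq R,
    (forall u, u \in c ->
       path <%R 0 (rcons (ts u) 1) /\
       forall tt, tt \in zip (0 :: ts u) (rcons (ts u) 1) ->
         affine_between f u (next c u) tt.1 tt.2) /\
    P = flatten [seq [seq f (edge_point u (next c u) t) | t <- 0 :: ts u]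
                | u <- c].

Definition polygon_edges (T : Type) (P : seq T) : seq (T * T) :=
  zip P (rot 1 P).

Definition segment (E : lmodType R) (a b : E) : set E :=
  [set x | exists2 t : R, 0 <= t <= 1 & x = a + t *: (b - a)].

Definition triangle (E : lmodType R) (p a b : E) : set E :=
  [set x | exists s t : R, [/\ 0 <= s, 0 <= t, s + t <= 1 &
     x = p + s *: (a - p) + t *: (b - p)]].

Definition det3 (u v w : 'rV[R]_3) : R :=
  \det (\matrix_(i < 3) nth 0 [:: u; v; w] i).

(* For disjoint P and Q this makes every intersection of Q with the cone p * P *)
(* a transversal crossing of the interiors of an edge and of a triangle.       *)
Definition generic_apex (P Q : seq 'rV[R]_3) (p : 'rV[R]_3) : Prop :=
  forall a b, a \in polygon_edges P -> b \in polygon_edges Q ->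
    ~ triangle p a.1 a.2 b.1 /\ segment p a.1 `&` segment b.1 b.2 = set0.

Definition crossing_sign (p : 'rV[R]_3) (a b : 'rV[R]_3 * 'rV[R]_3) : int :=
  if `[< triangle p a.1 a.2 `&` segment b.1 b.2 !=set0 >]
  then sgz (det3 (a.1 - p) (a.2 - p) (b.2 - b.1)) else 0.

Definition cone_intersection (P Q : seq 'rV[R]_3) (p : 'rV[R]_3) : int :=
  \sum_(a <- polygon_edges P) \sum_(b <- polygon_edges Q) crossing_sign p a b.

(* The linking number of disjoint oriented closed polygonal lines P and Q is   *)
(* the algebraic number of intersections of Q with a surface bounded by P, in  *)
(* general position to Q; the surface is a cone over P with a chosen generic   *)
(* apex (almost every apex is generic, and the number does not depend on it).  *)
Definition linking_number (P Q : seq 'rV[R]_3) : int :=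
  cone_intersection P Q (xget 0 (generic_apex P Q)).

End Realization.

Arguments PL_embeddable R {V} K d.

(* Main.v *)
Require Import Defs.
From mathcomp Require Import all_boot all_order all_algebra.
From mathcomp Require Import all_classical reals.
From mathcomp Require Import topology normedtype derive.
From mathcomp Require Import perm ring lra zify.

(* Let F embed L * [3] in R^4 and let O be the image of the cone point 1.  Near O
   the image is a cone over L, which misses some ray; a piecewise linear
   homeomorphism of R^4 moves it into the open upper half-space, and its section
   by a horizontal hyperplane is the embedding f of L in R^3.

   Let beta, gamma be disjoint cycles.  The cones 1 * beta and 2 * beta form a
   sphere A, the cones 1 * gamma and 3 * gamma a sphere B, and F(A), F(B) meet
   only at O.  The algebraic intersection number of two 2-cycles in R^4 in
   general position is zero.  After a translation of one of them by a small
   vector - r (p, 1), all intersections lie near O, where they correspond, under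
   the central projection from O, to the crossings of f(gamma) with the cone with
   apex p over f(beta).  Hence the linking number vanishes.

   Only the parts of the spheres near O have to be exact: elsewhere F is replaced
   by its values on a fine triangulation, which is harmless by uniform continuity
   and compactness. *)

Set Implicit Arguments.
Unset Strict Implicit.
Unset Printing Implicit Defensive.
Import Order.TTheory GRing.Theory Num.Theory.
Import numFieldNormedType.Exports.

Local Open Scope ring_scope.

(** * Signed solutions of linear systems *)

Section SignedIncidence.
Variable R : realFieldType.

(** The intersection number in R^4 is handled by linear algebra: an intersection of a triangle with
    a translated one is a nonnegative solution of a 6 by 6 system, and its sign is that of the
    determinant. To see that these signs add up to zero for two closed chains, one chain is coned
    off from a point; the extra vertex gives a system with 7 unknowns, whose solutions form a
    segment with two ends of opposite sign. General position is obtained along a moment curve, where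
    each bad event lies at the roots of a nonzero polynomial in one variable; no measure or
    dimension theory enters.

    Another obstacle is that the radial projection of a cone to a hyperplane is not piecewise
    linear. The section [f] is therefore extended linearly from the vertices of a subdivision, and
    the point of the cone lying over [f x] is found by rescaling each vertex coordinate of [x]
    separately. *)

Definition nonneg_mx m n (x : 'M[R]_(m, n)) : Prop := forall i j, 0 <= x i j.

Definition feasible m n (N : 'M[R]_(m, n)) (c : 'cV[R]_m) : Prop :=
  exists2 x : 'cV[R]_n, nonneg_mx x & N *m x = c.

Definition incidence n (c : 'cV[R]_n) (N : 'M[R]_n) : int :=
  if `[< feasible N c >] then sgz (\det N) else 0.

Definition minor_vec n (M : 'M[R]_(n, n.+1)) : 'cV[R]_n.+1 :=
  \col_k ((-1) ^+ k * \det (col' k M)).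

(** Cramer's rule: repeating row [i] on top of [M] gives a singular square matrix, and expanding its
    determinant along the extra row gives entry [i] of the product. *)
Lemma mul_minor_vec n (M : 'M[R]_(n, n.+1)) : M *m minor_vec M = 0.
Proof.
apply/matrixP => i j; rewrite !mxE.
pose A : 'M[R]_(1 + n, n.+1) := col_mx (row i M) M.
have : \det (A : 'M_n.+1) = 0.
  apply: (@determinant_alternate _ _ _ (lshift n (ord0 : 'I_1)) (rshift 1 i)).
    by rewrite eq_lrshift.
  by move=> k; rewrite col_mxEu col_mxEd mxE.
rewrite (expand_det_row _ (lshift n (ord0 : 'I_1))) => E; rewrite -[RHS]E.
apply: eq_bigr => k _; rewrite /cofactor [A _ _]col_mxEu !mxE.
congr (_ * (_ * \det _)); apply/matrixP => a b.
rewrite [in RHS]mxE [in RHS]mxE [LHS]mxE.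
have -> : lift (lshift n ord0) (a : 'I_(1 + n).-1) = rshift 1 a by apply: val_inj.
by rewrite col_mxEd.
Qed.

(** A nonzero minor makes the kernel a line: subtracting the multiple of [minor_vec M] that agrees
    with [x] in coordinate [k] leaves a vector killed by the invertible matrix [col' k M]. *)
Lemma kernel_minor_vec n (M : 'M[R]_(n, n.+1)) (x : 'cV[R]_n.+1) k :
  minor_vec M k 0 != 0 -> M *m x = 0 ->
  x = (x k 0 / minor_vec M k 0) *: minor_vec M.
Proof.
have := mul_minor_vec M.
have : minor_vec M k 0 = (-1) ^+ k * \det (col' k M) by rewrite mxE.
move: (minor_vec M) => d dkE Md dk Mx; apply/eqP; rewrite -subr_eq0; apply/eqP.
set u := x - _.
have uk : u k 0 = 0 by rewrite !mxE mulfVK ?subrr.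
have Mu : M *m u = 0 by rewrite mulmxBr -scalemxAr Md Mx scaler0 subr0.
have row'u : row' k u = 0.
  have detN : col' k M \in unitmx.
    rewrite unitmxE unitfE; apply: contraNneq dk => d0.
    by rewrite dkE d0 mulr0.
  apply: (can_inj (mulKmx detN)); rewrite mulmx0 -Mu.
  apply/matrixP => i j; rewrite !mxE (bigD1_ord k) //= ord1 uk mulr0 add0r.
  by apply: eq_bigr => l _; rewrite !mxE.
apply/matrixP => i j; rewrite ord1 [RHS]mxE.
case: (unliftP k i) => [l ->|-> //].
by move/matrixP/(_ l 0): row'u; rewrite !mxE.
Qed.

Lemma feasible_colP n (M : 'M[R]_(n, n.+1)) c k :
  feasible (col' k M) c <->
  exists x : 'cV_n.+1, [/\ nonneg_mx x, M *m x = c & x k 0 = 0].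
Proof.
split=> [[y y0 <-]|[x [x0 <- xk]]].
  exists (\col_i oapp (fun l => y l 0) 0 (unlift k i)); split.
  - by move=> i j; rewrite mxE; case: unlift => //=.
  - apply/matrixP => i j; rewrite !mxE (bigD1_ord k) //= mxE unlift_none mulr0 add0r.
    by apply: eq_bigr => l _; rewrite !mxE liftK ord1.
  - by rewrite mxE unlift_none.
exists (row' k x) => [i j|]; first by rewrite mxE.
apply/matrixP => i j; rewrite !mxE (bigD1_ord k) //= ord1 xk mulr0 add0r.
by apply: eq_bigr => l _; rewrite !mxE.
Qed.

Section Boundary.
Variables (n : nat) (M : 'M[R]_(n, n.+1)) (c : 'cV[R]_n).
(** Geometrically: the polyhedron of nonnegative solutions has no direction of recession, and each
    of its points lies on at most one facet. *)
Hypothesis M_bounded : forall d : 'cV_n.+1, nonneg_mx d -> M *m d = 0 -> d = 0.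
Hypothesis M_generic : forall x : 'cV_n.+1, nonneg_mx x -> M *m x = c ->
  forall i j, x i 0 = 0 -> x j 0 = 0 -> i = j.

(* Moving from a solution along a kernel direction, the first coordinate to
   vanish is unique by genericity, and every other exit would have to occur at
   the same time. *)
Lemma exit_facet (d x0 : 'cV[R]_n.+1) :
  (forall k, d k 0 != 0 -> forall y, M *m y = 0 -> y = (y k 0 / d k 0) *: d) ->
  d != 0 -> M *m d = 0 -> nonneg_mx x0 -> M *m x0 = c ->
  exists k, [/\ d k 0 < 0, feasible (col' k M) c &
    forall k', d k' 0 < 0 -> feasible (col' k' M) c -> k' = k].
Proof.
move=> ker dn0 Md x0_ge0 Mx0.
have [k0 dk0] : exists k, d k 0 < 0.
  apply/existsP; apply: contra_neqT dn0; rewrite negb_exists => /forallP d_ge0.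
  apply: M_bounded => // i j; rewrite ord1 leNgt; exact: d_ge0.
(* The time at which coordinate [k] vanishes on the line through [x0] in direction [d]. *)
pose T k := x0 k 0 / - d k 0.
case: (@arg_minP _ _ _ k0 (fun k => d k 0 < 0) T dk0) => k dk kmin.
have xk_ge0 : nonneg_mx (x0 + T k *: d).
  move=> i j; rewrite ord1 !mxE; have [di|di] := ltP (d i 0) 0.
    have := kmin i di; rewrite /T ler_pdivlMr ?oppr_gt0 // mulrN.
    by rewrite -subr_ge0 opprK addrC.
  rewrite addr_ge0 // mulr_ge0 // divr_ge0 ?oppr_ge0 //; exact: ltW.
have Mxk : M *m (x0 + T k *: d) = c by rewrite mulmxDr -scalemxAr Md scaler0 addr0.
have xkk : (x0 + T k *: d) k 0 = 0.
  by rewrite !mxE /T invrN mulrN mulNr mulfVK ?subrr // lt_eqF.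
exists k; split=> //; first by apply/feasible_colP; exists (x0 + T k *: d).
(* A solution on facet [k'] is the point of this line at time [T k']; nonnegativity of its
   coordinate [k] gives [T k' <= T k], so both facets are met at the same point. *)
move=> k' dk' /feasible_colP[x [x_ge0 Mx xk']].
have xE : x = x0 + T k' *: d.
  have dk'0 : d k' 0 != 0 by rewrite lt_eqF.
  have /(ker _ dk'0) : M *m (x - x0) = 0 by rewrite mulmxBr Mx Mx0 subrr.
  rewrite !mxE xk' sub0r /T invrN mulrN mulNr => E.
  by rewrite -E addrC subrK.
have Tk : T k = T k'.
  apply/eqP; rewrite eq_le kmin //=.
  have := x_ge0 k 0; rewrite xE !mxE addrC -[_ * _]opprK -mulrN addrC subr_ge0.
  by rewrite -ler_pdivlMr ?oppr_gt0.
by apply: (M_generic xk_ge0 Mxk) => //; rewrite Tk -xE.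
Qed.

(* The solutions of [M x = c] with nonnegative coordinates form a segment, whose
   two endpoints lie on facets crossed with opposite signs. *)
Lemma sum_incidence_facets :
  \sum_(k < n.+1) (-1) ^+ k * incidence c (col' k M) = 0 :> int.
Proof.
set d := minor_vec M.
have termE (k : 'I_n.+1) : (-1) ^+ k * incidence c (col' k M) =
    if `[< feasible (col' k M) c >] then sgz (d k 0) else 0.
  rewrite /incidence; case: ifP => _; last by rewrite mulr0.
  rewrite mxE sgzM; congr (_ * _).
  by rewrite -signr_odd -[in RHS]signr_odd; case: odd; rewrite ?expr0 ?expr1 ?sgz1 ?sgzN1.
under eq_bigr do rewrite termE.
have [d0|dn0] := eqVneq d 0.
  by rewrite big1 // => k _; rewrite d0 mxE sgz0 if_same.
have [[x0 x0_ge0 Mx0]|infeas] := pselect (feasible M c); last first.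
  rewrite big1 // => k _; case: asboolP => // /feasible_colP[x [x_ge0 Mx _]].
  by case: infeas; exists x.
have ker := kernel_minor_vec (M := M).
have [] := exit_facet (d := d) (x0 := x0) => //.
- by move=> k dk y My; apply: ker.
- exact: mul_minor_vec.
move=> k1 [dk1 fk1 uk1].
have [] := exit_facet (d := - d) (x0 := x0) => //.
- move=> k; rewrite mxE oppr_eq0 => dk y My; rewrite invrN mulrN scalerN scaleNr opprK.
  exact: ker.
- by rewrite oppr_eq0.
- by rewrite mulmxN mul_minor_vec oppr0.
move=> k2; rewrite mxE oppr_lt0 => -[dk2 fk2 uk2].
have k21 : k2 != k1 by apply: contraTneq dk2 => ->; rewrite -leNgt ltW.
rewrite (bigD1 k1) //= (bigD1 k2) //= !asboolT // ltr0_sgz // gtr0_sgz // addrA addNr add0r.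
rewrite big1 // => k /andP[kk1 kk2]; case: asboolP => // fk.
case: (ltgtP (d k 0) 0) => [dk|dk|->]; last exact: sgz0.
  by case/eqP: kk1; apply: uk1.
by case/eqP: kk2; apply: uk2 => //; rewrite mxE oppr_lt0.
Qed.
End Boundary.

Lemma feasible_xcol m n (N : 'M[R]_(m, n)) c i j :
  feasible N c -> feasible (xcol i j N) c.
Proof.
case=> x x0 Nx; exists (xrow i j x) => [a b|]; first by rewrite mxE.
by rewrite xcolE xrowE mulmxA -(mulmxA N) -perm_mxM tperm2 perm_mx1 mulmx1.
Qed.

Lemma incidence_xcol n c (N : 'M[R]_n) i j :
  i != j -> incidence c (xcol i j N) = - incidence c N.
Proof.
move=> ij; rewrite /incidence.
have -> : `[< feasible (xcol i j N) c >] = `[< feasible N c >].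
  apply/asbool_equiv_eq; split; last exact: feasible_xcol.
  move/(feasible_xcol i j); congr (feasible _ c).
  by apply/matrixP => a b; rewrite !mxE tpermK.
case: ifP => _; last by rewrite oppr0.
by rewrite xcolE det_mulmx det_perm odd_tperm ij expr1 mulrN1 sgzN.
Qed.

End SignedIncidence.

(** * General position in one parameter *)

Section Generic.
Variable R : realFieldType.

(** Exceptional sets are contained in root sets of nonzero polynomials: finite unions stay of this
    kind, by multiplying the polynomials, and never exhaust the field. *)
Definition generic (Q : R -> Prop) : Prop :=
  exists2 p : {poly R}, p != 0 & forall z, ~~ root p z -> Q z.

Lemma generic_ex Q : generic Q -> exists z, Q z.
Proof.
move=> [p p0 pQ].
have [z zp] : exists z, ~~ root p z.
  pose s := [seq (i%:R : R) | i <- iota 0 (size p)].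
  have [rs|/allPn[z _ zp]] := boolP (all (root p) s); last by exists z.
  have := max_poly_roots p0 rs.
  rewrite map_inj_uniq ?iota_uniq => [/(_ isT)|i j]; last first.
    by move/eqP; rewrite eqr_nat => /eqP.
  by rewrite size_map size_iota ltnn.
by exists z; apply: pQ.
Qed.

Lemma generic_sub (Q Q' : R -> Prop) :
  (forall z, Q z -> Q' z) -> generic Q -> generic Q'.
Proof. by move=> QQ' [p p0 pQ]; exists p => // z /pQ/QQ'. Qed.

Lemma generic_true (Q : R -> Prop) : (forall z, Q z) -> generic Q.
Proof. by move=> q; exists 1; rewrite ?oner_eq0. Qed.

Lemma generic_and Q Q' : generic Q -> generic Q' -> generic (fun z => Q z /\ Q' z).
Proof.
move=> [p p0 pQ] [q q0 qQ]; exists (p * q); first by rewrite mulf_neq0.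
by move=> z; rewrite rootM negb_or => /andP[/pQ ? /qQ].
Qed.

Lemma generic_seq (T : eqType) (s : seq T) (Q : T -> R -> Prop) :
  (forall t, t \in s -> generic (Q t)) ->
  generic (fun z => forall t, t \in s -> Q t z).
Proof.
elim: s => [|a s IH] H; first exact: generic_true.
apply: (@generic_sub (fun z => Q a z /\ forall t, t \in s -> Q t z)).
  by move=> z [Qa Qs] t; rewrite inE => /predU1P[->|/Qs].
apply: generic_and; first by apply: H; rewrite mem_head.
by apply: IH => t ts; apply: H; rewrite inE ts orbT.
Qed.

Lemma generic_fin (T : finType) (Q : T -> R -> Prop) :
  (forall t, generic (Q t)) -> generic (fun z => forall t, Q t z).
Proof.
move=> H; apply: (@generic_sub (fun z => forall t, t \in enum T -> Q t z)).
  by move=> z Hz t; apply: Hz; rewrite mem_enum.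
by apply: generic_seq => t _; apply: H.
Qed.

End Generic.

(** * Intersection number of closed 2-chains in R^4 *)

Section Cycles.
Variable R : realFieldType.

Definition triple_sum (E : Type) (phi : E -> E -> int) (T : E * E * E) : int :=
  phi T.1.1 T.1.2 + phi T.1.2 T.2 + phi T.2 T.1.1.

(* Closed 2-chains are detected by testing their boundary against all
   antisymmetric functions on oriented edges. *)
Definition closed2 (E : Type) (A : seq (E * E * E)) : Prop :=
  forall phi : E -> E -> int, (forall a b, phi a b = - phi b a) ->
    \sum_(T <- A) triple_sum phi T = 0.

Definition mxcols m n (s : seq 'cV[R]_m) : 'M[R]_(m, n) :=
  \matrix_(i < m, j < n) nth 0 s j i 0.

Lemma mul_mxcols m n (s : seq 'cV[R]_m) (x : 'cV[R]_n) :
  mxcols n s *m x = \sum_j x j 0 *: nth 0 s j.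
Proof.
apply/matrixP => i j; rewrite mxE summxE ord1.
by apply: eq_bigr => k _; rewrite !mxE mulrC.
Qed.

Lemma col'_mxcols m n (s : seq 'cV[R]_m) (k : 'I_n.+1) :
  size s = n.+1 -> col' k (mxcols n.+1 s) = mxcols n (take k s ++ drop k.+1 s).
Proof.
move=> ss; apply/matrixP => i j; rewrite !mxE nth_cat size_take ss ltn_ord.
rewrite /= /bump; case: ltnP => jk; first by rewrite add0n nth_take.
by rewrite nth_drop; congr (fun_of_matrix (nth _ _ _) _ _); lia.
Qed.

Definition inc n (c : 'cV[R]_n) (s : seq 'cV[R]_n) : int := incidence c (mxcols n s).

Lemma inc_swap n (c : 'cV[R]_n) s1 a b s2 :
  size (s1 ++ a :: b :: s2) = n ->
  inc c (s1 ++ a :: b :: s2) = - inc c (s1 ++ b :: a :: s2).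
Proof.
rewrite size_cat /= => sn.
have i1 : (size s1 < n)%N by lia.
have i2 : ((size s1).+1 < n)%N by lia.
rewrite /inc -[RHS](incidence_xcol c _ (_ : Ordinal i1 != Ordinal i2)); last first.
  by rewrite -val_eqE /=; lia.
congr incidence; apply/matrixP => i j; rewrite !mxE !nth_cat.
case: tpermP => [->|->|/eqP + /eqP] /=.
- by rewrite ltnn subnn ltnNge leqnSn subSnn.
- by rewrite ltnn subnn ltnNge leqnSn subSnn.
rewrite -!val_eqE /= => j1 j2; case: ltnP => // j3.
by case E: (j - size s1)%N => [|[|k]] //; exfalso; lia.
Qed.

(** With three columns of each kind, the system with right side [colW w] asks for a point of one
    triangle and a point of the other whose difference is [w]; the last two rows say that the
    weights in each triangle add up to 1. *)
Definition colX (a : 'rV[R]_4) : 'cV[R]_6 := col_mx a^T (\col_(i < 2) (i == 0)%:R).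
Definition colY (b : 'rV[R]_4) : 'cV[R]_6 := col_mx (- b^T) (\col_(i < 2) (i == 1)%:R).
Definition colW (w : 'rV[R]_4) : 'cV[R]_6 := col_mx w^T (const_mx 1).

Lemma addmxE m n (A B : 'M[R]_(m, n)) i j : (A + B) i j = A i j + B i j.
Proof. by rewrite mxE. Qed.

Lemma oppmxE m n (A : 'M[R]_(m, n)) i j : (- A) i j = - A i j.
Proof. by rewrite mxE. Qed.

Lemma scalemxE m n c (A : 'M[R]_(m, n)) i j : (c *: A) i j = c * A i j.
Proof. by rewrite mxE. Qed.

Lemma zeromxE m n i j : (0 : 'M[R]_(m, n)) i j = 0.
Proof. by rewrite mxE. Qed.

Definition mxlinE := (addmxE, oppmxE, scalemxE, zeromxE).

Lemma colXu a (k : 'I_4) : colX a (lshift 2 k) 0 = a 0 k.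
Proof. by rewrite (col_mxEu a^T) mxE. Qed.

Lemma colYu b (k : 'I_4) : colY b (lshift 2 k) 0 = - b 0 k.
Proof. by rewrite (col_mxEu (- b^T)) !mxE. Qed.

Lemma colXd a (k : 'I_2) : colX a (rshift 4 k) 0 = (k == 0)%:R.
Proof. by rewrite (col_mxEd a^T) mxE. Qed.

Lemma colYd b (k : 'I_2) : colY b (rshift 4 k) 0 = (k == 1)%:R.
Proof. by rewrite (col_mxEd (- b^T)) mxE. Qed.

Definition moment (z : R) : 'rV[R]_4 := \row_(i < 4) z ^+ i.+1.

Definition cols (s t : 'rV[R]_4 * 'rV[R]_4 * 'rV[R]_4) : seq 'cV[R]_6 :=
  [:: colX s.1.1; colX s.1.2; colX s.2; colY t.1.1; colY t.1.2; colY t.2].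

Definition boundary_free w s t : Prop :=
  forall x : 'cV[R]_6, nonneg_mx x -> mxcols 6 (cols s t) *m x = colW w ->
    forall i, x i 0 != 0.

(** If the apex weight and another one vanish, [boundary_free] is contradicted. If two other weights
    vanish, [colW w] is a combination of the apex column and four columns; a functional killing
    [colW w] and these four takes on the apex column a value polynomial in [z], and off its roots
    the apex weight vanishes as well. *)
Lemma generic_cone_point w s t : boundary_free w s t ->
  generic (fun z => forall x : 'cV[R]_7, nonneg_mx x ->
    mxcols 7 (colX (moment z) :: cols s t) *m x = colW w ->
    forall i j, x i 0 = 0 -> x j 0 = 0 -> i = j).
Proof.
move=> bf.
have x0_neq0 z (x : 'cV[R]_7) i : nonneg_mx x ->
    mxcols 7 (colX (moment z) :: cols s t) *m x = colW w ->
    x 0 0 = 0 -> x (lift 0 i) 0 = 0 -> False.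
  move=> x_ge0; rewrite mul_mxcols big_ord_recl => + x0; rewrite x0 scale0r add0r => E xi.
  have := bf (\col_i x (lift 0 i) 0) _ _ i; rewrite mxE xi eqxx => /(_ _ _)/negP; apply=> //.
    by move=> a b; rewrite mxE.
  by rewrite mul_mxcols -E; apply: eq_bigr => k _; rewrite mxE.
suff H : forall i j : 'I_7, generic (fun z => forall x : 'cV[R]_7, nonneg_mx x ->
    mxcols 7 (colX (moment z) :: cols s t) *m x = colW w ->
    x i 0 = 0 -> x j 0 = 0 -> i = j).
  have := generic_fin (fun i => generic_fin (H i)).
  by apply: generic_sub => z Hz x x0 Mx i j; apply: Hz.
move=> i j; case: (unliftP 0 i) => [i'|] ->; last first.
  case: (unliftP 0 j) => [j'|] ->; last exact: generic_true.
  by apply: generic_true => z x x0 Mx xi xj; case: (x0_neq0 z x j').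
case: (unliftP 0 j) => [j'|] ->; last first.
  by apply: generic_true => z x x0 Mx xi xj; case: (x0_neq0 z x i').
have [->|ij] := eqVneq i' j'; first exact: generic_true.
(* [B] carries [colW w] in place of column [i'] and zeros in place of column [j'], so some nonzero
   row [h] annihilates [colW w] and the four remaining columns. *)
pose B : 'M[R]_6 := \matrix_(k, l)
  if l == i' then colW w k 0 else if l == j' then 0 else nth 0 (cols s t) l k 0.
have /eqP/det0P[h h0 hB] : \det B = 0.
  rewrite (expand_det_col _ j') big1 // => k _; rewrite mxE eq_sym (negbTE ij) eqxx.
  by rewrite mul0r.
have hW : h *m colW w = 0.
  apply/matrixP => a b; rewrite ord1 mxE [RHS]mxE; move/matrixP/(_ 0 i'): hB; rewrite !mxE => E.
  by rewrite -[RHS]E (ord1 b); apply: eq_bigr => k _; rewrite [B _ _]mxE eqxx.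
have hN l : l != i' -> l != j' -> h *m nth 0 (cols s t) l = 0.
  move=> li lj; apply/matrixP => a b; rewrite ord1 mxE [RHS]mxE.
  move/matrixP/(_ 0 l): hB; rewrite !mxE => E.
  by rewrite -[RHS]E (ord1 b); apply: eq_bigr => k _; rewrite [B _ _]mxE (negbTE li) (negbTE lj).
have [hl [hr hlr]] : exists (hl : 'rV[R]_4) (hr : 'rV[R]_2), h = row_mx hl hr.
  by exists (lsubmx (h : 'rV_(4 + 2))), (rsubmx (h : 'rV_(4 + 2))); rewrite hsubmxK.
have hE (u : 'cV_4) (v : 'cV_2) : h *m (col_mx u v : 'cV_6) = hl *m u + hr *m v.
  by rewrite hlr; exact: (mul_row_col hl hr u v).
pose q : {poly R} := rVpoly hl * 'X + (hr 0 0)%:P.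
have hC z : (h *m colX (moment z)) 0 0 = q.[z].
  rewrite hE !hornerE mxE; congr (_ + _).
    rewrite mxE (@horner_coef_wide _ 4) ?size_poly // mulr_suml.
    by apply: eq_bigr => k _; rewrite !mxE coef_rVpoly_ord exprSr mulrA.
  by rewrite mxE !big_ord_recl big_ord0 !mxE /= mulr1 mulr0 !addr0.
exists q; last first.
  move=> z qz x x_ge0 Mx xi xj; exfalso.
  have x0 : x 0 0 = 0.
    have : (h *m colW w) 0 0 = 0 by rewrite hW mxE.
    rewrite -Mx mul_mxcols mulmx_sumr summxE big_ord_recl -scalemxAr mxE hC.
    rewrite big1 => [|k _]; last first.
      rewrite -scalemxAr mxE /=.
      have [->|ki] := eqVneq k i'; first by rewrite xi mul0r.
      have [->|kj] := eqVneq k j'; first by rewrite xj mul0r.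
      by rewrite hN // mxE mulr0.
    by rewrite addr0 => /eqP; rewrite mulf_eq0 -[q.[z] == 0]rootE (negbTE qz) orbF => /eqP.
  exact: (x0_neq0 z x i').
(* If [q] were zero, the first five entries of [h] would vanish, and then the sixth as well, because
   [h] annihilates [colW w], whose last two entries are 1. *)
apply: contraNneq h0 => q0.
have hr0 : hr 0 0 = 0.
  by have := congr1 (horner^~ 0) q0; rewrite !hornerE => ->.
have hl0 : hl = 0.
  apply: (can_inj rVpolyK); rewrite linear0; apply/eqP.
  by move/eqP: q0; rewrite /q hr0 addr0 mulf_eq0 polyX_eq0 orbF.
have hr1 : hr 0 1 = 0.
  have : (h *m colW w) 0 0 = 0 by rewrite hW mxE.
  rewrite hE hl0 mul0mx add0r mxE !big_ord_recl big_ord0 !mxE !mulr1 addr0 hr0 add0r => <-.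
  by congr (hr _ _); apply: val_inj.
rewrite hlr hl0.
suff -> : hr = 0 by rewrite row_mx0.
apply/matrixP => a b; rewrite ord1 mxE.
by case: b => [[|[|//]]] ?; [rewrite -[RHS]hr0|rewrite -[RHS]hr1]; congr (hr _ _); apply: val_inj.
Qed.

(** The last two rows add up to a row of ones, so the nonnegative entries of [d] have sum zero. *)
Lemma mxcols_bounded a s t (d : 'cV[R]_7) : nonneg_mx d ->
  mxcols 7 (colX a :: cols s t) *m d = 0 -> d = 0.
Proof.
move=> d0 Md.
have rowE (k : 'I_2) : \sum_(j < 7)
    d j 0 * nth (0 : 'cV_6) (colX a :: cols s t) j (rshift 4 k : 'I_6) 0 = 0.
  move/matrixP/(_ (rshift 4 k : 'I_6) 0): Md; rewrite mul_mxcols summxE mxE => E; rewrite -[RHS]E.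
  by apply: eq_bigr => j _; rewrite !mxE.
have E0 := rowE 0; have E1 := rowE 1.
have {rowE} S0 : \sum_(j < 7) d j 0 = 0.
  transitivity (0 + 0 : R); last by rewrite addr0.
  rewrite -[X in _ = X + _]E0 -[X in _ = _ + X]E1 -big_split /=.
  rewrite !big_ord_recl !big_ord0 /= !colXd !colYd /= !mulr0 !mulr1 !addr0 !add0r //.
have d0' (j : 'I_7) : 0 <= d j 0 by apply: d0.
apply/matrixP => j k; rewrite ord1 [RHS]mxE.
by apply/eqP; move/eqP: S0; rewrite psumr_eq0 // => /allP/(_ j (mem_index_enum j)).
Qed.

(** The tetrahedron [a * s] meets the translated triangle [t] in segments. Their ends lie on [s], on
    the cones from [a] over the edges of [s], or on the edges of [t]; the signed count of these ends
    is zero. *)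
Lemma sum_inc_cone a w s t :
  (forall x : 'cV[R]_7, nonneg_mx x ->
    mxcols 7 (colX a :: cols s t) *m x = colW w ->
    forall i j, x i 0 = 0 -> x j 0 = 0 -> i = j) ->
  inc (colW w) (cols s t) =
  triple_sum (fun u v => inc (colW w)
    [:: colX a; colX u; colX v; colY t.1.1; colY t.1.2; colY t.2]) s
  - triple_sum (fun u v => inc (colW w)
    [:: colX a; colX s.1.1; colX s.1.2; colX s.2; colY u; colY v]) t.
Proof.
move=> gen.
have := sum_incidence_facets (@mxcols_bounded a s t) gen.
under eq_bigr => k _ do rewrite (@col'_mxcols 6 6 (colX a :: cols s t) k erefl).
rewrite !big_ord_recl big_ord0 /= -!/(inc _ _) /triple_sum.
have sw u v : inc (colW w) [:: colX a; colX u; colX v; colY t.1.1; colY t.1.2; colY t.2]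
    = - inc (colW w) [:: colX a; colX v; colX u; colY t.1.1; colY t.1.2; colY t.2].
  exact: (@inc_swap _ _ [:: _]).
have sw' u v : inc (colW w) [:: colX a; colX s.1.1; colX s.1.2; colX s.2; colY u; colY v]
    = - inc (colW w) [:: colX a; colX s.1.1; colX s.1.2; colX s.2; colY v; colY u].
  exact: (@inc_swap _ _ [:: _; _; _; _]).
rewrite (sw s.2 s.1.1) (sw' t.2 t.1.1) /bump /=.
rewrite ?addn0 ?add1n ?exprS ?expr0 -!/(cols s t).
lia.
Qed.

(** All triangles of [A] are coned off from one common generic point. Both boundary terms of
    [sum_inc_cone] are antisymmetric functions of an edge, one of [s] and one of [t], so they cancel
    on closed chains. *)
Lemma closed2_intersection (A B : seq ('rV[R]_4 * 'rV[R]_4 * 'rV[R]_4)) w :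
  closed2 A -> closed2 B ->
  (forall s t, s \in A -> t \in B -> boundary_free w s t) ->
  \sum_(s <- A) \sum_(t <- B) inc (colW w) (cols s t) = 0.
Proof.
move=> cA cB bf.
have /generic_ex[z gz] := generic_seq (fun s sA => generic_seq (fun t tB =>
  generic_cone_point (bf s t sA tB))).
rewrite big_seq; under eq_bigr => s sA.
  rewrite big_seq; under eq_bigr => t tB do rewrite (sum_inc_cone (gz _ sA _ tB)).
  rewrite -big_seq big_split /= sumrN cB => [|u v]; last first.
    exact: (@inc_swap _ _ [:: _; _; _; _]).
  rewrite oppr0 addr0; over.
rewrite -big_seq exchange_big big1 // => t _; apply: cA => u v.
exact: (@inc_swap _ _ [:: _]).
Qed.

End Cycles.

(** * Crossings of a segment with a cone *)

Section Laplace.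
Variable R : comNzRingType.

Definition del_nth (i : nat) (s : seq R) : seq R := take i s ++ drop i.+1 s.

(** Expansion along the first column, for a list of columns. It unfolds by computation, so
    determinants with explicit entries become polynomials that [ring] can compare. *)
Fixpoint laplace (n : nat) (L : seq (seq R)) : R :=
  if n is n'.+1 then
    foldr +%R 0 [seq (-1) ^+ i * nth 0 (head [::] L) i *
                     laplace n' [seq del_nth i d | d <- behead L]
                | i <- iota 0 n]
  else 1.

Lemma nth_del_nth i s n : (i < size s)%N -> nth 0 (del_nth i s) n = nth 0 s (bump i n).
Proof.
move=> si; rewrite nth_cat size_take si /bump; case: ltnP => ni /=.
  by rewrite add0n nth_take.
by rewrite nth_drop; congr nth; lia.
Qed.

Lemma det_laplace n (L : seq (seq R)) : size L = n -> all (fun s => size s == n) L ->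
  \det (\matrix_(i < n, j < n) nth 0 (nth [::] L j) i) = laplace n L.
Proof.
elim: n L => [|n IH] [|c L] //=; first by rewrite det_mx00.
move=> [sL] /andP[/eqP sc aL]; rewrite (expand_det_col _ ord0).
rewrite -[RHS]/(foldr +%R 0 [seq (-1) ^+ i * nth 0 c i * laplace n [seq del_nth i d | d <- L]
                | i <- iota 0 n.+1]).
rewrite foldrE big_map -[iota 0 _]/(index_iota 0 n.+1) big_mkord.
apply: eq_bigr => i _; rewrite mxE /cofactor addn0 /= mulrCA mulrA; congr (_ * _).
rewrite -IH ?size_map //; last first.
  rewrite all_map; apply: sub_all aL => s /= /eqP ss.
  by rewrite size_cat size_take size_drop ss ltn_ord; apply/eqP; have := ltn_ord i; lia.
congr (\det _); apply/matrixP => k l; rewrite !mxE /=.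
have sl : (l < size L)%N by rewrite sL.
rewrite (nth_map [::]) // nth_del_nth // (eqP (all_nthP [::] aL _ sl)) //.
Qed.

(** The columns belong to two triangles with a common vertex at the origin. The hypotheses describe
    the crossing of the segment from [B1] in direction [d] with the triangle [p], [A1], [A2], and
    serve to eliminate [B1]. *)
Lemma laplace_cones eta s t u p0 p1 p2 A10 A11 A12 A20 A21 A22 d0 d1 d2 B10 B11 B12 :
  B10 = (1 - s - t) * p0 + s * A10 + t * A20 - u * d0 ->
  B11 = (1 - s - t) * p1 + s * A11 + t * A21 - u * d1 ->
  B12 = (1 - s - t) * p2 + s * A12 + t * A22 - u * d2 ->
  laplace 6 [:: [:: 0; 0; 0; 0; 1; 0]; [:: eta * A10; eta * A11; eta * A12; eta; 1; 0];
     [:: eta * A20; eta * A21; eta * A22; eta; 1; 0]; [:: 0; 0; 0; 0; 0; 1];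
     [:: - (eta * B10); - (eta * B11); - (eta * B12); - eta; 0; 1];
     [:: - (eta * (B10 + d0)); - (eta * (B11 + d1)); - (eta * (B12 + d2)); - eta; 0; 1]] =
  - (eta ^+ 4 * (1 - s - t) * laplace 3 [:: [:: A10 - p0; A11 - p1; A12 - p2];
     [:: A20 - p0; A21 - p1; A22 - p2]; [:: d0; d1; d2]]).
Proof. by move=> -> -> ->; rewrite /=; ring. Qed.

End Laplace.

Section Crossing.
Variable R : realType.
Implicit Types (a b p : 'rV[R]_3) (v w : 'rV[R]_4).

Definition up a : 'rV[R]_4 := row_mx a (1%:M : 'M_1).

Lemma upl a (k : 'I_3) : up a 0 (lshift 1 k) = a 0 k.
Proof. exact: (row_mxEl a). Qed.

Lemma upr a (k : 'I_1) : up a 0 (rshift 3 k) = 1.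
Proof. by rewrite /up (row_mxEr a) mxE ord1. Qed.

Lemma rV31P v w : (forall k : 'I_3, v 0 (lshift 1 k) = w 0 (lshift 1 k)) ->
  v 0 (rshift 3 (ord0 : 'I_1)) = w 0 (rshift 3 (ord0 : 'I_1)) -> v = w.
Proof.
move=> H1 H2; apply/matrixP => i j; rewrite ord1.
by case: (fintype.split_ordP (j : 'I_(3 + 1))) => k -> //; rewrite (ord1 k).
Qed.

Lemma upE a : [/\ up a 0 (inord 0) = a 0 (inord 0), up a 0 (inord 1) = a 0 (inord 1),
  up a 0 (inord 2) = a 0 (inord 2) & up a 0 (inord 3) = 1].
Proof.
have H (k : 'I_3) : up a 0 (inord k) = a 0 k.
  rewrite (_ : inord k = lshift 1 k) ?upl //.
  by apply: val_inj; rewrite /= inordK //; have := ltn_ord k; lia.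
split; first by rewrite -[in RHS](H (inord 0)) inordK.
- by rewrite -[in RHS](H (inord 1)) inordK.
- by rewrite -[in RHS](H (inord 2)) inordK.
rewrite (_ : inord 3 = rshift 3 (ord0 : 'I_1)).
  exact: upr.
by apply: val_inj; rewrite /= inordK.
Qed.

Lemma rV3P a b : (forall k, (k < 3)%N -> a 0 (inord k) = b 0 (inord k)) -> a = b.
Proof.
by move=> H; apply/matrixP => i j; rewrite ord1 -[j]inord_val H.
Qed.

Definition seq4 v : seq R := [seq v 0 (inord k) | k <- iota 0 4].

Lemma colX_seq v (i : 'I_6) : colX v i 0 = nth 0 (seq4 v ++ [:: 1; 0]) i.
Proof.
rewrite nth_cat size_map size_iota; case: (ltnP i 4) => i4.
  rewrite (nth_map 0%N) ?size_iota // nth_iota // add0n.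
  rewrite [i in LHS](_ : i = lshift 2 (Ordinal i4)); last exact: val_inj.
  by rewrite (col_mxEu v^T) mxE; congr (v _ _); apply: val_inj; rewrite /= inordK.
have i2 : (i - 4 < 2)%N by have := ltn_ord i; lia.
rewrite [i in LHS](_ : i = rshift 4 (Ordinal i2)); last by apply: val_inj => /=; lia.
by rewrite colXd -val_eqE /=; case: (i - 4)%N i2 => [|[]].
Qed.

Lemma colY_seq v (i : 'I_6) : colY v i 0 = nth 0 ([seq - x | x <- seq4 v] ++ [:: 0; 1]) i.
Proof.
rewrite nth_cat !size_map size_iota; case: (ltnP i 4) => i4.
  rewrite -map_comp (nth_map 0%N) ?size_iota // nth_iota // add0n.
  rewrite [i in LHS](_ : i = lshift 2 (Ordinal i4)); last exact: val_inj.
  by rewrite (col_mxEu (- v^T)) !mxE /=; congr (- v _ _); apply: val_inj; rewrite /= inordK.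
have i2 : (i - 4 < 2)%N by have := ltn_ord i; lia.
rewrite [i in LHS](_ : i = rshift 4 (Ordinal i2)); last by apply: val_inj => /=; lia.
by rewrite colYd -val_eqE /=; case: (i - 4)%N i2 => [|[]].
Qed.

Definition seqs (s t : 'rV[R]_4 * 'rV[R]_4 * 'rV[R]_4) : seq (seq R) :=
  [seq seq4 v ++ [:: 1; 0] | v <- [:: s.1.1; s.1.2; s.2]] ++
  [seq [seq - x | x <- seq4 v] ++ [:: 0; 1] | v <- [:: t.1.1; t.1.2; t.2]].

Lemma det_cols s t : \det (mxcols 6 (cols s t)) = laplace 6 (seqs s t).
Proof.
rewrite -(@det_laplace _ 6) //; congr (\det _); apply/matrixP => i j; rewrite !mxE.
by case: j => [[|[|[|[|[|[|]]]]]]] //= _; rewrite ?colX_seq ?colY_seq.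
Qed.

Definition seq3 a : seq R := [seq a 0 (inord k) | k <- iota 0 3].

Lemma det3_laplace a b p :
  det3 a b p = laplace 3 [seq seq3 x | x <- [:: a; b; p]].
Proof.
rewrite -(@det_laplace _ 3) // /det3 -det_tr; congr (\det _); apply/matrixP => i j; rewrite !mxE.
case: i j => [[|[|[|]]]] //= ? [[|[|[|]]]] //= ?; congr (fun_of_matrix _ _ _);
  by apply: val_inj; rewrite /= inordK.
Qed.


Definition cone_triangle (eta : R) (a : 'rV[R]_3 * 'rV[R]_3) : 'rV[R]_4 * 'rV[R]_4 * 'rV[R]_4 :=
  (0, eta *: up a.1, eta *: up a.2).

(** This converts the orientation of an intersection in R^4 into the orientation of a crossing in
    R^3: the two agree up to the global sign once the weight of [p] at the crossing is positive. *)
Lemma det_cone_triangles eta (a b : 'rV[R]_3 * 'rV[R]_3) p (s t u : R) :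
  (1 - s - t) *: p + s *: a.1 + t *: a.2 = b.1 + u *: (b.2 - b.1) ->
  \det (mxcols 6 (cols (cone_triangle eta a) (cone_triangle eta b))) =
  - (eta ^+ 4 * (1 - s - t) * det3 (a.1 - p) (a.2 - p) (b.2 - b.1)).
Proof.
case: a b => a1 a2 [b1 b2] /= E.
have scE (v : 'rV[R]_3) : seq4 (eta *: up v) =
    [:: eta * v 0 (inord 0); eta * v 0 (inord 1); eta * v 0 (inord 2); eta].
  case: (upE v) => v0 v1 v2 v3.
  have vE k : (eta *: up v) 0 k = eta * up v 0 k by rewrite mxE.
  by rewrite /seq4 /= !vE v0 v1 v2 v3 mulr1.
have sub3E (x y : 'rV[R]_3) : seq3 (x - y) = [:: x 0 (inord 0) - y 0 (inord 0);
    x 0 (inord 1) - y 0 (inord 1); x 0 (inord 2) - y 0 (inord 2)].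
  by rewrite /seq3 /= !mxE.
have seq40 : seq4 (0 : 'rV[R]_4) = [:: 0; 0; 0; 0] by rewrite /seq4 /= !mxE.
have Ek k : b1 0 (inord k) =
    (1 - s - t) * p 0 (inord k) + s * a1 0 (inord k) + t * a2 0 (inord k)
    - u * (b2 0 (inord k) - b1 0 (inord k)).
  by move/matrixP/(_ 0 (inord k)): E; rewrite !mxE => ->; rewrite addrK.
have sE : seqs (0, eta *: up a1, eta *: up a2) (0, eta *: up b1, eta *: up b2) =
    [:: [:: 0; 0; 0; 0; 1; 0];
     [:: eta * a1 0 (inord 0); eta * a1 0 (inord 1); eta * a1 0 (inord 2); eta; 1; 0];
     [:: eta * a2 0 (inord 0); eta * a2 0 (inord 1); eta * a2 0 (inord 2); eta; 1; 0];
     [:: 0; 0; 0; 0; 0; 1];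
     [:: - (eta * b1 0 (inord 0)); - (eta * b1 0 (inord 1)); - (eta * b1 0 (inord 2));
         - eta; 0; 1];
     [:: - (eta * (b1 0 (inord 0) + (b2 0 (inord 0) - b1 0 (inord 0))));
         - (eta * (b1 0 (inord 1) + (b2 0 (inord 1) - b1 0 (inord 1))));
         - (eta * (b1 0 (inord 2) + (b2 0 (inord 2) - b1 0 (inord 2)))); - eta; 0; 1]].
  rewrite -[LHS]/[:: seq4 0 ++ [:: 1; 0]; seq4 (eta *: up a1) ++ [:: 1; 0];
    seq4 (eta *: up a2) ++ [:: 1; 0]; [seq - x | x <- seq4 0] ++ [:: 0; 1];
    [seq - x | x <- seq4 (eta *: up b1)] ++ [:: 0; 1];
    [seq - x | x <- seq4 (eta *: up b2)] ++ [:: 0; 1]].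
  by rewrite !scE !seq40 /= oppr0 !(addrC (b1 0 _)) !subrK.
rewrite det_cols sE (laplace_cones eta (Ek 0%N) (Ek 1%N) (Ek 2%N)) det3_laplace.
rewrite -[[seq seq3 x | x <- _]]/[:: seq3 (a1 - p); seq3 (a2 - p); seq3 (b2 - b1)].
by rewrite !sub3E.
Qed.

End Crossing.

Section ConeIncidence.
Variable R : realType.
Implicit Types (a b : 'rV[R]_3 * 'rV[R]_3) (p : 'rV[R]_3) (v w : 'rV[R]_4).

Lemma big_ord6 (E : nmodType) (F : 'I_6 -> E) : \sum_(j < 6) F j =
  F (inord 0) + F (inord 1) + F (inord 2) + F (inord 3) + F (inord 4) + F (inord 5).
Proof.
rewrite !big_ord_recl big_ord0 addr0 !addrA.
by do !congr (_ + _); congr F; apply: val_inj; rewrite /= inordK.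
Qed.

Lemma cols_eq (s t : 'rV[R]_4 * 'rV[R]_4 * 'rV[R]_4) (x : 'cV[R]_6) w :
  mxcols 6 (cols s t) *m x = colW w <->
  [/\ x (inord 0) 0 + x (inord 1) 0 + x (inord 2) 0 = 1,
      x (inord 3) 0 + x (inord 4) 0 + x (inord 5) 0 = 1 &
      x (inord 0) 0 *: s.1.1 + x (inord 1) 0 *: s.1.2 + x (inord 2) 0 *: s.2
      - (x (inord 3) 0 *: t.1.1 + x (inord 4) 0 *: t.1.2 + x (inord 5) 0 *: t.2) = w].
Proof.
rewrite mul_mxcols big_ord6 !inordK //=.
move: (x (inord 0) 0) (x (inord 1) 0) (x (inord 2) 0).
move: (x (inord 3) 0) (x (inord 4) 0) (x (inord 5) 0) => y0 y1 y2 x0 x1 x2.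
pose top : 'cV[R]_4 := (x0 *: s.1.1 + x1 *: s.1.2 + x2 *: s.2
   - (y0 *: t.1.1 + y1 *: t.1.2 + y2 *: t.2))^T.
pose bot : 'cV[R]_2 := \col_i if i == 0 then x0 + x1 + x2 else y0 + y1 + y2.
rewrite (_ : _ + _ = (col_mx top bot : 'cV_6)); last first.
  apply/matrixP => i j; rewrite ord1 -[i]/(i : 'I_(4 + 2)).
  case: (fintype.split_ordP (i : 'I_(4 + 2))) => k -> {i}.
    rewrite (col_mxEu top) /top [in RHS]mxE !mxlinE !colXu !colYu; ring.
  rewrite (col_mxEd top) /bot [in RHS]mxE !mxlinE !colXd !colYd.
  by case: k => [[|[|]]] //= ?; rewrite -?val_eqE /=; ring.
split=> [E|[Ex Ey <-]].
  have [E1 E2] := @eq_col_mx _ _ _ _ top bot w^T (const_mx 1) E; split.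
  - by move/matrixP/(_ 0 0): E2; rewrite !mxE.
  - by move/matrixP/(_ 1 0): E2; rewrite !mxE.
  - exact: trmx_inj.
rewrite /colW -/top (_ : bot = const_mx 1) //; apply/matrixP => i j; rewrite !mxE Ex Ey.
by case: ifP.
Qed.

Variables (p : 'rV[R]_3) (eta r : R).
Hypotheses (eta_gt0 : 0 < eta) (r_gt0 : 0 < r).
Variables (a b : 'rV[R]_3 * 'rV[R]_3).

(** While the second triangle is translated from 0 to [- r *: up p], its outer edge never touches
    the first triangle. The whole range of [r'] matters: 0 excludes crossings of weight zero at [p],
    [r] keeps solutions off the outer edge, and intermediate values show that a crossing lies inside
    the truncated cones. *)
Hypothesis far : forall r' x1 x2 y, 0 <= r' <= r -> 0 <= x1 -> 0 <= x2 -> x1 + x2 <= 1 ->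
  0 <= y <= 1 ->
  eta *: (x1 *: up a.1 + x2 *: up a.2 - ((1 - y) *: up b.1 + y *: up b.2)) != - r' *: up p.

Hypotheses (gen1 : ~ triangle p a.1 a.2 b.1) (gen2 : ~ triangle p a.1 a.2 b.2).
Hypotheses (gen3 : (segment p a.1 `&` segment b.1 b.2 = set0)%classic)
  (gen4 : (segment p a.2 `&` segment b.1 b.2 = set0)%classic).

Let s := cone_triangle eta a.
Let t := cone_triangle eta b.

(* A solution of the incidence system of two cone triangles is, after a central
   projection, a crossing of the segment [b] with the triangle spanned by [p]
   and [a], at barycentric coordinate [1 - x1 - x2] along [p]. *)
Lemma cone_solution x1 x2 y1 y2 : 0 <= x1 -> 0 <= x2 -> 0 <= y1 -> 0 <= y2 ->
  x1 *: (eta *: up a.1) + x2 *: (eta *: up a.2)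
    - (y1 *: (eta *: up b.1) + y2 *: (eta *: up b.2)) = (- r) *: up p ->
  let m := y1 + y2 in
  [/\ r + eta * (x1 + x2) = eta * m, 0 < m &
   (1 - x1 / m - x2 / m) *: p + (x1 / m) *: a.1 + (x2 / m) *: a.2
   = b.1 + (y2 / m) *: (b.2 - b.1)].
Proof.
move=> x10 x20 y10 y20 E m.
have E4 : r + eta * (x1 + x2) = eta * m.
  have [_ _ _ p3] := upE p; have [_ _ _ a13] := upE a.1; have [_ _ _ a23] := upE a.2.
  have [_ _ _ b13] := upE b.1; have [_ _ _ b23] := upE b.2.
  move/matrixP/(_ 0 (inord 3)): E.
  rewrite !mxlinE p3 a13 a23 b13 b23 /m; lra.
have m0 : 0 < m.
  by rewrite -(pmulr_rgt0 _ eta_gt0) -E4 ltr_wpDr // mulr_ge0 ?addr_ge0 // ltW.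
split=> //.
have mn : m != 0 by rewrite gt_eqF.
have en : eta != 0 by rewrite gt_eqF.
apply/rV3P => k k3.
have upk (c : 'rV[R]_3) : up c 0 (inord k) = c 0 (inord k).
  by case: (upE c); case: k k3 => [|[|[|]]].
move/matrixP/(_ 0 (inord k)): E.
rewrite !mxlinE !upk => Ek.
have Er : r = eta * m - eta * (x1 + x2) by rewrite -E4 addrK.
move: Ek; rewrite Er => Ek.
have {}Ek : x1 * a.1 0 (inord k) + x2 * a.2 0 (inord k)
   - (y1 * b.1 0 (inord k) + y2 * b.2 0 (inord k)) + (m - x1 - x2) * p 0 (inord k) = 0.
  by apply: (mulfI en); rewrite mulr0; lra.
have y2E : y2 = m - y1 by rewrite /m; ring.
move: mn Ek; rewrite y2E; move: (m) => c mn Ek.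
by apply/eqP; rewrite -subr_eq0; apply/eqP; apply: (mulfI mn); rewrite mulr0 -Ek; field.
Qed.

Lemma cone_solution_lt x1 x2 m : r + eta * (x1 + x2) = eta * m -> 0 < m ->
  0 < 1 - x1 / m - x2 / m.
Proof.
move=> E4 m0.
have lt : x1 + x2 < m by rewrite -(ltr_pM2l eta_gt0) -E4 ltrDr.
rewrite -(pmulr_rgt0 _ m0) !mulrBr mulr1 !(mulrC m) !divfK ?gt_eqF //; lra.
Qed.

Lemma upD (u v : 'rV[R]_3) (c d : R) : c + d = 1 ->
  c *: up u + d *: up v = up (c *: u + d *: v).
Proof.
by move=> cd; apply: rV31P => [k|]; rewrite !mxlinE ?upl ?upr ?mxlinE // !mulr1.
Qed.

(** Each of the six weights is excluded from vanishing for its own reason: the origin of the second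
    triangle by [far], the origin of the first by comparing heights, the ends of [a] by the
    genericity of the segments from [p], and the ends of [b] by that of the triangles. *)
Lemma boundary_free_cones : boundary_free (- r *: up p) s t.
Proof.
move=> x x_ge0 /cols_eq[]; rewrite /s /t /=.
have x0 k : 0 <= x (inord k) 0 by [].
move: (x0 0%N) (x0 1%N) (x0 2%N) (x0 3%N) (x0 4%N) (x0 5%N) => {x0}.
set u0 := x (inord 0) 0; set u1 := x (inord 1) 0; set u2 := x (inord 2) 0.
set v0 := x (inord 3) 0; set v1 := x (inord 4) 0; set v2 := x (inord 5) 0.
move=> u00 u10 u20 v00 v10 v20 su sv; rewrite !scaler0 !add0r => E.
have [E4 m0 cross] := cone_solution u10 u20 v10 v20 E.
have al0 := cone_solution_lt E4 m0.
move: cross al0; set m := v1 + v2 => cross al0.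
have mn : m != 0 by rewrite gt_eqF.
have Hfar : v0 != 0.
  apply/eqP => v00'; have v12 : v1 + v2 = 1 by rewrite -sv v00' add0r.
  have rr : 0 <= r <= r by rewrite lexx ltW.
  have uu : u1 + u2 <= 1 by lra.
  have vv : 0 <= v2 <= 1 by apply/andP; split; lra.
  have /eqP[] := far rr u10 u20 uu vv.
  rewrite -E -v12 addrK !scalerBr !scalerDr !scalerA.
  by rewrite !(mulrC eta).
have Hu0 : u0 != 0.
  apply/eqP => u0'; have := E4.
  rewrite (_ : u1 + u2 = 1); last by rewrite -su u0' add0r.
  have : eta * m <= eta * 1 by rewrite ler_pM2l // /m; lra.
  rewrite -/m; have := r_gt0; lra.
have um1 : 0 <= u1 / m by rewrite divr_ge0 // ltW.
have um2 : 0 <= u2 / m by rewrite divr_ge0 // ltW.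
have vm : v1 / m + v2 / m = 1 by rewrite -mulrDl divff.
have vm1 : 0 <= v1 / m by rewrite divr_ge0 // ltW.
have vm2 : 0 <= v2 / m by rewrite divr_ge0 // ltW.
have inseg : segment b.1 b.2 (b.1 + (v2 / m) *: (b.2 - b.1)) by exists (v2 / m) => //; lra.
have triE : b.1 + (v2 / m) *: (b.2 - b.1) = p + (u1 / m) *: (a.1 - p) + (u2 / m) *: (a.2 - p).
  rewrite -cross !scalerBr !scalerBl scale1r.
  by rewrite !addrA; apply/eqP; rewrite -subr_eq0; apply/eqP/matrixP => i j; rewrite !mxE; ring.
have intri : triangle p a.1 a.2 (b.1 + (v2 / m) *: (b.2 - b.1)).
  by exists (u1 / m), (u2 / m); split=> //; lra.
have Hu1 : u1 != 0.
  apply/eqP => u1'; have : (set0 (b.1 + (v2 / m) *: (b.2 - b.1)))%classic.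
    rewrite -gen4; split=> //; exists (u2 / m); first lra.
    by rewrite triE u1' mul0r scale0r addr0.
  by [].
have Hu2 : u2 != 0.
  apply/eqP => u2'; have : (set0 (b.1 + (v2 / m) *: (b.2 - b.1)))%classic.
    rewrite -gen3; split=> //; exists (u1 / m); first lra.
    by rewrite triE u2' mul0r scale0r addr0.
  by [].
have Hv1 : v1 != 0.
  apply/eqP => v1'; apply: gen2.
  have vm1' : v2 / m = 1 by rewrite -vm v1' mul0r add0r.
  by move: intri; rewrite vm1' scale1r addrC subrK.
have Hv2 : v2 != 0.
  apply/eqP => v2'; apply: gen1.
  by move: intri; rewrite v2' mul0r scale0r addr0.
move=> i; rewrite -[i]inord_val.
by case: i => [[|[|[|[|[|[|]]]]]]].
Qed.

(** A crossing of weight zero at [p] would be a common point of the segments [a] and [b], which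
    [far] excludes at [r' = 0]. *)
Lemma crossing_coord_gt0 x1 x2 y : 0 <= x1 -> 0 <= x2 -> x1 + x2 <= 1 -> 0 <= y <= 1 ->
  (1 - x1 - x2) *: p + x1 *: a.1 + x2 *: a.2 = b.1 + y *: (b.2 - b.1) ->
  0 < 1 - x1 - x2.
Proof.
move=> x10 x20 x12 y01 E; rewrite lt_def; apply/andP; split; last by lra.
apply/eqP => al0.
have r0 : 0 <= (0 : R) <= r by rewrite lexx ltW.
have /eqP[] := far r0 x10 x20 x12 y01.
rewrite oppr0 scale0r !upD; [|lra|lra].
move: E; rewrite al0 scale0r add0r => ->.
rewrite (_ : b.1 + _ = (1 - y) *: b.1 + y *: b.2) ?subrr ?scaler0 //.
by apply/matrixP => i j; rewrite !mxE; ring.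
Qed.

Lemma feasible_cones :
  feasible (mxcols 6 (cols s t)) (colW (- r *: up p)) <->
  (triangle p a.1 a.2 `&` segment b.1 b.2 !=set0)%classic.
Proof.
split.
  case=> x x_ge0 /cols_eq[]; rewrite /s /t /=.
  have x0 k : 0 <= x (inord k) 0 by [].
  move: (x0 0%N) (x0 1%N) (x0 2%N) (x0 3%N) (x0 4%N) (x0 5%N) => {x0}.
  set u0 := x (inord 0) 0; set u1 := x (inord 1) 0; set u2 := x (inord 2) 0.
  set v0 := x (inord 3) 0; set v1 := x (inord 4) 0; set v2 := x (inord 5) 0.
  move=> u00 u10 u20 v00 v10 v20 su sv; rewrite !scaler0 !add0r => E.
  have [E4 m0 cross] := cone_solution u10 u20 v10 v20 E.
  have al0 := cone_solution_lt E4 m0.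
  move: cross al0; set m := v1 + v2 => cross al0.
  have mn : m != 0 by rewrite gt_eqF.
  have um1 : 0 <= u1 / m by rewrite divr_ge0 // ltW.
  have um2 : 0 <= u2 / m by rewrite divr_ge0 // ltW.
  have vm : v1 / m + v2 / m = 1 by rewrite -mulrDl divff.
  have vm1 : 0 <= v1 / m by rewrite divr_ge0 // ltW.
  have vm2 : 0 <= v2 / m by rewrite divr_ge0 // ltW.
  exists (b.1 + (v2 / m) *: (b.2 - b.1)); split.
    exists (u1 / m), (u2 / m); split=> //; first lra.
    by rewrite -cross; apply/matrixP => i j; rewrite !mxE; ring.
  by exists (v2 / m) => //; lra.
case=> z [[x1 [x2 [x10 x20 x12 zE]]] [y y01 zE']].
have cross : (1 - x1 - x2) *: p + x1 *: a.1 + x2 *: a.2 = b.1 + y *: (b.2 - b.1).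
  by rewrite -zE' zE; apply/matrixP => i j; rewrite !mxE; ring.
have al0 := crossing_coord_gt0 x10 x20 x12 y01 cross.
set al := 1 - x1 - x2 in al0 *.
(* Scaling the relation [upcross] by [eta * la] gives [up p] the coefficient [r], as the translation
   requires. *)
pose la := r / (eta * al).
have ea : 0 < eta * al by rewrite mulr_gt0.
have la0 : 0 < la by rewrite divr_gt0.
have upcross : al *: up p + x1 *: up a.1 + x2 *: up a.2 = (1 - y) *: up b.1 + y *: up b.2.
  rewrite (upD b.1 b.2); last by rewrite subrK.
  rewrite (_ : _ + y *: b.2 = b.1 + y *: (b.2 - b.1)); last first.
    by apply/matrixP => i j; rewrite !mxE; ring.
  rewrite -cross -/al; apply: rV31P => [k|]; rewrite !mxlinE ?upl ?upr ?mxlinE // /al; ring.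
(* Otherwise the outer edge would already have been hit at the smaller translation [eta * al],
   against [far]. *)
have la1 : la <= 1.
  rewrite leNgt; apply/negP => la1.
  have rlt : eta * al < r by move: la1; rewrite /la ltr_pdivlMr // mul1r.
  have er : 0 <= eta * al <= r by rewrite !ltW.
  have /eqP[] := far er x10 x20 x12 y01.
  rewrite -upcross; apply/matrixP => i j; rewrite !mxlinE; ring.
pose x : 'cV[R]_6 := \col_i nth 0 [:: 1 - la * x1 - la * x2; la * x1; la * x2;
  1 - la; la * (1 - y); la * y] i.
have la1x : la * x1 + la * x2 <= 1 by rewrite -mulrDr mulr_ile1 ?addr_ge0 // ltW.
exists x.
  move=> i j; rewrite mxE; have l0 := ltW la0.
  have l1 := mulr_ge0 l0 x10; have l2 := mulr_ge0 l0 x20.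
  have l3 : 0 <= la * y by apply: mulr_ge0 => //; lra.
  have l4 : 0 <= la * (1 - y) by apply: mulr_ge0 => //; lra.
  by case: i => [[|[|[|[|[|[|]]]]]]] //= _; lra.
apply/cols_eq; rewrite /s /t /cone_triangle /= /x !(mxE, inordK) //=.
rewrite !scaler0 !add0r; split; [ring|ring|].
have rE : r = eta * al * la by rewrite /la mulrCA divff ?mulr1 // gt_eqF.
rewrite [in RHS]rE; apply/matrixP => i j; move/matrixP/(_ i j): upcross.
rewrite !mxlinE => Ek; rewrite -[LHS]addr0.
rewrite -[X in _ + X](mulr0 (la * eta)) -(subrr ((1 - y) * up b.1 i j + y * up b.2 i j)).
by rewrite -{2}Ek; ring.
Qed.

Lemma inc_cones : inc (colW (- r *: up p)) (cols s t) = - crossing_sign p a b.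
Proof.
rewrite /inc /incidence /crossing_sign.
rewrite (asbool_equiv_eq feasible_cones); case: asboolP; last by rewrite oppr0.
case=> z [[x1 [x2 [x10 x20 x12 zE]]] [y y01 zE']].
have cross : (1 - x1 - x2) *: p + x1 *: a.1 + x2 *: a.2 = b.1 + y *: (b.2 - b.1).
  by rewrite -zE' zE; apply/matrixP => i j; rewrite !mxE; ring.
have al0 := crossing_coord_gt0 x10 x20 x12 y01 cross.
rewrite (det_cone_triangles eta cross) sgzN sgzM gtr0_sgz ?mul1r //.
by rewrite mulr_gt0 // exprn_gt0.
Qed.

End ConeIncidence.

(** * Intersection of two surfaces with a common cone point *)

Section Apex.
Variable R : realType.

Definition moment3 (z : R) : 'rV[R]_3 := \row_(i < 3) z ^+ i.+1.

(** Some nonzero functional kills [u], [v] and [w]; its value on [up (moment3 z)] is a nonzero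
    polynomial in [z]. *)
Lemma generic_span3 (u v w : 'rV[R]_4) :
  generic (fun z => forall c c1 c2 c3,
    c *: up (moment3 z) = c1 *: u + c2 *: v + c3 *: w -> c = 0).
Proof.
pose A : 'M[R]_(4, 3) := \matrix_(i, j) nth 0 [:: u; v; w] j 0 i.
have : kermx A != 0.
  rewrite kermx_eq0 /row_free; apply/eqP => rA.
  by have := rank_leq_col A; rewrite rA.
case/rowV0Pn => h /sub_kermxP hA h0.
have hE j : (j < 3)%N -> (nth 0 [:: u; v; w] j *m h^T) 0 0 = 0.
  move=> j3; move/matrixP/(_ 0 (Ordinal j3)): hA; rewrite !mxE => E0; rewrite -[RHS]E0.
  by apply: eq_bigr => k _; rewrite !mxE mulrC.
have hu : (u *m h^T) 0 0 = 0 by exact: (hE 0%N).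
have hv : (v *m h^T) 0 0 = 0 by exact: (hE 1%N).
have hw : (w *m h^T) 0 0 = 0 by exact: (hE 2).
pose hl : 'rV[R]_3 := \row_(k < 3) h 0 (lshift 1 k).
pose hr := h 0 (rshift 3 (ord0 : 'I_1)).
pose q : {poly R} := rVpoly hl * 'X + hr%:P.
have qE z : (up (moment3 z) *m h^T) 0 0 = q.[z].
  rewrite !hornerE mxE (@big_split_ord _ _ _ 3 1) /= big_ord1 upr mul1r mxE.
  congr (_ + _); rewrite (@horner_coef_wide _ 3) ?size_poly // mulr_suml.
  by apply: eq_bigr => k _; rewrite upl !mxE coef_rVpoly_ord mxE exprSr mulrC mulrA.
exists q.
  apply: contra_neq h0 => q0; have hr0 : hr = 0.
    by have := congr1 (horner^~ 0) q0; rewrite !hornerE.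
  have hl0 : hl = 0.
    apply: (can_inj rVpolyK); rewrite linear0; apply/eqP.
    by move/eqP: q0; rewrite /q hr0 addr0 mulf_eq0 polyX_eq0 orbF.
  apply: rV31P => [k|]; rewrite mxE; last exact: hr0.
  by have := congr1 (fun m : 'rV[R]_3 => m 0 k) hl0; rewrite !mxE.
move=> z qz c c1 c2 c3 /(congr1 (fun m : 'rV[R]_4 => (m *m h^T) 0 0)).
rewrite !mulmxDl -!scalemxAl !mxlinE qE hu hv hw !mulr0 !addr0 => /eqP.
by rewrite mulf_eq0 -[q.[z] == 0]rootE (negbTE qz) orbF => /eqP.
Qed.

(** A forbidden incidence writes a multiple of [up p] in terms of three fixed vectors, so the weight
    of [p] in it is zero. The incidence then takes place on the edge [a] itself and is a common
    point of [a] and [b]. *)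
Lemma generic_apex_exists (P Q : seq 'rV[R]_3) :
  (forall a b, a \in polygon_edges P -> b \in polygon_edges Q ->
     (segment a.1 a.2 `&` segment b.1 b.2 = set0)%classic) ->
  exists p, generic_apex P Q p.
Proof.
move=> disj.
suff /generic_ex[z Hz] : generic (fun z => forall a, a \in polygon_edges P ->
    forall b, b \in polygon_edges Q ->
    ~ triangle (moment3 z) a.1 a.2 b.1 /\
    (segment (moment3 z) a.1 `&` segment b.1 b.2 = set0)%classic).
  by exists (moment3 z) => a b aP bQ; apply: Hz.
apply: generic_seq => a aP; apply: generic_seq => b bQ.
have dab x : segment a.1 a.2 x -> segment b.1 b.2 x -> False.
  by move=> ax bx; have : (set0 x)%classic by rewrite -(disj a b aP bQ).
have := generic_and (generic_span3 (up b.1) (up a.1) (up a.2))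
  (generic_span3 (up a.1) (up b.1) (up b.2)).
have upk (x y : 'rV[R]_3) (c : R) : up (x + c *: (y - x)) = (1 - c) *: up x + c *: up y.
  by apply: rV31P => [k|]; rewrite !mxlinE ?upl ?upr ?mxlinE; ring.
apply: generic_sub => z [H1 H2]; split.
  case=> s [t [s0 t0 st E]].
  have : 1 - s - t = 0.
    apply: (H1 _ 1 (- s) (- t)).
    by rewrite {1}E; apply: rV31P => [k|]; rewrite !mxlinE ?upl ?upr ?mxlinE; ring.
  move=> st1; apply: (dab b.1); last by exists 0; rewrite ?lexx ?ler01 // scale0r addr0.
  exists t; first by apply/andP; split => //; lra.
  rewrite {1}E (_ : s = 1 - t); last lra.
  by apply/matrixP => i j; rewrite !mxE; ring.
apply/seteqP; split=> // x [[t t01 xE] [y y01 xE']] /=.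
have : 1 - t = 0.
  apply: (H2 _ (- t) (1 - y) y).
  have : up x = up x by []; rewrite {1}xE xE' !upk => E.
  by rewrite -addrA -E; apply/matrixP => i j; rewrite !mxlinE; ring.
move=> t1; apply: (dab a.1); first by exists 0; rewrite ?lexx ?ler01 // scale0r addr0.
exists y => //; rewrite -xE' xE (_ : t = 1); last lra.
by rewrite scale1r addrC subrK.
Qed.

End Apex.

Section Intersection.
Variable R : realType.
Implicit Types (s t : 'rV[R]_4 * 'rV[R]_4 * 'rV[R]_4) (w : 'rV[R]_4) (eps eta : R).

Definition tri s : set 'rV[R]_4 :=
  [set x | exists x0 x1 x2 : R, [/\ 0 <= x0, 0 <= x1, 0 <= x2, x0 + x1 + x2 = 1 &
    x = x0 *: s.1.1 + x1 *: s.1.2 + x2 *: s.2]]%classic.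

(** [generic_apex] speaks only of the initial points of edges; since the polygon is cyclic, it
    covers the terminal points too. *)
Lemma polygon_edges_next (T : eqType) (P : seq T) (a : T * T) :
  a \in polygon_edges P -> exists2 a', a' \in polygon_edges P & a'.1 = a.2.
Proof.
move=> aP; have sz : size P = size (rot 1 P) by rewrite size_rot.
have a2P : a.2 \in P.
  have : a.2 \in unzip2 (polygon_edges P) by apply: map_f.
  by rewrite unzip2_zip ?sz // mem_rot.
have : a.2 \in unzip1 (polygon_edges P) by rewrite unzip1_zip ?sz.
by case/mapP => a' a'P ->; exists a'.
Qed.

Lemma infeasible_inc eps w s t :
  (forall x y, tri s x -> tri t y -> exists k, eps <= `|x 0 k - y 0 k|) ->
  (forall k, `|w 0 k| < eps) ->
  boundary_free w s t /\ inc (colW w) (cols s t) = 0.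
Proof.
move=> far small.
have no (x : 'cV[R]_6) : nonneg_mx x -> mxcols 6 (cols s t) *m x = colW w -> False.
  move=> x0 /cols_eq[s1 s2 E].
  have [||k] := far (x (inord 0) 0 *: s.1.1 + x (inord 1) 0 *: s.1.2 + x (inord 2) 0 *: s.2)
    (x (inord 3) 0 *: t.1.1 + x (inord 4) 0 *: t.1.2 + x (inord 5) 0 *: t.2).
  - by exists (x (inord 0) 0), (x (inord 1) 0), (x (inord 2) 0); split.
  - by exists (x (inord 3) 0), (x (inord 4) 0), (x (inord 5) 0); split.
  have := small k; rewrite -E !mxlinE => lt le.
  by have := lt_le_trans lt le; rewrite ltxx.
split; first by move=> x x0 /(no x x0).
by rewrite /inc /incidence asboolF // => -[x x0 /(no x x0)].
Qed.

(* The translation by [- r *: up p] isolates the intersection at the common cone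
   point: nothing else of the two surfaces meets after a small translation. *)
Lemma cone_intersection_eq0 (P Q : seq 'rV[R]_3) p eta eps
    (A B : seq ('rV[R]_4 * 'rV[R]_4 * 'rV[R]_4)) :
  generic_apex P Q p -> 0 < eta -> 0 < eps ->
  closed2 ([seq cone_triangle eta a | a <- polygon_edges P] ++ A) ->
  closed2 ([seq cone_triangle eta b | b <- polygon_edges Q] ++ B) ->
  (forall s t, s \in A -> t \in [seq cone_triangle eta b | b <- polygon_edges Q] ++ B ->
     forall x y, tri s x -> tri t y -> exists k, eps <= `|x 0 k - y 0 k|) ->
  (forall s t, s \in [seq cone_triangle eta a | a <- polygon_edges P] ++ A -> t \in B ->
     forall x y, tri s x -> tri t y -> exists k, eps <= `|x 0 k - y 0 k|) ->
  (forall a b, a \in polygon_edges P -> b \in polygon_edges Q ->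
     forall x y, tri (cone_triangle eta a) x -> 0 <= y <= 1 ->
       exists k, eps <= `|x 0 k - (eta *: ((1 - y) *: up b.1 + y *: up b.2)) 0 k|) ->
  cone_intersection P Q p = 0.
Proof.
move=> gen eta0 eps0 cA cB farA farB farE.
(* [M] exceeds every coordinate of [up p], so no translation by [- r' *: up p] with [r' <= r]
   changes a coordinate by [eps] or more. *)
pose M := 1 + \sum_k `|up p 0 k|.
have M0 : 0 < M by rewrite ltr_pwDl // sumr_ge0.
pose r := eps / M.
have r0 : 0 < r by rewrite divr_gt0.
have small r' : 0 <= r' <= r -> forall k, `|(- r' *: up p) 0 k| < eps.
  move=> /andP[r'0 r'r] k; rewrite scalemxE normrM normrN (ger0_norm r'0).
  have : `|up p 0 k| < M.
    rewrite /M (bigD1 k) //= addrCA ltrDl ltr_pwDl // sumr_ge0 //.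
  move=> lt; apply: (@le_lt_trans _ _ (r * `|up p 0 k|)); first exact: ler_wpM2r.
  by rewrite /r mulrAC ltr_pdivrMr // ltr_pM2l.
have rr : 0 <= r <= r by rewrite lexx ltW.
set w := - r *: up p.
have smallw := small r rr; rewrite -/w in smallw.
have inner a b : a \in polygon_edges P -> b \in polygon_edges Q ->
    boundary_free w (cone_triangle eta a) (cone_triangle eta b) /\
    inc (colW w) (cols (cone_triangle eta a) (cone_triangle eta b)) = - crossing_sign p a b.
  move=> aP bQ.
  have far r' x1 x2 y : 0 <= r' <= r -> 0 <= x1 -> 0 <= x2 -> x1 + x2 <= 1 -> 0 <= y <= 1 ->
      eta *: (x1 *: up a.1 + x2 *: up a.2 - ((1 - y) *: up b.1 + y *: up b.2)) != - r' *: up p.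
    move=> r'r x10 x20 x12 y01; apply/eqP => E.
    have [|k] := farE a b aP bQ (eta *: (x1 *: up a.1 + x2 *: up a.2)) y _ y01.
      exists (1 - x1 - x2), x1, x2; split=> //; [lra|ring|].
      rewrite /cone_triangle /= scaler0 add0r scalerDr !scalerA.
      by rewrite (mulrC eta x1) (mulrC eta x2).
    have := small r' r'r k; rewrite -E scalerBr addmxE oppmxE => lt le.
    by have := lt_le_trans lt le; rewrite ltxx.
  have [gen1 gen3] := gen a b aP bQ.
  have gen2 : ~ triangle p a.1 a.2 b.2.
    by have [b' b'Q <-] := polygon_edges_next bQ; case: (gen a b' aP b'Q).
  have gen4 : (segment p a.2 `&` segment b.1 b.2 = set0)%classic.
    by have [a' a'P <-] := polygon_edges_next aP; case: (gen a' b a'P bQ).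
  split; first exact: boundary_free_cones.
  exact: inc_cones.
have outA s t : s \in A -> t \in [seq cone_triangle eta b | b <- polygon_edges Q] ++ B ->
    boundary_free w s t /\ inc (colW w) (cols s t) = 0.
  by move=> sA tB; apply: infeasible_inc smallw; apply: farA.
have outB s t : s \in [seq cone_triangle eta a | a <- polygon_edges P] ++ A -> t \in B ->
    boundary_free w s t /\ inc (colW w) (cols s t) = 0.
  by move=> sA tB; apply: infeasible_inc smallw; apply: farB.
have := closed2_intersection (w := w) cA cB.
have -> : \sum_(s <- [seq cone_triangle eta a | a <- polygon_edges P] ++ A)
    \sum_(t <- [seq cone_triangle eta b | b <- polygon_edges Q] ++ B) inc (colW w) (cols s t) =
    - cone_intersection P Q p.
  rewrite big_cat /= [X in _ + X]big_seq [X in _ + X]big1 ?addr0; last first.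
    by move=> s sA; rewrite big_seq big1 // => t tB; case: (outA s t sA tB).
  rewrite big_map /cone_intersection -sumrN big_seq [RHS]big_seq; apply: eq_bigr => a aP.
  rewrite big_cat /= [X in _ + X]big_seq [X in _ + X]big1 ?addr0; last first.
    by move=> t tB; apply: (proj2 (outB _ t _ tB)); rewrite mem_cat map_f.
  rewrite big_map -sumrN big_seq [RHS]big_seq; apply: eq_bigr => b bQ.
  by case: (inner a b aP bQ).
move=> /(_ _)/eqP; rewrite oppr_eq0 => H; apply/eqP/H => s t.
rewrite !mem_cat => /orP[|sA]; last by move=> tB; case: (outA s t sA) => //; rewrite mem_cat.
move=> sI /orP[tI|tB]; last by case: (outB s t _ tB) => //; rewrite mem_cat sI.
by case/mapP: sI => a aP ->; case/mapP: tI => b bQ ->; case: (inner a b aP bQ).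
Qed.

End Intersection.

(** * Triangulated discs as chains *)

Section DiscChain.
Variables (I : eqType) (Y E : Type) (m : nat) (pt : I -> nat -> Y).

(** In its use the points [h k] lie on a segment starting at [a]: the triangles are degenerate and
    only replace a long edge by [m] short ones. *)
Definition fan (a : E) (h : nat -> E) : seq (E * E * E) :=
  [seq (a, h k, h k.+1) | k <- iota 0 m].

(** A grid of squares, each cut by a diagonal: [k] runs along the edge [i] and [j] along the
    homotopy [S]. *)
Definition strip (S : Y -> nat -> E) (i : I) : seq (E * E * E) :=
  flatten [seq flatten [seq
    [:: (S (pt i k) j.+1, S (pt i k.+1) j.+1, S (pt i k.+1) j);
        (S (pt i k) j.+1, S (pt i k.+1) j, S (pt i k) j)] | j <- iota 0 m] | k <- iota 0 m].

Variable phi : E -> E -> int.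
Hypothesis antisym : forall a b, phi a b = - phi b a.

Lemma antisym0 a : phi a a = 0.
Proof. by have := antisym a a; lia. Qed.

Lemma sum_fan a h :
  \sum_(T <- fan a h) triple_sum phi T =
  \sum_(0 <= k < m) phi (h k) (h k.+1) + phi a (h 0%N) - phi a (h m).
Proof.
rewrite /fan big_map (_ : iota 0 m = index_iota 0 m); last by rewrite /index_iota subn0.
rewrite -addrA -opprB -(telescope_sumr (fun k => phi a (h k)) (leq0n m)) -sumrN -big_split.
by apply: eq_bigr => k _; rewrite /triple_sum /= (antisym (h k.+1) a); ring.
Qed.

Lemma sum_strip (S : Y -> nat -> E) i :
  \sum_(T <- strip S i) triple_sum phi T =
  \sum_(0 <= k < m) phi (S (pt i k) m) (S (pt i k.+1) m) -
  \sum_(0 <= k < m) phi (S (pt i k) 0%N) (S (pt i k.+1) 0%N) +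
  (\sum_(0 <= j < m) phi (S (pt i 0%N) j) (S (pt i 0%N) j.+1) -
   \sum_(0 <= j < m) phi (S (pt i m) j) (S (pt i m) j.+1)).
Proof.
pose N k := \sum_(0 <= j < m) phi (S (pt i k) j) (S (pt i k) j.+1).
rewrite -!/(N _) /strip big_flatten big_map (_ : iota 0 m = index_iota 0 m); last by rewrite /index_iota subn0.
rewrite -[N 0%N - N m]opprB -(telescope_sumr N (leq0n m)) -sumrB -sumrN -big_split /=.
apply: eq_bigr => k _; rewrite big_flatten big_map /N.
pose r j := phi (S (pt i k) j) (S (pt i k.+1) j).
rewrite -/(r m) -/(r 0%N) -(telescope_sumr r (leq0n m)) -sumrB -sumrN -big_split /=.
apply: eq_bigr => j _; rewrite big_cons big_seq1 /triple_sum /r /=.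
rewrite (antisym (S (pt i k.+1) j) (S (pt i k) j.+1)).
rewrite (antisym (S (pt i k.+1) j) (S (pt i k) j)).
rewrite (antisym (S (pt i k.+1) j.+1) (S (pt i k.+1) j)); ring.
Qed.

End DiscChain.

(* A closed polygon is filled by the cone with apex [O] on one side and, on the
   other side, by fans refining its edges followed by a homotopy in two stages
   to a constant polygon. *)
Lemma disc_closed (I : eqType) (Y E : Type) (m : nat) (pt : I -> nat -> Y) (XE : seq I)
    (S1 S2 : Y -> nat -> E) (O c : E) :
  (forall g : Y -> int, \sum_(i <- XE) g (pt i 0%N) = \sum_(i <- XE) g (pt i m)) ->
  (forall i k, i \in XE -> (k <= m)%N -> S1 (pt i k) m = S2 (pt i k) 0%N) ->
  (forall y, S2 y m = c) ->
  closed2 ([seq (O, S1 (pt i 0%N) 0%N, S1 (pt i m) 0%N) | i <- XE] ++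
    flatten [seq fan m (S1 (pt i 0%N) 0%N) (fun k => S1 (pt i k) 0%N) ++
      (strip m pt S1 i ++ strip m pt S2 i) | i <- XE]).
Proof.
move=> closed glue const phi anti; have phi0 := antisym0 anti.
rewrite big_cat big_map big_flatten big_map /= -big_split /= big_seq.
pose N (S : Y -> nat -> E) y := \sum_(0 <= j < m) phi (S y j) (S y j.+1).
(* [n y] collects the contributions of an endpoint [y] of an edge: the edge to [O] and the tracks of
   both homotopies. Around a closed polygon they occur once with each sign. *)
pose n y := phi O (S1 y 0%N) + N S1 y + N S2 y.
transitivity (\sum_(i <- XE | i \in XE) (n (pt i 0%N) - n (pt i m))); last first.
  by rewrite -big_seq sumrB closed subrr.
apply: eq_bigr => i iXE; rewrite !big_cat /= sum_fan // !sum_strip // /triple_sum /= -!/(N _ _).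
have -> : \sum_(0 <= k < m) phi (S1 (pt i k) m) (S1 (pt i k.+1) m) =
    \sum_(0 <= k < m) phi (S2 (pt i k) 0%N) (S2 (pt i k.+1) 0%N).
  by apply: eq_big_nat => k /andP[_ km]; rewrite !glue // ltnW.
rewrite [X in _ + (X - _ + (N S2 _ - _))]big1; last by move=> k _; rewrite !const phi0.
by rewrite phi0 (anti (S1 (pt i m) 0%N) O) /n; ring.
Qed.

(** * Compactness *)

Section PolyGap.
Import ArrowAsProduct.
Variable R : realType.

Lemma continuous_lin (I : finType) (c : I -> R) :
  continuous ((fun y => \sum_i c i * y i) : (I -> R) -> R).
Proof.
move=> y; have : (fun y : I -> R => \sum_i c i * y i) = \sum_i (fun y : I -> R => c i * y i).
  by apply/funext => z; rewrite fct_sumE.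
move=> ->; elim/big_ind: _ => [|f g cf cg|i _].
- exact: cst_continuous.
- exact: continuousD.
- apply: continuousM; first exact: cst_continuous.
  exact: proj_continuous.
Qed.

Lemma continuous_l1 (I J : finType) (B : J -> I -> R) :
  continuous ((fun y => \sum_j `|\sum_i B j i * y i|) : (I -> R) -> R).
Proof.
move=> y; have : (fun y : I -> R => \sum_j `|\sum_i B j i * y i|)
    = \sum_j (fun y : I -> R => `|\sum_i B j i * y i|).
  by apply/funext => z; rewrite fct_sumE.
move=> ->; elim/big_ind: _ => [|f g cf cg|j _].
- exact: cst_continuous.
- exact: continuousD.
- apply: (continuous_comp (continuous_lin (c := B j) (x := y))); exact: norm_continuous.
Qed.

Lemma closed_halfspace (I : finType) (c : I -> R) (a : R) :
  closed ([set y : I -> R | \sum_i c i * y i <= a]%classic : set (I -> R)).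
Proof.
have H := preimage_closed (fun y _ => continuous_lin (c := c) (x := y)) (@closed_le R a).
exact: H.
Qed.

(* Compactness enters only here: on a compact polytope, linear forms without a
   common zero are uniformly bounded away from having one. *)
Lemma polytope_gap (I J1 J2 : finType) (A : J1 -> I -> R) (a : J1 -> R) (B : J2 -> I -> R) :
  (forall y : I -> R, (forall i, 0 <= y i <= 1) ->
     (forall j, \sum_i A j i * y i <= a j) -> exists j, \sum_i B j i * y i != 0) ->
  exists2 d : R, 0 < d & forall y : I -> R, (forall i, 0 <= y i <= 1) ->
     (forall j, \sum_i A j i * y i <= a j) -> exists j, d <= `|\sum_i B j i * y i|.
Proof.
move=> noZ.
pose box : set (I -> R) := [set y | forall i, 0 <= y i <= 1]%classic.
have cbox : compact box.
  by apply: (@tychonoff I (fun _ => R) (fun _ => [set x : R | 0 <= x <= 1]%classic)) => i;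
    rewrite -set_itvcc; exact: segment_compact.
pose C : set (I -> R) := [set y | forall j, \sum_i A j i * y i <= a j]%classic.
have closedC : closed C.
  rewrite (_ : C = \bigcap_j [set y | \sum_i A j i * y i <= a j])%classic; last first.
    apply/seteqP; split=> y /= H j; first by move=> _; exact: H.
    exact: H.
  apply: closed_bigI => j _.
  exact: closed_halfspace.
have cS : compact (box `&` C)%classic by exact: compact_closedI.
have [S0|S0] := pselect ((box `&` C)%classic !=set0)%classic; last first.
  by exists 1 => // y y01 yA; case: S0; exists y.
have [y0] := compact_EVT_min S0 cS (continuous_subspaceT (@continuous_l1 I J2 B)).
rewrite inE => -[y0box y0C] y0min.
have y01 i : 0 <= y0 i <= 1 by exact: y0box.
pose m := \sum_j `|\sum_i B j i * y0 i|.
have m0 : 0 < m.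
  have [j yj] := noZ y0 y01 y0C.
  by rewrite /m (bigD1 j) //= ltr_pwDl ?normr_gt0 // sumr_ge0.
exists (m / #|J2|.+1%:R); first by rewrite divr_gt0.
move=> y yb yC; apply: contrapT => nj.
have lt j : `|\sum_i B j i * y i| <= m / #|J2|.+1%:R.
  by rewrite leNgt; apply/negP => lt; apply: nj; exists j; apply: ltW.
have : m <= \sum_j `|\sum_i B j i * y i|.
  apply: y0min; by rewrite inE.
apply/negP; rewrite -ltNge.
apply: (@le_lt_trans _ _ (\sum_(j : J2) m / #|J2|.+1%:R)); first exact: ler_sum.
rewrite sumr_const -[X in X < _]mulr_natr mulrAC ltr_pdivrMr // ltr_pM2l //.
by rewrite ltr_nat.
Qed.

End PolyGap.

Section Realizations.
Variable R : realType.

Lemma common_small (T : finType) (P : T -> R -> Prop) :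
  (forall t d d', 0 < d' <= d -> P t d -> P t d') ->
  (forall t, exists2 d, 0 < d & P t d) -> exists2 d, 0 < d & forall t, P t d.
Proof.
move=> mono ex.
suff [d d0 Hd] : exists2 d, 0 < d & forall t, t \in enum T -> P t d.
  by exists d => // t; apply: Hd; rewrite mem_enum.
elim: (enum T) => [|t s [d d0 IH]]; first by exists 1.
have [d' d'0 Pd'] := ex t; have md : 0 < Num.min d d' by rewrite lt_min d0.
exists (Num.min d d') => // u; rewrite inE => /predU1P[->|us].
  by apply: mono Pd'; rewrite md ge_min lexx orbT.
by apply: mono (IH u us); rewrite md ge_min lexx.
Qed.

Definition sp (V : finType) (x : V -> R) : {set V} := [set v | x v != 0]%SET.

(* Points of a realization as plain functions: this keeps all computations in R
   rather than in R^o. *)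
Definition rz (V : finType) (K : {set {set V}}) (x : V -> R) : Prop :=
  [/\ forall v, 0 <= x v, \sum_v x v = 1 & sp x \in K].

Definition bc (V W : finType) (p : W -> V -> R) (y : W -> R) : V -> R :=
  fun v => \sum_w y w * p w v.

Lemma rz_le1 (V : finType) (K : {set {set V}}) x v : rz K x -> 0 <= x v <= 1.
Proof.
by case=> x0 <- _; rewrite x0 (bigD1 v) //= lerDl sumr_ge0.
Qed.

(** Uniform continuity of the [be] values as functions of the [al] values. For two closed simplices
    and one coordinate [k], the pairs of points whose [be] values differ by at least [eps] form a
    polytope, on which the differences of the [al] values have no common zero; [polytope_gap]
    applies. *)
Lemma rz_modulus (W J1 J2 : finType) (K : {set {set W}}) (al : J1 -> W -> R) (be : J2 -> W -> R) :
  finset.set0 \notin K ->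
  (forall s t : {set W}, s \in K -> t \subset s -> t != finset.set0 -> t \in K) ->
  (forall y y', rz K y -> rz K y' ->
    (forall j, \sum_w y w * al j w = \sum_w y' w * al j w) ->
    forall k, \sum_w y w * be k w = \sum_w y' w * be k w) ->
  forall eps : R, 0 < eps -> exists2 d : R, 0 < d & forall y y', rz K y -> rz K y' ->
    (forall j, `|\sum_w y w * al j w - \sum_w y' w * al j w| < d) ->
    forall k, `|\sum_w y w * be k w - \sum_w y' w * be k w| < eps.
Proof.
move=> K0 Kd inj eps eps0.
pose Q (t : {set W} * {set W} * J2) (d : R) := forall y y', rz K y -> rz K y' ->
  sp y = t.1.1 -> sp y' = t.1.2 ->
  (forall j, `|\sum_w y w * al j w - \sum_w y' w * al j w| < d) ->
  \sum_w y w * be t.2 w - \sum_w y' w * be t.2 w < eps.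
have mono t (d d' : R) : 0 < d' <= d -> Q t d -> Q t d'.
  move=> /andP[_ dd'] H y y' ry ry' sy sy' Hj; apply: H => // j.
  exact: lt_le_trans (Hj j) dd'.
suff ex t : exists2 d : R, 0 < d & Q t d.
  have [d d0 Qd] := common_small mono ex; exists d => // y y' ry ry' Hj k.
  rewrite ltr_norml; apply/andP; split; last by apply: (Qd (sp y, sp y', k)).
  rewrite ltrNl opprB; apply: (Qd (sp y', sp y, k)) => // j.
  by rewrite distrC.
case: t => [[s s'] k].
have [/andP[sK s'K]|sK] := boolP ((s \in K) && (s' \in K)); last first.
  by exists 1 => // y y' [_ _ yK] [_ _ yK'] /= sys sys'; rewrite -sys -sys' yK yK' in sK.
pose sd (f g : W -> R) (i : W + W) := match i with inl w => f w | inr w => g w end.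
have sdE f g (y : W + W -> R) : \sum_i sd f g i * y i =
    \sum_w y (inl w) * f w + \sum_w y (inr w) * g w.
  by rewrite big_sumType /=; congr (_ + _); apply: eq_bigr => w _; rewrite mulrC.
(* The constraints on a pair of points: each sum condition as two inequalities of opposite sign,
   vanishing outside [s] and [s'] as [<= 0], and the gap of size [eps]. *)
pose A (j : bool * bool + (W + W) + unit) : W + W -> R := match j with
  | inl (inl (sg, true)) => sd (fun=> (-1) ^+ sg) (fun=> 0)
  | inl (inl (sg, false)) => sd (fun=> 0) (fun=> (-1) ^+ sg)
  | inl (inr (inl w)) => sd (fun v => ((v == w) && (w \notin s))%:R) (fun=> 0)
  | inl (inr (inr w)) => sd (fun=> 0) (fun v => ((v == w) && (w \notin s'))%:R)
  | inr _ => sd (fun w => - be k w) (be k) end.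
pose a (j : bool * bool + (W + W) + unit) : R := match j with
  | inl (inl (sg, _)) => (-1) ^+ sg | inl (inr _) => 0 | inr _ => - eps end.
pose B (j : J1) := sd (al j) (fun w => - al j w).
have sum0 (f : W -> R) : \sum_w f w * 0 = 0 by rewrite big1 // => w _; rewrite mulr0.
have sumd (f : W -> R) w (b : bool) : \sum_v f v * ((v == w) && b)%:R = f w * b%:R.
  by rewrite (bigD1 w) //= eqxx big1 ?addr0 // => v /negbTE ->; rewrite mulr0.
have sumN (f g : W -> R) : \sum_w f w * - g w = - \sum_w f w * g w.
  by rewrite -sumrN; apply: eq_bigr => w _; rewrite mulrN.
have AE y : (forall j, \sum_i A j i * y i <= a j) <->
  [/\ \sum_w y (inl w) = 1 /\ \sum_w y (inr w) = 1,
      forall w, w \notin s -> y (inl w) <= 0, forall w, w \notin s' -> y (inr w) <= 0 &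
      eps <= \sum_w y (inl w) * be k w - \sum_w y (inr w) * be k w].
  split=> [H|[[H1 H2] H3 H4 H5]].
    have sgn (f : W -> R) : - \sum_(w : W) f w * -1 = \sum_w f w.
      by rewrite -sumrN; apply: eq_bigr => w _; rewrite mulrN1 opprK.
    have one (f : W -> R) : \sum_(w : W) f w * 1 = \sum_w f w by apply: eq_bigr => w _; rewrite mulr1.
    split.
    - move: (H (inl (inl (false, true)))) (H (inl (inl (true, true))))
        (H (inl (inl (false, false)))) (H (inl (inl (true, false)))) => {H}.
      rewrite /= !sdE !sum0 !expr0 !expr1 !one -(sgn (fun w => y (inl w))) -(sgn (fun w => y (inr w))) /=.
      move=> h1 h2 h3 h4; have := sgn (fun w => y (inl w)); have := sgn (fun w => y (inr w)) => /= s1 s2.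
      by split; apply/eqP; rewrite eq_le; apply/andP; split; lra.
    - move=> w ws; have := H (inl (inr (inl w))).
      by rewrite /= sdE sum0 sumd ws mulr1 addr0.
    - move=> w ws; have := H (inl (inr (inr w))).
      by rewrite /= sdE sum0 sumd ws mulr1 add0r.
    - by have := H (inr tt); rewrite /= sdE sumN; lra.
  move=> [[[[] []]|[w|w]]|[]]; rewrite /= sdE ?sum0 ?addr0 ?add0r ?expr0 ?expr1.
  - by rewrite -mulr_suml H1 mul1r.
  - by rewrite -mulr_suml H2 mul1r.
  - by rewrite -mulr_suml H1 mul1r.
  - by rewrite -mulr_suml H2 mul1r.
  - by rewrite sumd; case: (boolP (w \in s)) => ws; rewrite ?mulr0 ?mulr1 // H3.
  - by rewrite sumd; case: (boolP (w \in s')) => ws; rewrite ?mulr0 ?mulr1 // H4.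
  - by rewrite sumN; lra.
have BE j y : \sum_i B j i * y i =
    \sum_w y (inl w) * al j w - \sum_w y (inr w) * al j w by rewrite sdE sumN.
have rzI (t : {set W}) (z : W -> R) : t \in K -> (forall w, 0 <= z w) -> \sum_w z w = 1 ->
    (forall w, w \notin t -> z w <= 0) -> rz K z.
  move=> tK z0 z1 zt; split=> //; apply: (Kd t) => //.
    apply/fintype.subsetP => w; rewrite inE; apply: contraR => wt.
    by rewrite eq_le z0 zt.
  apply/set0Pn; apply: contrapT => no; move/eqP: z1; rewrite big1 ?(eq_sym 0) ?oner_eq0 // => w _.
  by apply/eqP/negPn/negP => zw; apply: no; exists w; rewrite inE.
have [] := @polytope_gap R _ _ _ A a B.
  move=> y y01 /AE[[y1 y1'] ys ys' gap]; apply: contrapT => no.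
  have y0 i : 0 <= y i by case/andP: (y01 i).
  have := inj _ _ (rzI s (fun w => y (inl w)) sK (fun _ => y0 _) y1 ys)
    (rzI s' (fun w => y (inr w)) s'K (fun _ => y0 _) y1' ys').
  move=> /(_ _ k) /= eqk; move: gap; rewrite eqk ?subrr => [|j]; first by rewrite leNgt eps0.
  apply/eqP; rewrite -subr_eq0 -BE; apply: contrapT => /negP nz; apply: no; exists j; exact: nz.
move=> d d0 Hd; exists d => // y y' ry ry' /= sys sys' small; rewrite ltNge; apply/negP => gap.
pose z i := match i with inl w => y w | inr w => y' w end.
have [||j] := Hd z.
- case=> w; [exact: rz_le1 ry|exact: rz_le1 ry'].
- have [y0 y1 _] := ry; have [y0' y1' _] := ry'; apply/AE; split=> //= w ws.
    have : w \notin sp y by rewrite sys.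
    by rewrite inE negbK => /eqP ->.
  have : w \notin sp y' by rewrite sys'.
  by rewrite inE negbK => /eqP ->.
by rewrite BE /= leNgt small.
Qed.

End Realizations.

(** * Piecewise linear maps in plain coordinates *)

Section PlainFunctions.
Variable R : realType.

Definition toff (V : finType) (x : V -> R) : {ffun V -> R^o} := [ffun v => x v : R^o].

Lemma toffK (V : finType) (x : V -> R) : (fun v => toff x v : R) = x.
Proof. by apply/funext => v; rewrite ffunE. Qed.

Lemma toff_fun (V : finType) (x : {ffun V -> R^o}) : toff (fun v => x v) = x.
Proof. by apply/ffunP => v; rewrite ffunE. Qed.

Lemma realizationP (V : finType) (K : {set {set V}}) (x : {ffun V -> R^o}) :
  realization K x <-> rz K (fun v => x v : R).
Proof. by []. Qed.

Lemma realization_toff (V : finType) (K : {set {set V}}) (x : V -> R) :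
  realization K (toff x) <-> rz K x.
Proof. by rewrite realizationP toffK. Qed.

Lemma barycenterE (V W : finType) (p : W -> {ffun V -> R^o}) (y : {ffun W -> R^o}) :
  barycenter p y = toff (bc (fun w v => p w v : R) (fun w => y w : R)).
Proof.
apply/ffunP => v; rewrite /barycenter sum_ffunE ffunE; apply: eq_bigr => w _.
by rewrite ffunE.
Qed.

Definition pl_data (V W : finType) (K : {set {set V}}) (K' : {set {set W}})
    (p : W -> V -> R) (E : lmodType R) (F : (V -> R) -> E) : Prop :=
  [/\ [/\ is_complex K',
      forall s, s \in K' -> exists2 t, t \in K & forall w, w \in s -> sp (p w) \subset t,
      forall y, rz K' y -> rz K (bc p y) &
      forall y y', rz K' y -> rz K' y' -> bc p y = bc p y' -> y = y'],
      forall x, rz K x -> exists2 y, rz K' y & x = bc p y,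
      forall y, rz K' y -> F (bc p y) = \sum_w y w *: F (p w) &
      forall x x', rz K x -> rz K x' -> F x = F x' -> x = x'].

Lemma PL_embeddable_data (V : finType) (K : {set {set V}}) d :
  PL_embeddable R K d ->
  exists (W : finType) (K' : {set {set W}}) (p : W -> V -> R) (F : (V -> R) -> 'rV[R]_d),
    pl_data K K' p F.
Proof.
move=> [f [[W [K' [p [[cK' bij simp] lin]]]] inj]].
exists W, K', (fun w v => p w v : R), (fun x => f (toff x)).
have bcE y : toff (bc (fun w v => p w v : R) y) = barycenter p (toff y).
  by rewrite barycenterE toffK.
split; first split.
- by [].
- move=> s /simp[t tK Ht]; exists t => // w /Ht; exact.
- move=> y /realization_toff ry; apply/realization_toff; rewrite bcE.
  by case: bij => bij _ _; exact: bij.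
- move=> y y' /realization_toff ry /realization_toff ry' E.
  have : toff y = toff y'.
    by apply: (set_bij_inj bij); rewrite ?inE // -!bcE E.
  by move/(congr1 (fun x : {ffun W -> R^o} => fun v => x v : R)); rewrite !toffK.
- move=> x /realization_toff rx; case: bij => _ _ /(_ _ rx)[y ry E].
  exists (fun w => y w : R); first exact/realizationP.
  by move/(congr1 (fun x : {ffun V -> R^o} => fun v => x v : R)): E; rewrite toffK barycenterE toffK.
- move=> y /realization_toff ry; rewrite bcE (lin _ ry) /barycenter.
  by apply: eq_bigr => w _; rewrite /= ffunE toff_fun.
- move=> x x' /realization_toff rx /realization_toff rx' E.
  have : toff x = toff x' by apply: inj; rewrite ?inE.
  by move/(congr1 (fun x : {ffun V -> R^o} => fun v => x v : R)); rewrite !toffK.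
Qed.

Lemma pl_data_embedding (V W : finType) (K : {set {set V}}) (K' : {set {set W}})
    (p : W -> V -> R) d (F : (V -> R) -> 'rV[R]_d) :
  pl_data K K' p F -> PL_embedding K (fun x : {ffun V -> R^o} => F (fun v => x v : R)).
Proof.
move=> [[cK' simp sub inj] surj lin injF]; split; last first.
  move=> x x'; rewrite !inE => /realizationP rx /realizationP rx' /injF E.
  by rewrite -[x]toff_fun -[x']toff_fun E.
exists W, K', (fun w => toff (p w)); split; last first.
  move=> y /realizationP ry; rewrite barycenterE.
  have -> : (fun w v => toff (p w) v : R) = p by apply/funext => w; exact: toffK.
  rewrite toffK lin // /barycenter; apply: eq_bigr => w _ /=.
  by rewrite toffK.
have pE : (fun w v => toff (p w) v : R) = p by apply/funext => w; exact: toffK.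
split=> //.
- split=> [y /realizationP ry|y y'|x /realizationP /surj[y ry xE]].
  + by rewrite barycenterE pE; apply/realization_toff/sub.
  + rewrite !inE => /realizationP ry /realizationP ry'; rewrite !barycenterE pE.
    move/(congr1 (fun x : {ffun V -> R^o} => fun v => x v : R)); rewrite !toffK => /inj E.
    by rewrite -[y]toff_fun -[y']toff_fun E.
  + exists (toff y); first exact/realization_toff.
    by rewrite barycenterE pE toffK -xE toff_fun.
move=> s /simp[t tK Ht]; exists t => // w /Ht.
suff -> : supp (toff (p w)) = sp (p w) by []. 
 by apply/setP => v; rewrite !inE ffunE.
Qed.

End PlainFunctions.

(** * Conic subdivisions *)

Section Cones.
Variable R : realType.

Definition mass (V : finType) (x : V -> R) : R := \sum_v x v.

Definition in_cone (V : finType) (K : {set {set V}}) (x : V -> R) : Prop :=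
  (forall v, 0 <= x v) /\ (sp x = finset.set0 \/ sp x \in K).

(** A homogeneous form of [subdivision], for the infinite cone over the realization of [L]: [q w]
    generates a ray, and its length is immaterial. *)
Definition conic_subdiv (V W : finType) (L : {set {set V}}) (K : {set {set W}})
    (q : W -> V -> R) : Prop :=
  [/\ is_complex K,
      forall s, s \in K -> exists2 t, t \in L & forall w, w \in s -> sp (q w) \subset t,
      forall w, [set w]%SET \in K -> (forall v, 0 <= q w v) /\ 0 < mass (q w),
      forall y y', in_cone K y -> in_cone K y' -> bc q y = bc q y' -> y = y' &
      forall x, in_cone L x -> exists2 y, in_cone K y & x = bc q y].

Definition linear_on (V W : finType) (K : {set {set W}}) (q : W -> V -> R)
    (E : lmodType R) (G : (V -> R) -> E) : Prop :=
  forall y, in_cone K y -> G (bc q y) = \sum_w y w *: G (q w).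

Lemma notin_sp (V : finType) (x : V -> R) v : v \notin sp x -> x v = 0.
Proof. by rewrite inE negbK => /eqP. Qed.

Lemma sp0 (V : finType) (x : V -> R) : sp x = finset.set0 -> x = fun=> 0.
Proof. by move=> s0; apply/funext => v; apply: notin_sp; rewrite s0 inE. Qed.

Lemma sp_scale (V : finType) c (x : V -> R) : c != 0 -> sp (fun v => c * x v) = sp x.
Proof. by move=> c0; apply/setP => v; rewrite !inE mulf_eq0 (negbTE c0). Qed.

Lemma sp_sub (V : finType) (x y : V -> R) :
  (forall v, y v = 0 -> x v = 0) -> sp x \subset sp y.
Proof.
move=> H; apply/fintype.subsetP => v; rewrite !inE; apply: contraNneq => yv.
by rewrite H.
Qed.

Lemma mass_ge0 (V : finType) (x : V -> R) : (forall v, 0 <= x v) -> 0 <= mass x.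
Proof. by move=> x0; apply: sumr_ge0. Qed.

Lemma le_mass (V : finType) (x : V -> R) v : (forall v, 0 <= x v) -> x v <= mass x.
Proof. by move=> x0; rewrite /mass (bigD1 v) //= lerDl sumr_ge0. Qed.

Lemma mass_gt0 (V : finType) (x : V -> R) :
  (forall v, 0 <= x v) -> sp x != finset.set0 -> 0 < mass x.
Proof.
move=> x0 /set0Pn[v]; rewrite inE => xv; apply: lt_le_trans (le_mass v x0).
by rewrite lt_def xv x0.
Qed.

Lemma mass_scale (V : finType) c (x : V -> R) : mass (fun v => c * x v) = c * mass x.
Proof. by rewrite /mass mulr_sumr. Qed.

Lemma mass_bc (V W : finType) (q : W -> V -> R) y :
  mass (bc q y) = \sum_w y w * mass (q w).
Proof. by rewrite /mass /bc exchange_big; apply: eq_bigr => w _; rewrite mulr_sumr. Qed.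

Lemma bc_scale (V W : finType) (q : W -> V -> R) c y :
  bc q (fun w => c * y w) = fun v => c * bc q y v.
Proof.
by apply/funext => v; rewrite /bc mulr_sumr; apply: eq_bigr => w _; rewrite mulrA.
Qed.

Lemma in_cone_scale (V : finType) (K : {set {set V}}) c (x : V -> R) :
  0 <= c -> in_cone K x -> in_cone K (fun v => c * x v).
Proof.
rewrite le_eqVlt => /predU1P[<-|c0] [x0 xK].
  split=> [v|]; first by rewrite mul0r.
  by left; apply/setP => v; rewrite !inE mul0r eqxx.
split=> [v|]; first by rewrite mulr_ge0 // ltW.
by rewrite sp_scale ?gt_eqF.
Qed.

Lemma in_cone_sub (V : finType) (K : {set {set V}}) (t : {set V}) (x : V -> R) :
  is_complex K -> t \in K -> (forall v, 0 <= x v) -> sp x \subset t -> in_cone K x.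
Proof.
move=> [_ Kd] tK x0 xt; split=> //.
by have [->|n0] := eqVneq (sp x) finset.set0; [left|right; apply: Kd xt n0].
Qed.

Lemma in_cone0 (V : finType) (K : {set {set V}}) : in_cone K (fun=> 0).
Proof. by split=> //; left; apply/setP => v; rewrite !inE eqxx. Qed.

Lemma rz_cone (V : finType) (K : {set {set V}}) x :
  is_complex K -> rz K x <-> in_cone K x /\ mass x = 1.
Proof.
move=> [K0 _]; split=> [[x0 x1 xK]|[[x0 [x00|xK]] x1]]; first by split=> //; split=> //; right.
  by move/eqP: x1; rewrite (sp0 x00) /mass big1 // eq_sym oner_eq0.
by split.
Qed.

Definition delta (W : finType) (w : W) : W -> R := fun v => (v == w)%:R.

Lemma sp_delta (W : finType) (w : W) : sp (delta w) = [set w]%SET.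
Proof. by apply/setP => v; rewrite !inE /delta pnatr_eq0 eqb0 negbK. Qed.

Lemma sum_delta (W : finType) (w : W) (E : lmodType R) (f : W -> E) :
  \sum_v delta w v *: f v = f w.
Proof.
rewrite (bigD1 w) //= /delta eqxx scale1r big1 ?addr0 // => v /negbTE ->.
by rewrite scale0r.
Qed.

Lemma bc_delta (V W : finType) (q : W -> V -> R) w : bc q (delta w) = q w.
Proof. by apply/funext => v; apply: (sum_delta w (fun w => q w v : R^o)). Qed.

Lemma mass_delta (W : finType) (w : W) : mass (delta w) = 1.
Proof.
rewrite /mass (bigD1 w) //= big1 ?addr0 /delta ?eqxx // => v /negbTE ->; exact: erefl.
Qed.

Lemma rz_delta (W : finType) (K : {set {set W}}) w : [set w]%SET \in K -> rz K (delta w).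
Proof.
by move=> wK; split=> [v||]; [rewrite ler0n|exact: mass_delta|rewrite sp_delta].
Qed.

Lemma delta_cone (W : finType) (K : {set {set W}}) w : [set w]%SET \in K -> in_cone K (delta w).
Proof. by case/rz_delta => ? _ ?; split=> //; right. Qed.

Lemma delta_inj (W : finType) : injective (@delta W).
Proof. by move=> w w' /(congr1 (fun f => sp f)); rewrite !sp_delta => /set1_inj. Qed.

Lemma vertex_in (W : finType) (K : {set {set W}}) (s : {set W}) w :
  is_complex K -> s \in K -> w \in s -> [set w]%SET \in K.
Proof.
move=> [_ Kd] sK ws; apply: Kd sK _ _; first by rewrite finset.sub1set.
by apply/set0Pn; exists w; rewrite inE.
Qed.

Lemma cone_vertex (W : finType) (K : {set {set W}}) y w :
  is_complex K -> in_cone K y -> y w != 0 -> [set w]%SET \in K.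
Proof.
move=> cK [_ [y0|yK]] yw; first by rewrite (sp0 y0) eqxx in yw.
by apply: (vertex_in cK yK); rewrite inE.
Qed.

Lemma bc_cone (V W : finType) (L : {set {set V}}) (K : {set {set W}}) q y :
  is_complex L -> conic_subdiv L K q -> in_cone K y -> in_cone L (bc q y).
Proof.
move=> cL [cK simp pos _ _] yc; have [y0 yK] := yc.
have b0 v : 0 <= bc q y v.
  apply: sumr_ge0 => w _; have [->|yw] := eqVneq (y w) 0; first by rewrite mul0r.
  by rewrite mulr_ge0 //; case: (pos w (cone_vertex cK yc yw)).
case: yK => [ys|ys].
  rewrite (_ : bc q y = fun=> 0); first exact: in_cone0.
  by apply/funext => v; rewrite /bc big1 // => w _; rewrite (sp0 ys) mul0r.
have [t tL Ht] := simp _ ys; apply: (in_cone_sub cL tL b0).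
apply/fintype.subsetP => v; rewrite inE; apply: contraNT => vt.
rewrite /bc big1 // => w _; have [->|yw] := eqVneq (y w) 0; first by rewrite mul0r.
rewrite (notin_sp (x := q w)) ?mulr0 //; apply: contra vt => vq.
by apply: (fintype.subsetP (Ht w _)) => //; rewrite inE.
Qed.

Lemma linear_on_scale (V W : finType) (L : {set {set V}}) (K : {set {set W}}) q
    (E : lmodType R) (G : (V -> R) -> E) c x :
  conic_subdiv L K q -> linear_on K q G -> 0 <= c -> in_cone L x ->
  G (fun v => c * x v) = c *: G x.
Proof.
move=> [_ _ _ _ surj] lin c0 /surj[y yc ->]; rewrite -bc_scale lin; last exact: in_cone_scale.
by rewrite lin // scaler_sumr; apply: eq_bigr => w _; rewrite scalerA.
Qed.

(** Generators of mass one turn the conic subdivision into an ordinary subdivision of the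
    realization. *)
Lemma conic_normalize (V W : finType) (L : {set {set V}}) (K : {set {set W}}) q :
  conic_subdiv L K q ->
  let q' w v := (mass (q w))^-1 * q w v in
  conic_subdiv L K q' /\ (forall w, [set w]%SET \in K -> mass (q' w) = 1).
Proof.
move=> [cK simp pos inj surj] q'.
have nz w : [set w]%SET \in K -> mass (q w) != 0 by move/pos => [_ m]; rewrite gt_eqF.
have m1 w : [set w]%SET \in K -> mass (q' w) = 1.
  by move=> wK; rewrite mass_scale mulVf // nz.
have bcE y : bc q' y = bc q (fun w => y w / mass (q w)).
  by apply/funext => v; apply: eq_bigr => w _; rewrite mulrA.
have divc y : in_cone K y -> in_cone K (fun w => y w / mass (q w)).
  move=> yc; have [y0 ys] := yc; split.
    move=> w; have [->|yw] := eqVneq (y w) 0; first by rewrite mul0r.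
    by rewrite divr_ge0 // ltW //; case: (pos _ (cone_vertex cK yc yw)).
  rewrite (_ : sp _ = sp y) //; apply/setP => w; rewrite !inE.
  have [->|yw] := eqVneq (y w) 0; first by rewrite mul0r eqxx.
  by rewrite mulf_neq0 // invr_neq0 // nz // (cone_vertex cK yc yw).
split=> //; split=> //.
- move=> s sK; have [t tL Ht] := simp s sK; exists t => // w ws; rewrite sp_scale; first exact: Ht.
  by rewrite invr_neq0 // nz // (vertex_in cK sK ws).
- move=> w wK; rewrite m1 //; split=> // v; have [q0 qm] := pos w wK.
  by rewrite mulr_ge0 // invr_ge0 ltW.
- move=> y y' yc yc'; rewrite !bcE => /(inj _ _ (divc _ yc) (divc _ yc')) E.
  apply/funext => w; have Ew := congr1 (fun f => f w) E; rewrite /= in Ew.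
  have [yw|yw] := eqVneq (y w) 0; have [yw'|yw'] := eqVneq (y' w) 0.
  + by rewrite yw yw'.
  + have mn := nz _ (cone_vertex cK yc' yw').
    by apply: (mulIf (invr_neq0 mn)).
  + have mn := nz _ (cone_vertex cK yc yw).
    by apply: (mulIf (invr_neq0 mn)).
  + have mn := nz _ (cone_vertex cK yc yw).
    by apply: (mulIf (invr_neq0 mn)).
- move=> x /surj[y yc ->]; exists (fun w => y w * mass (q w)).
    have [y0 ys] := yc; split.
      move=> w; have [->|yw] := eqVneq (y w) 0; first by rewrite mul0r.
      by rewrite mulr_ge0 // ltW //; case: (pos _ (cone_vertex cK yc yw)).
    rewrite (_ : sp _ = sp y) //; apply/setP => w; rewrite !inE.
    have [->|yw] := eqVneq (y w) 0; first by rewrite mul0r eqxx.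
    by rewrite mulf_neq0 // nz // (cone_vertex cK yc yw).
  rewrite bcE; congr bc; apply/funext => w.
  have [->|yw] := eqVneq (y w) 0; first by rewrite !mul0r.
  by rewrite mulfK // nz // (cone_vertex cK yc yw).
Qed.

Lemma linear_on_normalize (V W : finType) (L : {set {set V}}) (K : {set {set W}}) q
    (E : lmodType R) (G : (V -> R) -> E) :
  is_complex L -> conic_subdiv L K q -> linear_on K q G ->
  linear_on K (fun w v => (mass (q w))^-1 * q w v) G.
Proof.
move=> cL cs lin y yc; have [cK simp pos inj surj] := cs.
have [[_ _ _ _ surj'] _] := conic_normalize cs.
have nz w : [set w]%SET \in K -> 0 < mass (q w) by move/pos => [_ m].
rewrite (_ : bc _ y = bc q (fun w => y w / mass (q w))); last first.
  by apply/funext => v; apply: eq_bigr => w _; rewrite mulrA.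
rewrite lin.
  apply: eq_bigr => w _; have [->|yw] := eqVneq (y w) 0; first by rewrite mul0r !scale0r.
  have wK := cone_vertex cK yc yw.
  rewrite -scalerA -(linear_on_scale cs lin) ?invr_ge0 ?(ltW (nz w _)) //.
  rewrite -(bc_delta q w); apply: (bc_cone cL cs); exact: delta_cone.
have [y0 ys] := yc; split.
  move=> w; have [->|yw] := eqVneq (y w) 0; first by rewrite mul0r.
  by rewrite divr_ge0 // ltW // nz // (cone_vertex cK yc yw).
rewrite (_ : sp _ = sp y) //; apply/setP => w; rewrite !inE.
have [->|yw] := eqVneq (y w) 0; first by rewrite mul0r eqxx.
by rewrite mulf_neq0 // invr_neq0 // gt_eqF // nz // (cone_vertex cK yc yw).
Qed.

End Cones.

(** * The link of a cone point *)

Section Join.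
Variables (R : realType) (V : finType) (L : {set {set V}}).
Let K : {set {set V + 'I_3}} := join_complex L (points_complex 3).

(* The point with coordinates [z] on the base and the rest of its mass on the
   cone point [i]. *)
Definition jp (i : 'I_3) (z : V -> R) (t : V + 'I_3) : R :=
  match t with inl v => z v | inr j => if j == i then 1 - mass z else 0 end.

Lemma mass_jp i z : mass (jp i z) = 1.
Proof.
rewrite /mass big_sumType /= (bigD1 i) //= eqxx [X in _ + (_ + X)]big1; last by move=> j /negbTE ->.
by rewrite addr0 addrC subrK.
Qed.

Lemma sp_jpl i z : (inl @^-1: sp (jp i z) = sp z)%SET.
Proof. by apply/setP => v; rewrite !inE. Qed.

Lemma rz_jp i z : in_cone L z -> mass z <= 1 -> rz K (jp i z).
Proof.
move=> [z0 zL] z1; split; last 1 first.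
- rewrite inE sp_jpl; apply/and3P; split.
  + apply/eqP => s0; have := mass_jp i z; rewrite (sp0 s0) /mass big1 // => /eqP.
    by rewrite eq_sym oner_eq0.
  + by rewrite !inE; case: zL => [->|->]; rewrite ?eqxx ?orbT.
  + rewrite !inE; have [m1|m1] := eqVneq (mass z) 1; apply/orP; [left|right].
      apply/eqP/setP => j; rewrite !inE /= m1 subrr.
      by case: ifP; rewrite eqxx.
    apply/imsetP; exists i => //; apply/setP => j; rewrite !inE /=.
    by case: ifP => _; rewrite ?eqxx // subr_eq0 eq_sym.
- by case=> [v|j] //=; case: ifP => // _; rewrite subr_ge0.
- exact: mass_jp.
Qed.

Lemma join_apex (x : V + 'I_3 -> R) i : rz K x -> x (inr i) != 0 -> x = jp i (fun v => x (inl v)).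
Proof.
case=> x0 x1; rewrite inE => /and3P[_ _]; rewrite !inE => xr xi.
have {}xr : (inr @^-1: sp x = [set i])%SET.
  case/predU1P: xr => [/setP/(_ i)|/imsetP[j _ E]]; first by rewrite !inE xi.
  by move/setP/(_ i): (E); rewrite !inE xi => /esym/eqP ->.
have xj j : j != i -> x (inr j) = 0.
  move=> ji; apply: notin_sp; apply: contra ji => xj.
  by move/setP/(_ j): xr; rewrite !inE in xj *; rewrite xj => /esym.
apply/funext; case=> [v|j] //=; case: eqP => [->|/eqP/xj //].
move: x1; rewrite big_sumType /= (bigD1 i) //= [X in _ + (_ + X)]big1 ?addr0 => [<-|j' /xj //].
by rewrite /mass addrC addrK.
Qed.

Section Link.
Variables (W : finType) (K' : {set {set W}}) (p : W -> V + 'I_3 -> R) (E : lmodType R)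
  (F : (V + 'I_3 -> R) -> E).
Hypothesis data : pl_data K K' p F.

Let o : V + 'I_3 := inr ord0.

Lemma small_scale (m m' : R) : 0 <= m -> 0 <= m' ->
  exists2 c, 0 < c & c * m <= 1 /\ c * m' <= 1.
Proof.
move=> m0 m0'; have s0 : 0 < 1 + m + m' by lra.
exists (1 + m + m')^-1; first by rewrite invr_gt0.
by split; rewrite mulrC ler_pdivrMr // mul1r; lra.
Qed.

(** The cone point is extreme: the coordinate [o] attains its maximum 1 there, hence also at every
    vertex that has positive weight in a representation of the cone point, and it is 1 nowhere
    else. *)
Lemma apex_vertex : exists w0, [set w0]%SET \in K' /\ p w0 = jp ord0 (fun=> 0).
Proof.
have [[cK' _ sub _] surj _ _] := data.
have mass0 : mass (fun _ : V => 0) = 0 :> R by rewrite /mass big1.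
have /surj[y ry yE] : rz K (jp ord0 (fun=> 0)).
  by apply: rz_jp; [exact: in_cone0|rewrite mass0 ler01].
have [y0 y1 yK] := ry.
have [w0 yw0] : exists w, y w != 0.
  have [K0 _] := cK'; have /set0Pn[w] : sp y != finset.set0 by apply: contraNneq K0 => <-.
  by rewrite inE; exists w.
have wK : [set w0]%SET \in K' by apply: (vertex_in cK' yK); rewrite inE.
have rp w : [set w]%SET \in K' -> rz K (p w) by rewrite -(bc_delta p w) => /rz_delta/sub.
exists w0; split=> //.
have po : p w0 o = 1.
  apply/eqP; rewrite eq_le; have /andP[_ -> /=] := rz_le1 o (rp _ wK).
  have /(congr1 (fun f => f o)) := yE; rewrite /= ?eqxx mass0 subr0 /bc => S1.
  have : \sum_w y w * (1 - p w o) = 0.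
    under eq_bigr do rewrite mulrBr mulr1.
    by rewrite sumrB y1 -S1 subrr.
  move/eqP; rewrite psumr_eq0 => [/allP/(_ w0 (mem_index_enum _))|w _].
    by rewrite mulf_eq0 (negbTE yw0) /= subr_eq0 => /eqP ->.
  have [->|yw] := eqVneq (y w) 0; first by rewrite mul0r.
  have wK' : [set w]%SET \in K' by apply: (vertex_in cK' yK); rewrite inE.
  by have /andP[_ H] := rz_le1 o (rp _ wK'); rewrite mulr_ge0 // subr_ge0.
have pE := join_apex (i := ord0) (rp _ wK); rewrite {}pE; last by rewrite -/o po oner_eq0.
congr jp; apply/funext => v; apply/eqP; have [_ p1 _] := rp _ wK.
have [p0 _ _] := rp _ wK.
move: p1; rewrite big_sumType /= (bigD1 ord0 (P := predT)) //= -/o po => S.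
have : mass (fun v => p w0 (inl v)) <= 0.
  rewrite -(lerD2r 1) add0r -[X in _ <= X]S lerD2l.
  by rewrite lerDl sumr_ge0.
move=> m0; rewrite eq_le p0 andbT; apply: le_trans m0.
exact: (le_mass (x := fun v => p w0 (inl v))).
Qed.

(* Near the cone point the map is conical: it is governed by a positively
   homogeneous map [G] that is linear on the cones over the link of the vertex
   lying above the cone point. *)
Lemma link_conic : exists (K1 : {set {set W}}) (q : W -> V -> R) (rho : R) (G : (V -> R) -> E),
  [/\ conic_subdiv L K1 q, linear_on K1 q G, 0 < rho <= 1,
   forall z, in_cone L z -> mass z < rho ->
     F (jp ord0 z) = F (jp ord0 (fun=> 0)) + G z &
   forall z z', in_cone L z -> in_cone L z' -> G z = G z' -> z = z'].
Proof.
have [[cK' simp sub inj] surj lin injF] := data.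
have [w0 [w0K pw0]] := apex_vertex.
have [K'0 K'd] := cK'.
have mass0 : mass (fun _ : V => 0) = 0 :> R by rewrite /mass big1.
have rp w : [set w]%SET \in K' -> rz K (p w) by rewrite -(bc_delta p w) => /rz_delta/sub.
have po1 w : [set w]%SET \in K' -> w != w0 -> p w o < 1.
  move=> wK ww0; have /andP[_ le1] := rz_le1 o (rp w wK).
  rewrite lt_def le1 andbT; apply: contra_neq ww0 => p1.
  have pE := join_apex (i := ord0) (rp _ wK).
  have {}pE : p w = jp ord0 (fun v => p w (inl v)) by apply: pE; rewrite -/o -p1 oner_eq0.
  have m0 : mass (fun v => p w (inl v)) = 0.
    by move: p1; rewrite pE /= => /eqP; rewrite eq_sym subr_eq addrC -subr_eq subrr eq_sym => /eqP.
  have z0 : (fun v => p w (inl v)) = (fun=> 0).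
    apply/funext => v; apply/eqP; have [p0 _ _] := rp w wK; rewrite eq_le p0 andbT -m0.
    exact: (le_mass (x := fun v => p w (inl v))).
  apply: (@delta_inj R); apply: inj; try exact: rz_delta.
  by rewrite !bc_delta pw0 pE z0.
(* A gap in the coordinate [o] between [w0] and all other vertices: a point closer to the cone point
   than this must give [w0] a positive weight. *)
have [rho0 rho00 Hrho] : exists2 rho : R, 0 < rho & forall w, [set w]%SET \in K' -> w != w0 ->
    p w o <= 1 - rho.
  apply: (@common_small R W (fun w rho => [set w]%SET \in K' -> w != w0 -> p w o <= 1 - rho)).
    move=> w d d' /andP[_ dd'] H wK ww0; apply: le_trans (H wK ww0) _; lra.
  move=> w; have [wK|wK] := boolP ([set w]%SET \in K'); last by exists 1.
  have [->|ww0] := eqVneq w w0; first by exists 1.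
  exists (1 - p w o); first by rewrite subr_gt0 po1.
  by move=> _ _; rewrite opprB addrC subrK.
pose rho := Num.min rho0 1.
have rho1 : 0 < rho <= 1 by rewrite lt_min rho00 ltr01 ge_min lexx orbT.
have {}Hrho w : [set w]%SET \in K' -> w != w0 -> p w o <= 1 - rho.
  by move=> wK /(Hrho w wK) H; apply: le_trans H _; rewrite lerD2l lerN2 ge_min lexx.
(* The link of [w0]. *)
pose K1 := [set s : {set W} | [&& s != finset.set0, w0 \notin s & w0 |: s \in K']]%SET.
pose q w v := p w (inl v).
have K1K' s : s \in K1 -> s \in K'.
  by rewrite inE => /and3P[s0 _ sK]; apply: K'd sK _ s0; apply: finset.subsetUr.
have linkE s w : s \in K1 -> w \in s ->
    [/\ [set w]%SET \in K', w != w0 & p w = jp ord0 (q w)].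
  move=> sK1 ws; have wK := vertex_in cK' (K1K' _ sK1) ws.
  move: sK1; rewrite inE => /and3P[_ w0s sK].
  have ww0 : w != w0 by apply: contraNneq w0s => <-.
  split=> //; have [t tK Ht] := simp _ sK.
  have ot : o \in t.
    apply: (fintype.subsetP (Ht w0 _)); first by rewrite !inE eqxx.
    by rewrite pw0 inE /= mass0 subr0 oner_eq0.
  have pwt : sp (p w) \subset t by apply: Ht; rewrite !inE ws orbT.
  have tr : (inr @^-1: t = [set ord0])%SET.
    move: tK; rewrite inE => /and3P[_ _]; rewrite !inE => /predU1P[/setP/(_ ord0)|].
      by rewrite !inE ot.
    by case/imsetP=> j _ E1; move/setP/(_ ord0): (E1); rewrite !inE ot => /esym/eqP ->.
  have pj j : j != ord0 -> p w (inr j) = 0.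
    move=> j0; apply: notin_sp; apply: contra j0 => /(fintype.subsetP pwt) jt.
    by move/setP/(_ j): tr; rewrite !inE jt => /esym.
  have [_ p1 _] := rp w wK; apply/funext; case=> [v|j] //=.
  case: eqP => [->|/eqP/pj //]; move: p1.
  rewrite big_sumType /= (bigD1 ord0 (P := predT)) //= [X in _ + (_ + X)]big1 => [|j' /pj //].
  by rewrite addr0 => <-; rewrite /mass addrC addrK.
have cK1 : is_complex K1.
  split; first by rewrite inE eqxx.
  move=> s t sK1 ts t0; move: sK1; rewrite !inE t0 => /and3P[_ w0s sK] /=.
  apply/andP; split; first by apply: contra w0s => /(fintype.subsetP ts).
  apply: K'd sK _ _; first exact: finset.setUS.
  by apply/set0Pn; exists w0; rewrite !inE eqxx.
have qmass w : [set w]%SET \in K1 -> rho <= mass (q w).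
  move=> wK1; have [wK ww0 pE] := linkE _ w wK1 (set11 w).
  have := Hrho w wK ww0; rewrite pE /o /=; lra.
(* From a point of the cone over the link to a point of the star: [w0] receives the remaining
   mass. *)
pose hat (y : W -> R) w := if w == w0 then 1 - mass y else y w.
have yw0 y : in_cone K1 y -> y w0 = 0.
  move=> [_ [/sp0 -> //|]]; rewrite inE => /and3P[_ w0s _]; exact: notin_sp.
have sum_hat y (f : W -> E) : in_cone K1 y ->
    \sum_w hat y w *: f w = f w0 + \sum_w y w *: (f w - f w0).
  move=> yc; rewrite (bigD1 w0) //= /hat eqxx.
  transitivity ((1 - mass y) *: f w0 + \sum_w y w *: f w).
    congr (_ + _); rewrite [RHS](bigD1 w0) //= yw0 // scale0r add0r.
    by apply: eq_bigr => w /negbTE ->.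
  under [in RHS]eq_bigr do rewrite scalerBr.
  by rewrite sumrB -scaler_suml -/(mass y) scalerBl scale1r -addrA (addrC (- _)).
have hat_rz y : in_cone K1 y -> mass y <= 1 -> rz K' (hat y).
  move=> yc m1; have [y0 yK] := yc; have h0 w : 0 <= hat y w.
    by rewrite /hat; case: ifP => // _; rewrite subr_ge0.
  apply/(rz_cone _ cK'); split; last first.
    rewrite /mass (bigD1 w0) //= /hat eqxx.
    rewrite (_ : \sum_(i | _) _ = mass y) ?subrK //.
    rewrite /mass [RHS](bigD1 w0) //= yw0 // add0r.
    by apply: eq_bigr => w /negbTE ->.
  have [s sK ss] : exists2 s, s \in K' & (w0 |: sp y \subset s)%SET.
    case: yK => [->|]; first by exists [set w0]%SET; rewrite ?finset.setU0.
    by rewrite inE => /and3P[_ _ sK]; exists (w0 |: sp y)%SET.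
  apply: (in_cone_sub cK' sK h0); apply: fintype.subset_trans ss.
  by apply/fintype.subsetP => w; rewrite !inE /hat; case: (w == w0).
have hat_bc y : in_cone K1 y -> bc p (hat y) = jp ord0 (bc q y).
  move=> yc; have yE w : y w != 0 -> p w = jp ord0 (q w).
    move=> yw; have := cone_vertex cK1 yc yw.
    by move=> wK1; have [_ _] := linkE _ w wK1 (set11 w).
  have sum_hat' (f : W -> R) : \sum_w hat y w * f w = f w0 + \sum_w y w * (f w - f w0).
    rewrite (bigD1 w0) //= /hat eqxx.
    transitivity ((1 - mass y) * f w0 + \sum_w y w * f w).
      congr (_ + _); rewrite [RHS](bigD1 w0) //= yw0 // mul0r add0r.
      by apply: eq_bigr => w /negbTE ->.
    under [in RHS]eq_bigr do rewrite mulrBr.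
    by rewrite sumrB -mulr_suml -/(mass y); ring.
  apply/funext => t; rewrite /bc sum_hat' pw0; case: t => [v|j] /=.
    by rewrite add0r; apply: eq_bigr => w _; rewrite subr0.
  rewrite mass0 subr0; case: ifP => j0; last first.
    rewrite add0r big1 // => w _; have [->|yw] := eqVneq (y w) 0; first by rewrite mul0r.
    by rewrite yE //= j0 subr0 mulr0.
  rewrite mass_bc; congr (1 + _); rewrite -sumrN; apply: eq_bigr => w _.
  have [->|yw] := eqVneq (y w) 0; first by rewrite !mul0r oppr0.
  by rewrite yE //= j0 -mulrN addrAC subrr sub0r.
have repr z : in_cone L z -> mass z < rho ->
    exists y, [/\ in_cone K1 y, mass y <= 1 & z = bc q y].
  move=> zc mz; have z1 : mass z <= 1 by case/andP: rho1 => _; lra.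
  have [y ry yE] := surj _ (rz_jp ord0 zc z1).
  have [y0 y1 yK] := ry.
  have yw0' : y w0 != 0.
    apply/eqP => yw; have /(congr1 (fun f => f o)) := yE; rewrite /= ?eqxx /bc => S.
    have : 1 - mass z <= \sum_w y w * (1 - rho).
      rewrite S; apply: ler_sum => w _; have [->|yw'] := eqVneq (y w) 0; first by rewrite !mul0r.
      apply: ler_wpM2l => //; apply: Hrho; first by apply: (vertex_in cK' yK); rewrite inE.
      by apply: contraNneq yw' => ->; rewrite yw.
    by rewrite -mulr_suml y1 mul1r; lra.
  pose y' w := if w == w0 then 0 else y w.
  have my' : mass y' = 1 - y w0.
    rewrite -y1 (bigD1 w0) //= addrC addrK /mass (bigD1 w0) //= /y' eqxx add0r.
    by apply: eq_bigr => w /negbTE ->.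
  have spy' : sp y' = (sp y :\ w0)%SET.
    by apply/setP => w; rewrite !inE /y'; case: (w == w0); rewrite ?eqxx.
  exists y'; split.
  - split=> [w|]; first by rewrite /y'; case: ifP.
    have [->|n0] := eqVneq (sp y') finset.set0; [by left|right].
    rewrite inE n0 spy' !inE eqxx /= finset.setD1K //; by rewrite inE.
  - by rewrite my' lerBlDr lerDl.
  - apply/funext => v; have /(congr1 (fun f => f (inl v))) := yE; rewrite /= /bc => ->.
    apply: eq_bigr => w _; rewrite /y'; case: eqP => [->|//].
    by rewrite pw0 /= mulr0 mul0r.
(* The factor shrinks any [z] to mass less than [rho], where [F] is conical, and its inverse undoes
   the shrinking; this defines [G] on the whole cone. *)
pose G z := (rho / (1 + mass z))^-1 *:
  (F (jp ord0 (fun v => rho / (1 + mass z) * z v)) - F (jp ord0 (fun=> 0))).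
have Fo : F (p w0) = F (jp ord0 (fun=> 0)) by rewrite pw0.
have F_lin y : in_cone K1 y -> mass y <= 1 ->
    F (jp ord0 (bc q y)) = F (p w0) + \sum_w y w *: (F (p w) - F (p w0)).
  by move=> yc y1; rewrite -hat_bc // lin ?sum_hat //; apply: hat_rz.
have q_pos w : [set w]%SET \in K1 -> (forall v, 0 <= q w v) /\ 0 < mass (q w).
  move=> wK1; split; last by apply: lt_le_trans (qmass w wK1); case/andP: rho1.
  by have [wK _ _] := linkE _ w wK1 (set11 w); have [p0 _ _] := rp _ wK => v; exact: p0.
have bc0 y v : in_cone K1 y -> 0 <= bc q y v.
  move=> yc; have [y0 _] := yc; apply: sumr_ge0 => w _.
  have [->|yw] := eqVneq (y w) 0; first by rewrite mul0r.
  by rewrite mulr_ge0 //; case: (q_pos w (cone_vertex cK1 yc yw)).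
have mass_le y : in_cone K1 y -> rho * mass y <= mass (bc q y).
  move=> yc; have [y0 _] := yc; rewrite mass_bc /mass mulr_sumr; apply: ler_sum => w _.
  have [->|yw] := eqVneq (y w) 0; first by rewrite mulr0 mul0r.
  by rewrite mulrC ler_wpM2l // qmass // (cone_vertex cK1 yc yw).
have cscale (z : V -> R) : (forall v, 0 <= z v) ->
    0 < rho / (1 + mass z) /\ rho / (1 + mass z) * mass z < rho.
  move=> z0; have m0 := mass_ge0 z0; case/andP: rho1 => r0 _.
  have m1 : 0 < 1 + mass z by rewrite ltr_wpDr.
  split; first by rewrite divr_gt0.
  rewrite mulrAC ltr_pdivrMr // ltr_pM2l //; lra.
have G_lin y : in_cone K1 y -> G (bc q y) = \sum_w y w *: (F (p w) - F (p w0)).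
  move=> yc; rewrite /G -Fo -bc_scale.
  have [] := cscale (bc q y) (fun v => bc0 y v yc).
  move: (rho / _) => c c0 cm.
  rewrite F_lin.
  - rewrite addrC addKr scaler_sumr; apply: eq_bigr => w _.
    by rewrite !scalerA mulKf // gt_eqF.
  - by apply: in_cone_scale => //; apply: ltW.
  rewrite mass_scale; case/andP: rho1 => r0 _.
  rewrite -(ler_pM2l r0) mulr1 mulrCA; apply: le_trans (ltW cm).
  by rewrite ler_pM2l // mass_le.
have surjq x : in_cone L x -> exists2 y, in_cone K1 y & x = bc q y.
  move=> xc; have [x0 _] := xc; have [] := cscale x x0.
  move: (rho / _) => c c0 cm.
  have [||y [yc _ yE]] := repr (fun v => c * x v).
  - by apply: in_cone_scale => //; apply: ltW.
  - by rewrite mass_scale.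
  exists (fun w => c^-1 * y w); first by apply: in_cone_scale => //; rewrite invr_ge0 ltW.
  by rewrite bc_scale -yE; apply/funext => v; rewrite mulKf // gt_eqF.
exists K1, q, rho, G; split=> //.
- split=> //.
  + move=> s sK1; have [t tK Ht] := simp s (K1K' s sK1).
    move: tK; rewrite inE => /and3P[_ tl _].
    have qt w : w \in s -> sp (q w) \subset (inl @^-1: t)%SET.
      move=> ws; apply/fintype.subsetP => v; rewrite inE => qv; rewrite inE.
      by apply: (fintype.subsetP (Ht w ws)); rewrite inE.
    exists (inl @^-1: t)%SET => //; move: tl; rewrite !inE => /predU1P[t0|//].
    have /set0Pn[w ws] : s != finset.set0 by apply: contraNneq (proj1 cK1) => <-.
    have [_] := q_pos w (vertex_in cK1 sK1 ws); rewrite /mass big1 ?ltxx // => v _.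
    apply: notin_sp; apply/negP => /(fintype.subsetP (qt w ws)).
    by rewrite t0 inE.
  + move=> y y' yc yc' E1; have m0 := mass_ge0 (proj1 yc); have m0' := mass_ge0 (proj1 yc').
    have [c c0 [c1 c1']] := small_scale m0 m0'.
    have cyc : in_cone K1 (fun w => c * y w) by apply: in_cone_scale => //; apply: ltW.
    have cyc' : in_cone K1 (fun w => c * y' w) by apply: in_cone_scale => //; apply: ltW.
    have Eh : hat (fun w => c * y w) = hat (fun w => c * y' w).
      by apply: inj; rewrite ?hat_bc ?bc_scale ?E1 //; apply: hat_rz; rewrite ?mass_scale.
    apply/funext => w; have [->|ww0] := eqVneq w w0; first by rewrite !yw0.
    have := congr1 (fun f => f w) Eh; rewrite /hat (negbTE ww0) => /mulfI; apply.
    by rewrite gt_eqF.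
- move=> y yc; rewrite G_lin //; apply: eq_bigr => w _.
  have [->|yw] := eqVneq (y w) 0; first by rewrite !scale0r.
  congr (_ *: _); rewrite -(bc_delta q w) G_lin ?(sum_delta w (fun w => F (p w) - F (p w0))) //.
  exact/delta_cone/(cone_vertex cK1 yc yw).
- move=> z zc mz; have [y [yc y1 ->]] := repr z zc mz.
  by rewrite F_lin // G_lin // Fo.
move=> z z' /surjq[y yc ->] /surjq[y' yc' ->] E1.
have m0 := mass_ge0 (proj1 yc); have m0' := mass_ge0 (proj1 yc').
have [c c0 [c1 c1']] := small_scale m0 m0'.
have cyc : in_cone K1 (fun w => c * y w) by apply: in_cone_scale => //; apply: ltW.
have cyc' : in_cone K1 (fun w => c * y' w) by apply: in_cone_scale => //; apply: ltW.
have cF u : in_cone K1 u -> mass (fun w => c * u w) <= 1 ->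
    F (jp ord0 (bc q (fun w => c * u w))) = F (p w0) + c *: G (bc q u).
  move=> uc u1; rewrite F_lin //; last by apply: in_cone_scale => //; apply: ltW.
  rewrite G_lin // scaler_sumr; congr (_ + _); apply: eq_bigr => w _.
  by rewrite scalerA.
have rzu u : in_cone K1 (fun w => c * u w) -> mass (fun w => c * u w) <= 1 ->
    rz K (jp ord0 (bc q (fun w => c * u w))).
  by move=> uc u1; rewrite -hat_bc //; apply: sub; apply: hat_rz.
have : jp ord0 (bc q (fun w => c * y w)) = jp ord0 (bc q (fun w => c * y' w)).
  by apply: injF; [apply: rzu|apply: rzu|]; rewrite ?mass_scale ?cF ?mass_scale ?E1.
rewrite !bc_scale => E2; apply/funext => v.
have := congr1 (fun f => f (inl v)) E2; rewrite /= => /mulfI; apply.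
by rewrite gt_eqF.
Qed.

End Link.
End Join.

(** * Weighted barycentric subdivision *)

Section Refinement.
Variable R : realType.

Lemma bcD (V W : finType) (q : W -> V -> R) y y' v :
  bc q (fun w => y w + y' w) v = bc q y v + bc q y' v.
Proof. by rewrite /bc -big_split; apply: eq_bigr => w _; rewrite mulrDl. Qed.

Lemma bc_bc (U V W : finType) (q : W -> V -> R) (a : U -> W -> R) y :
  bc (fun u => bc q (a u)) y = bc q (bc a y).
Proof.
apply/funext => v; rewrite /bc; under [RHS]eq_bigr do rewrite mulr_suml.
rewrite exchange_big; apply: eq_bigr => u _; rewrite mulr_sumr.
by apply: eq_bigr => w _; rewrite mulrA.
Qed.

Lemma sp_bc (V W : finType) (q : W -> V -> R) y (t : {set V}) :
  (forall w, y w != 0 -> sp (q w) \subset t) -> sp (bc q y) \subset t.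
Proof.
move=> H; apply/fintype.subsetP => v; rewrite inE; apply: contraNT => vt.
rewrite /bc big1 // => w _; have [->|yw] := eqVneq (y w) 0; first by rewrite mul0r.
rewrite (notin_sp (x := q w)) ?mulr0 //; apply: contra vt; exact: (fintype.subsetP (H w yw)).
Qed.

(* A simplex with more than [n] vertices inside an [n]-dimensional cone would
   carry an affine dependency, against injectivity. *)
Lemma conic_dim (V W : finType) (L : {set {set V}}) (K : {set {set W}}) (q : W -> V -> R) n :
  conic_subdiv L K q -> (forall t, t \in L -> (#|t| <= n)%N) ->
  forall s, s \in K -> (#|s| <= n)%N.
Proof.
move=> [cK simp _ inj _] dimL s sK; have [t tL Ht] := simp s sK.
apply: leq_trans (dimL t tL); rewrite leqNgt; apply/negP => lt.
pose A : 'M[R]_(#|s|, #|t|) := \matrix_(i, j) q (enum_val i) (enum_val j).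
have : kermx A != 0.
  rewrite kermx_eq0 /row_free; apply: contraTneq lt => rA.
  by rewrite -leqNgt -rA rank_leq_col.
case/rowV0Pn => u /sub_kermxP uA u0.
pose c w := \sum_(i < #|s|) u 0 i * (enum_val i == w)%:R.
have cE i : c (enum_val i) = u 0 i.
  rewrite /c (bigD1 i) //= eqxx mulr1 big1 ?addr0 // => j ji.
  by rewrite (inj_eq enum_val_inj) (negbTE ji) mulr0.
have c0 w : w \notin s -> c w = 0.
  move=> ws; rewrite /c big1 // => i _; case: eqP => [E|]; last by rewrite mulr0.
  by move: ws; rewrite -E enum_valP.
have bcc v : bc q c v = 0.
  have cs : bc q c v = \sum_(i < #|s|) u 0 i * q (enum_val i) v.
    rewrite /bc (bigID (mem s)) /= [X in _ + X]big1 ?addr0; last first.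
      by move=> w ws; rewrite c0 // mul0r.
    rewrite big_enum_val; apply: eq_bigr => i _; by rewrite cE.
  rewrite cs; have [vt|vt] := boolP (v \in t).
    move/matrixP/(_ 0 (enum_rank_in vt v)): uA; rewrite !mxE => E0; rewrite -[RHS]E0.
    by apply: eq_bigr => i _; rewrite mxE enum_rankK_in.
  rewrite big1 // => i _; rewrite (notin_sp (x := q _)) ?mulr0 //.
  by apply: contra vt; apply: (fintype.subsetP (Ht _ (enum_valP i))).
pose M := 1 + \sum_w `|c w|.
have M0 : 0 < M by rewrite ltr_pwDl // sumr_ge0.
pose y w : R := (w \in s)%:R.
pose y' w : R := y w + M^-1 * c w.
have y0 w : 0 <= y w by rewrite ler0n.
have y'0 w : 0 <= y' w.
  rewrite /y'; have [ws|ws] := boolP (w \in s); last by rewrite c0 // mulr0 addr0.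
  rewrite (_ : y w = 1); last by rewrite /y ws.
  have cM : `|M^-1 * c w| <= 1.
    rewrite normrM gtr0_norm ?invr_gt0 // mulrC ler_pdivrMr // mul1r.
    rewrite /M (bigD1 w) //= addrCA lerDl addr_ge0 // sumr_ge0 //.
  by move: cM; rewrite ler_norml; lra.
have ssub f : (forall w, w \notin s -> f w = 0) -> sp f \subset s.
  by move=> H; apply/fintype.subsetP => w; rewrite inE; apply: contraNT => /H ->.
have yc : in_cone K y by apply: (in_cone_sub cK sK) => //; apply: ssub => w; rewrite /y => /negbTE ->.
have yc' : in_cone K y'.
  apply: (in_cone_sub cK sK) => //; apply: ssub => w ws.
  by rewrite /y' /y (negbTE ws) c0 // mulr0 addr0.
have E : y = y'.
  apply: inj => //; apply/funext => v; rewrite bcD bc_scale bcc mulr0 addr0 //.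
case/eqP: u0; apply/matrixP => a i; rewrite ord1 mxE -cE.
have := congr1 (fun f => f (enum_val i)) E; rewrite /y' => /eqP.
rewrite -subr_eq0 opprD addrA subrr sub0r oppr_eq0 mulf_eq0 invr_eq0 (gt_eqF M0) /=.
by move/eqP.
Qed.

Section Compose.
Variables (U V W : finType) (L : {set {set V}}) (K : {set {set W}}) (K2 : {set {set U}}).
Variables (q : W -> V -> R) (a : U -> W -> R).
Hypotheses (cL : is_complex L) (csq : conic_subdiv L K q) (csa : conic_subdiv K K2 a).

Lemma conic_comp : conic_subdiv L K2 (fun u => bc q (a u)).
Proof.
have [cK simp pos inj surj] := csq; have [cK2 simp2 pos2 inj2 surj2] := csa.
have ac u : [set u]%SET \in K2 -> in_cone K (a u).
  by move=> uK; rewrite -(bc_delta a u); apply: (bc_cone cK csa); apply: delta_cone.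
split=> //.
- move=> s /simp2[t /simp[r rL Hr] Ht]; exists r => // u us.
  apply: sp_bc => w aw; apply: Hr; apply: (fintype.subsetP (Ht u us)).
  by rewrite inE.
- move=> u uK; have [b0 _] := bc_cone cL csq (ac u uK); split=> //.
  apply: mass_gt0 => //; apply/eqP => s0; have [_] := pos2 u uK.
  have -> : a u = fun=> 0.
    apply: inj; [exact: ac|exact: in_cone0|]; rewrite (sp0 s0).
    by apply/funext => v; rewrite /bc big1 // => w _; rewrite mul0r.
  by rewrite /mass big1 // ltxx.
- move=> y y' yc yc'; rewrite !bc_bc => /inj E; apply: inj2 => //; apply: E.
    exact: (bc_cone cK csa).
  exact: (bc_cone cK csa).
- move=> x /surj[y /surj2[z zc ->] ->]; exists z => //; by rewrite bc_bc.
Qed.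

Lemma linear_on_comp (E : lmodType R) (G : (V -> R) -> E) :
  linear_on K q G -> linear_on K2 (fun u => bc q (a u)) G.
Proof.
have [cK simp pos inj surj] := csq; have [cK2 simp2 pos2 inj2 surj2] := csa.
move=> lin y yc; rewrite bc_bc lin; last exact: (bc_cone cK csa).
under eq_bigr do rewrite /bc scaler_suml.
rewrite exchange_big; apply: eq_bigr => u _.
have [->|yu] := eqVneq (y u) 0.
  by rewrite scale0r big1 // => w _; rewrite mul0r scale0r.
rewrite lin; last first.
  rewrite -(bc_delta a u); apply: (bc_cone cK csa); apply: delta_cone.
  exact: (cone_vertex cK2 yc yu).
by rewrite scaler_sumr; apply: eq_bigr => w _; rewrite scalerA.
Qed.

End Compose.

Section Barycentric.
Variables (W : finType) (K : {set {set W}}) (a : {set W} -> W -> R).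
Hypothesis cK : is_complex K.
Hypothesis a_ge0 : forall s w, 0 <= a s w.
Hypothesis sp_a : forall s, s \in K -> sp (a s) = s.

(** The simplices of the barycentric subdivision, as chains of simplices of [K]. The centre of [s]
    is any point [a s] with support [s], and only its ray matters. *)
Definition flags : {set {set {set W}}} :=
  [set c : {set {set W}} | [&& c != finset.set0, c \subset K &
    [forall s in c, forall s' in c, (s \subset s') || (s' \subset s)]]]%SET.

Lemma flagsP (c : {set {set W}}) : reflect
  [/\ c != finset.set0, forall s, s \in c -> s \in K &
    forall s s', s \in c -> s' \in c -> (s \subset s') || (s' \subset s)] (c \in flags).
Proof.
rewrite inE; apply: (iffP and3P) => [[c0 /fintype.subsetP cc /forall_inP H]|[c0 cc H]]; split=> //.
- by move=> s s' sc s'c; have /forall_inP := H s sc; apply.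
- exact/fintype.subsetP.
- by apply/forall_inP => s sc; apply/forall_inP => s' s'c; apply: H.
Qed.

Lemma flag_top c : c \in flags -> exists2 t, t \in c & forall s, s \in c -> s \subset t.
Proof.
case/flagsP => /set0Pn[s0 s0c] _ H.
case: (@arg_maxnP _ s0 (mem c) (fun s => #|s|) s0c) => t tc tmax.
exists t => // s sc; have /orP[//|ts] := H s t sc tc.
suff -> : s = t by [].
by apply/eqP; rewrite eq_sym eqEcard ts /=; exact: tmax.
Qed.

Lemma is_complex_flags : is_complex flags.
Proof.
split; first by rewrite inE eqxx.
move=> c d /flagsP[c0 cK' H] /fintype.subsetP dc d0; apply/flagsP; split=> //.
  by move=> s /dc/cK'.
by move=> s s' /dc sc /dc s'c; apply: H.
Qed.

Lemma flags_term (y : {set W} -> R) s : in_cone flags y -> y s != 0 -> s \in K.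
Proof.
move=> yc ys; have := cone_vertex is_complex_flags yc ys.
by case/flagsP => _ H _; apply: H; rewrite inE.
Qed.

Lemma flags_sub (y : {set W} -> R) s : in_cone flags y -> y s != 0 -> s \subset sp (bc a y).
Proof.
move=> yc ys; have [y0 _] := yc; have sK := flags_term yc ys.
apply/fintype.subsetP => w ws; rewrite inE gt_eqF // /bc (bigD1 s) //= ltr_pwDl //.
  rewrite mulr_gt0 // lt_def ?ys ?y0 // a_ge0 andbT.
  by move: ws; rewrite -{1}(sp_a sK) inE.
by apply: sumr_ge0 => s' _; apply: mulr_ge0.
Qed.

(** Greedy decomposition: subtract the largest multiple of [a (sp x)] that keeps all coordinates
    nonnegative; the support shrinks, and induction applies to the rest. *)
Lemma flags_surj (x : W -> R) : in_cone K x -> exists2 y, in_cone flags y & x = bc a y.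
Proof.
move=> xc; have [n le] := ubnP #|sp x|; elim: n => // n IH in x xc le *.
have [x0 [xs|xK]] := xc.
  exists (fun=> 0); first exact: in_cone0.
  rewrite (sp0 xs); apply/funext => v; rewrite /bc big1 // => w _; by rewrite mul0r.
set s := sp x in xK le *.
have [w0 w0s] : exists w, w \in s.
  by apply/set0Pn; apply: contraNneq (proj1 cK) => <-.
case: (@arg_minP _ _ _ w0 (mem s) (fun w => x w / a s w) w0s) => w ws wmin.
have {}ws : w \in s := ws.
have asw u : u \in s -> 0 < a s u.
  by rewrite lt_def a_ge0 andbT -{1}(sp_a xK) inE.
set m := x w / a s w in wmin.
have m0 : 0 < m.
  by rewrite divr_gt0 ?asw // lt_def x0 andbT; move: ws; rewrite inE.
pose x1 u := x u - m * a s u.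
have x1_0 u : 0 <= x1 u.
  rewrite subr_ge0; have [us|us] := boolP (u \in s).
    by rewrite -ler_pdivlMr ?asw // wmin.
  by rewrite (notin_sp (x := a s)) ?mulr0 // sp_a.
have sp1 : sp x1 \subset s.
  apply: sp_sub => u xu; rewrite /x1 xu (notin_sp (x := a s)) ?mulr0 ?subrr // sp_a //.
  by rewrite inE xu eqxx.
have x1c : in_cone K x1 by apply: (in_cone_sub cK xK).
have lt1 : (#|sp x1| < #|s|)%N.
  apply: proper_card; apply/properP; split=> //; exists w => //.
  by rewrite inE negbK /x1 /m divfK ?subrr // gt_eqF // asw.
have [|y yc yE] := IH x1 x1c; first by apply: leq_trans lt1 _; rewrite -ltnS.
have [y0 ys] := yc.
exists (fun t => y t + m * delta R s t).
  split=> [t|]; first by rewrite addr_ge0 // mulr_ge0 ?ler0n // ltW.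
  right; apply/flagsP; split.
  - apply/set0Pn; exists s; rewrite inE gt_eqF // ltr_wpDl // /delta eqxx mulr1 //.
  - move=> t; rewrite inE /delta; have [-> _|ts] := eqVneq t s; first exact: xK.
    by rewrite mulr0 addr0 => yt; apply: flags_term yc yt.
  have tsub t : t \in sp (fun t => y t + m * delta R s t) -> t != s -> y t != 0.
    by move=> + /negbTE ts; rewrite inE /delta ts mulr0 addr0.
  have tsub' t : y t != 0 -> t \subset s.
    by move=> yt; apply: fintype.subset_trans sp1; rewrite yE; apply: flags_sub.
  move=> t t' tc t'c.
  have [->|ts] := eqVneq t s.
    have [->|t's] := eqVneq t' s; first by rewrite fintype.subxx.
    by rewrite tsub' ?orbT // tsub.
  have [->|t's] := eqVneq t' s; first by rewrite tsub' // tsub.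
  have yt := tsub _ tc ts; have yt' := tsub _ t'c t's.
  case: ys => [/sp0 y00|/flagsP[_ _ H]]; first by rewrite y00 eqxx in yt.
  by apply: H; rewrite inE.
apply/funext => u; rewrite bcD bc_scale bc_delta -yE /x1; ring.
Qed.

(* The coefficient of the largest simplex of the flag is the least ratio of the
   coordinates to its weights, so it is determined by the point. *)
Lemma flags_inj (y y' : {set W} -> R) :
  in_cone flags y -> in_cone flags y' -> bc a y = bc a y' -> y = y'.
Proof.
move=> yc yc' E; have [n le] := ubnP #|sp y|; elim: n => // n IH in y y' yc yc' E le *.
have main z z' : in_cone flags z -> in_cone flags z' -> bc a z = bc a z' -> forall t,
    z t != 0 -> (forall s, z s != 0 -> s \subset t) ->
    (forall s, z' s != 0 -> s \subset t) -> z' t <= z t.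
  move=> zc zc' Ez t zt ztop ztop'; have [z0 zs] := zc; have [z'0 _] := zc'.
  rewrite leNgt; apply/negP => lt.
  have tK := flags_term zc zt.
  (* At a vertex [w] of [t] outside the smaller simplices of the flag, only the term of [t]
     contributes to [bc a z], so the values there compare the two coefficients. *)
  have [w [wt wz]] : exists w, w \in t /\ forall s, z s != 0 -> s != t -> w \notin s.
    have [d0|dn0] := eqVneq (sp z :\ t)%SET finset.set0.
      have [w wt] : exists w, w \in t by apply/set0Pn; apply: contraNneq (proj1 cK) => <-.
      exists w; split=> // s zs' st; have : s \in (sp z :\ t)%SET by rewrite !inE st.
      by rewrite d0 inE.
    have dK : (sp z :\ t)%SET \in flags.
      case: zs => [z00|zK]; first by move: dn0; rewrite z00 finset.set0D eqxx.
      by apply: (proj2 is_complex_flags) zK _ dn0; apply: finset.subD1set.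
    have [r rd rtop] := flag_top dK; move: rd; rewrite !inE => /andP[rt zr].
    have /properP[_ [w wt wr]] : r \proper t by rewrite finset.properEneq rt ztop.
    exists w; split=> // s zs' st; apply: contra wr; apply: (fintype.subsetP (rtop s _)).
    by rewrite !inE st.
  have : bc a z w < bc a z' w.
    rewrite /bc (bigD1 t) //= [X in _ + X]big1 => [|s st]; last first.
      have [->|zs'] := eqVneq (z s) 0; first by rewrite mul0r.
      by rewrite (notin_sp (x := a s)) ?mulr0 // sp_a ?(flags_term zc zs') // wz.
    rewrite addr0 [X in _ < X](bigD1 t) //=; apply: ltr_wpDr.
      by apply: sumr_ge0 => s _; apply: mulr_ge0.
    by rewrite ltr_pM2r // lt_def a_ge0 andbT; move: wt; rewrite -{1}(sp_a tK) inE.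
  by rewrite Ez ltxx.
have supE z : in_cone flags z -> forall s, z s != 0 -> s \subset sp (bc a z).
  by move=> zc s; apply: flags_sub.
have [y00|yn0] := eqVneq (sp y) finset.set0.
  have b0 : bc a y = fun=> 0.
    by apply/funext => v; rewrite /bc big1 // => s _; rewrite (sp0 y00) mul0r.
  have y'00 : sp y' = finset.set0.
    apply/eqP/negPn/negP => /set0Pn[s]; rewrite inE => ys.
    have /fintype.subsetP ss := supE y' yc' s ys.
    have [w ws] : exists w, w \in s.
      by apply/set0Pn; apply: contraNneq (proj1 cK) => <-; apply: flags_term yc' ys.
    by have := ss w ws; rewrite -E b0 inE eqxx.
  by rewrite (sp0 y00) (sp0 y'00).
have topE z : in_cone flags z -> sp z != finset.set0 ->
    z (sp (bc a z)) != 0 /\ forall s, z s != 0 -> s \subset sp (bc a z).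
  move=> zc zn0; split; last exact: supE.
  have zK : sp z \in flags by case: (zc) => _ [z0|//]; rewrite z0 eqxx in zn0.
  have [t tz ttop] := flag_top zK; have zt : z t != 0 by move: tz; rewrite inE.
  suff -> : sp (bc a z) = t by [].
  apply/eqP; rewrite finset.eqEsubset (supE z zc t zt) andbT; apply: sp_bc => s zs.
  by rewrite sp_a ?(flags_term zc zs) // ttop // inE.
have [yt ytop] := topE y yc yn0.
have y'n0 : sp y' != finset.set0.
  apply/eqP => y'0; have b0 : bc a y' = fun=> 0.
    by apply/funext => v; rewrite /bc big1 // => s _; rewrite (sp0 y'0) mul0r.
  have /flags_term := yt; move/(_ yc); rewrite E b0 => sK.
  have s0 : sp (fun _ : W => 0 : R) = finset.set0 by apply/setP => w; rewrite !inE eqxx.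
  by move: (proj1 cK); rewrite s0 in sK; rewrite sK.
have [y't y'top] := topE y' yc' y'n0.
move: y't y'top yt ytop; rewrite -E; set t := sp (bc a y) => y't y'top yt ytop.
have Et : y t = y' t.
  by apply/eqP; rewrite eq_le; apply/andP; split; apply: main.
pose cut (z : {set W} -> R) s := if s == t then 0 else z s.
have cutc z : in_cone flags z -> in_cone flags (cut z).
  move=> [z0 zs]; split=> [s|]; first by rewrite /cut; case: ifP.
  have sc : sp (cut z) \subset sp z.
    by apply/fintype.subsetP => s; rewrite !inE /cut; case: ifP; rewrite ?eqxx.
  have [->|n0] := eqVneq (sp (cut z)) finset.set0; [by left|right].
  case: zs => [z00|zK]; first by move: sc n0; rewrite z00 finset.subset0 => ->.
  exact: (proj2 is_complex_flags) zK sc n0.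
have cutE z : bc a (cut z) = fun w => bc a z w - z t * a t w.
  apply/funext => w; rewrite /bc (bigD1 t) //= [in RHS](bigD1 t) //= /cut eqxx mul0r add0r.
  by rewrite [in RHS]addrAC subrr add0r; apply: eq_bigr => s /negbTE ->.
have Ec : cut y = cut y'.
  apply: IH; [exact: cutc|exact: cutc|by rewrite !cutE E Et|].
  have : (#|sp (cut y)| < #|sp y|)%N.
    apply: proper_card; apply/properP; split.
      by apply/fintype.subsetP => s; rewrite !inE /cut; case: ifP; rewrite ?eqxx.
    by exists t; rewrite inE // /cut eqxx negbK eqxx.
  by move=> lt1; apply: leq_trans lt1 _; rewrite -ltnS.
apply/funext => s; have [->//|st] := eqVneq s t.
by have := congr1 (fun f => f s) Ec; rewrite /cut (negbTE st).
Qed.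

Lemma conic_flags : conic_subdiv K flags a.
Proof.
split; first exact: is_complex_flags.
- move=> c cF; have [t tc ttop] := flag_top cF.
  have /flagsP[_ cK' _] := cF.
  by exists t; [exact: cK'|move=> s sc; rewrite sp_a ?cK' // ttop].
- move=> s /flagsP[_ sK _]; have {}sK := sK s (set11 s); split=> //.
  apply: mass_gt0 => //; rewrite sp_a //.
  by apply: contraNneq (proj1 cK) => <-.
- exact: flags_inj.
- exact: flags_surj.
Qed.

(** The members of a chain have distinct cardinalities, and here only 1 and 2 are possible. *)
Lemma flags_dim2 : (forall s, s \in K -> (#|s| <= 2)%N) ->
  forall c, c \in flags -> (#|c| <= 2)%N.
Proof.
move=> dimK c /flagsP[_ cK' chain].
pose f (s : {set W}) : 'I_3 := inord #|s|.
have fE s : s \in c -> f s = #|s| :> nat.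
  by move=> sc; rewrite inordK // ltnS dimK // cK'.
have finj : {in c &, injective f}.
  move=> s s' sc s'c ff; have Es : #|s| = #|s'| by rewrite -!fE // ff.
  case/orP: (chain s s' sc s'c) => ss; apply/eqP; first by rewrite eqEcard ss Es /=.
  by rewrite eq_sym eqEcard ss Es /=.
rewrite -(card_in_imset finj).
have : (f @: c \subset [set~ ord0])%SET.
  apply/fintype.subsetP => i /imsetP[s sc ->]; rewrite !inE -val_eqE /= fE //.
  by rewrite cards_eq0; apply: contraNneq (proj1 cK) => <-; apply: cK'.
by move/subset_leq_card; rewrite cardsC1 card_ord.
Qed.

End Barycentric.

Definition same_sign (W : finType) (K : {set {set W}}) (l : W -> R) : Prop :=
  forall s w w', s \in K -> w \in s -> w' \in s -> 0 <= l w * l w'.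

Lemma same_sign_comp (U W : finType) (K : {set {set W}}) (K2 : {set {set U}}) a l :
  conic_subdiv K K2 a -> same_sign K l ->
  same_sign K2 (fun u => \sum_w a u w * l w).
Proof.
move=> [cK2 simp pos _ _] ss c u u' cK uc u'c.
have [t tK Ht] := simp c cK.
have a0 v w : v \in c -> 0 <= a v w.
  by move=> vc; case: (pos v (vertex_in cK2 cK vc)).
rewrite mulr_suml; apply: sumr_ge0 => w _; rewrite mulr_sumr; apply: sumr_ge0 => w' _.
have [->|aw] := eqVneq (a u w) 0; first by rewrite !mul0r.
have [->|aw'] := eqVneq (a u' w') 0; first by rewrite mul0r mulr0.
rewrite mulrACA; apply: mulr_ge0; first by rewrite mulr_ge0 ?a0.
apply: (ss t) => //.
  by apply: (fintype.subsetP (Ht u uc)); rewrite inE.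
by apply: (fintype.subsetP (Ht u' u'c)); rewrite inE.
Qed.

(** On an edge whose ends have opposite signs of [l], each end is weighted by the absolute value of
    [l] at the other end, which puts the centre at the zero of [l]. Elsewhere the centre is the
    usual barycentre. *)
Definition cut_weight (W : finType) (l : W -> R) (s : {set W}) (w : W) : R :=
  if w \in s then
    if [exists u in s, exists u' in s, l u * l u' < 0] then \sum_(u in s | u != w) `|l u|
    else 1
  else 0.

Lemma cut_weight_ge0 (W : finType) (l : W -> R) s w : 0 <= cut_weight l s w.
Proof. by rewrite /cut_weight; case: ifP => // _; case: ifP => // _; apply: sumr_ge0. Qed.

Lemma sp_cut_weight (W : finType) (l : W -> R) (s : {set W}) : sp (cut_weight l s) = s.
Proof.
apply/setP => w; rewrite inE /cut_weight; case: ifP => ws; last by rewrite eqxx.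
case: ifP => [/exists_inP[u us /exists_inP[u' u's opp]]|_]; last exact: oner_neq0.
have u0 : l u != 0 by apply: contraTneq opp => ->; rewrite mul0r ltxx.
have u'0 : l u' != 0 by apply: contraTneq opp => ->; rewrite mulr0 ltxx.
have uu' : u != u' by apply: contraTneq opp => ->; rewrite -leNgt -expr2 sqr_ge0.
rewrite gt_eqF //; have [uw|uw] := eqVneq u w.
  rewrite (bigD1 u') /=; last by rewrite u's -uw eq_sym.
  by rewrite ltr_pwDl ?normr_gt0 // sumr_ge0.
by rewrite (bigD1 u) ?us //= ltr_pwDl ?normr_gt0 // sumr_ge0.
Qed.

(** The case to check is a vertex [u] of an edge with ends [u] and [v]: at the centre of the edge
    the value is zero if the signs are opposite, and [l u + l v] otherwise. *)
Lemma same_sign_cut (W : finType) (K : {set {set W}}) (l : W -> R) :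
  is_complex K -> (forall s, s \in K -> (#|s| <= 2)%N) ->
  same_sign (flags K) (fun s => \sum_w cut_weight l s w * l w).
Proof.
move=> cK dimK c s s' /flagsP[_ cK' chain] sc s'c /=.
have [->|ss'] := eqVneq s s'; first by rewrite -expr2 sqr_ge0.
wlog sub : s s' sc s'c ss' / s \subset s'.
  move=> H; case/orP: (chain s s' sc s'c) => ss; first exact: H.
  by rewrite mulrC; apply: H => //; rewrite eq_sym.
have pr : s \proper s' by rewrite finset.properEneq ss' sub.
have c2 : #|s'| == 2 .
  have s0 : (0 < #|s|)%N.
    by rewrite card_gt0; apply: contraNneq (proj1 cK) => <-; apply: cK'.
  by have := proper_card pr; have := dimK s' (cK' _ s'c); lia.
have c1 : #|s| == 1%N.
  have s0 : (0 < #|s|)%N.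
    by rewrite card_gt0; apply: contraNneq (proj1 cK) => <-; apply: cK'.
  by have := proper_card pr; rewrite (eqP c2); lia.
have [w sE] := elimT cards1P c1.
have [u [v [uv s'E]]] := elimT (cards2P s') c2.
wlog wu : u v uv s'E / w = u.
  move=> H; have : w \in s' by apply: (fintype.subsetP sub); rewrite sE inE.
  rewrite {1}s'E !inE => /orP[/eqP wu|/eqP wv]; first exact: (H u v).
  by apply: (H v u _ _ wv); [rewrite eq_sym|rewrite s'E finset.setUC].
subst w s s'.
have E1 : \sum_w cut_weight l [set u]%SET w * l w = l u.
  rewrite (bigD1 u) //= big1 ?addr0; last by move=> w wu; rewrite /cut_weight inE (negbTE wu) mul0r.
  rewrite /cut_weight inE eqxx; case: ifP => [|_]; last by rewrite mul1r.
  case/exists_inP=> w; rewrite inE => /eqP -> /exists_inP[w']; rewrite inE => /eqP ->.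
  by rewrite ltNge -expr2 sqr_ge0.
have E2 (f : W -> R) : (forall w, w \notin [set u; v]%SET -> f w = 0) -> \sum_w f w = f u + f v.
  move=> f0; rewrite (bigD1 u) //= (bigD1 v) 1?eq_sym //= big1 ?addr0 // => w /andP[wu wv].
  by apply: f0; rewrite !inE negb_or wu.
rewrite E1 E2 => [|w ws]; last by rewrite /cut_weight (negbTE ws) mul0r.
have sumu : \sum_(w in [set u; v]%SET | w != u) `|l w| = `|l v|.
  rewrite (bigD1 v) /=; last by rewrite !inE eqxx orbT eq_sym.
  by rewrite big1 ?addr0 // => w; rewrite !inE => /andP[/andP[/orP[->|->]]].
have sumv : \sum_(w in [set u; v]%SET | w != v) `|l w| = `|l u|.
  rewrite (bigD1 u) /=; last by rewrite !inE eqxx.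
  by rewrite big1 ?addr0 // => w; rewrite !inE => /andP[/andP[/orP[/eqP ->|/eqP ->]]]; rewrite ?eqxx.
rewrite /cut_weight !inE !eqxx orbT /=; case: ifP => [opp|/negbT nopp].
  have {}opp : l u * l v < 0.
    case/exists_inP: opp => w ws /exists_inP[w' ws']; move: ws ws'; rewrite !inE.
    case/orP=> /eqP ->; case/orP => /eqP -> //; rewrite ?(mulrC (l v)) //.
      by rewrite ltNge -expr2 sqr_ge0.
    by rewrite ltNge -expr2 sqr_ge0.
  rewrite sumu sumv; case: (ltgtP (l u) 0) => lu; last by rewrite lu mul0r.
    have lv : 0 < l v by rewrite -(nmulr_rlt0 _ lu).
    by rewrite gtr0_norm // ltr0_norm // mulNr [l v * _]mulrC subrr mulr0.
  have lv : l v < 0 by rewrite -(pmulr_rlt0 _ lu).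
  by rewrite ltr0_norm // gtr0_norm // mulNr [l v * _]mulrC addNr mulr0.
have nuv : 0 <= l u * l v.
  rewrite leNgt; apply: contra nopp => h; apply/exists_inP; exists u; first by rewrite !inE eqxx.
  by apply/exists_inP; exists v; rewrite // !inE eqxx orbT.
by rewrite !mul1r mulrDr addr_ge0 // -expr2 sqr_ge0.
Qed.

(** One cut per functional; by [same_sign_comp], further subdivision does not spoil the signs
    already arranged. *)
Lemma refine_signs (V W : finType) (L : {set {set V}}) (K : {set {set W}}) (q : W -> V -> R)
    n (G : (V -> R) -> 'rV[R]_n) (hs : seq 'cV[R]_n) :
  is_complex L -> conic_subdiv L K q -> (forall s, s \in K -> (#|s| <= 2)%N) ->
  linear_on K q G ->
  exists (W2 : finType) (K2 : {set {set W2}}) (q2 : W2 -> V -> R),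
    [/\ conic_subdiv L K2 q2, forall s, s \in K2 -> (#|s| <= 2)%N, linear_on K2 q2 G &
     forall h, h \in hs -> same_sign K2 (fun w => (G (q2 w) *m h) 0 0)].
Proof.
move=> cL; elim: hs => [|h hs IH] in W K q *; first by move=> cs dimK lin; exists W, K, q; split.
move=> cs dimK lin; have [W1 [K1 [q1 [cs1 dim1 lin1 sg1]]]] := IH W K q cs dimK lin.
have [cK1 _ _ _ _] := cs1.
pose l w := (G (q1 w) *m h) 0 0.
have csf := conic_flags cK1 (cut_weight_ge0 l) (fun s _ => sp_cut_weight l s).
exists {set W1}, (flags K1), (fun s => bc q1 (cut_weight l s)).
have valE (h' : 'cV[R]_n) s : [set s]%SET \in flags K1 ->
    (G (bc q1 (cut_weight l s)) *m h') 0 0 =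
    \sum_w cut_weight l s w * (G (q1 w) *m h') 0 0.
  move=> sF; rewrite lin1; last first.
    by rewrite -(bc_delta (cut_weight l) s); apply: (bc_cone cK1 csf); apply: delta_cone.
  rewrite mulmx_suml summxE; apply: eq_bigr => w _.
  by rewrite -scalemxAl mxE.
have sgE (h' : 'cV[R]_n) :
    same_sign (flags K1) (fun s => \sum_w cut_weight l s w * (G (q1 w) *m h') 0 0) ->
    same_sign (flags K1) (fun s => (G (bc q1 (cut_weight l s)) *m h') 0 0).
  move=> H c s s' cF sc s'c; have cF' := is_complex_flags K1.
  by rewrite !valE ?(vertex_in cF' cF) //; apply: (H c).
split.
- exact: (conic_comp cL cs1 csf).
- exact: flags_dim2.
- exact: (linear_on_comp cs1 csf lin1).
- move=> h'; rewrite inE => /predU1P[->|h'hs]; apply: sgE; first exact: same_sign_cut.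
  by apply: same_sign_comp csf _; apply: sg1.
Qed.

End Refinement.

(** * Bending a cone into a half-space *)

Section Bend.
Variable R : realType.

Definition curve (z : R) : 'rV[R]_4 := \row_(i < 4) z ^+ i.

(** Coordinates of [g] modulo the line spanned by [curve z]; they vanish together exactly on that
    line. *)
Definition shear (z : R) (g : 'rV[R]_4) (k : 'I_3) : R :=
  g 0 (lift ord0 k) - z ^+ k.+1 * g 0 ord0.

Definition shear_col (z : R) (k : 'I_3) : 'cV[R]_4 :=
  \col_i ((i == lift ord0 k)%:R - z ^+ k.+1 * (i == ord0)%:R).

Lemma shear_colE z g k : (g *m shear_col z k) 0 0 = shear z g k.
Proof.
rewrite mxE /shear (bigD1 ord0) //= (bigD1 (lift ord0 k)) //= big1 ?addr0.
  have e1 : (ord0 == lift ord0 k) = false by rewrite (negbTE (neq_lift _ _)).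
  have e2 : (lift ord0 k == ord0) = false by rewrite eq_sym.
  by rewrite !mxE !eqxx e1 e2 mulr0 mulr1 subr0 sub0r mulr1 addrC mulrN mulrC.
move=> i /andP[i0 ik]; rewrite mxE (negbTE i0) (negbTE ik) mulr0 subrr mulr0 //.
Qed.

(* A piecewise linear homeomorphism of R^4 that lifts every ray, except the one
   opposite to [curve z], into the open upper half-space once [C] is large. *)
Definition bend (z C : R) (g : 'rV[R]_4) : 'rV[R]_4 :=
  row_mx (\row_k shear z g k) ((g 0 ord0 + C * \sum_k `|shear z g k|)%:M : 'M_1).

Lemma bendl z C g (k : 'I_3) : bend z C g 0 (lshift 1 k) = shear z g k.
Proof. by rewrite /bend (row_mxEl (\row_k shear z g k)) mxE. Qed.

Lemma bendr z C g :
  bend z C g 0 (rshift 3 (ord0 : 'I_1)) = g 0 ord0 + C * \sum_k `|shear z g k|.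
Proof. by rewrite /bend (row_mxEr (\row_k shear z g k)) mxE. Qed.

Lemma bend_inj z C : injective (bend z C).
Proof.
move=> g g' E; have Es k : shear z g k = shear z g' k by rewrite -!(bendl z C) E.
have E0 : g 0 ord0 = g' 0 ord0.
  have := congr1 (fun v : 'rV[R]_4 => v 0 (rshift 3 (ord0 : 'I_1))) E; rewrite !bendr.
  by rewrite (eq_bigr (fun k => `|shear z g' k|)) => [/addIr|k _]; rewrite ?Es.
apply/matrixP => i j; rewrite ord1; case: (unliftP ord0 j) => [k|] -> //.
by have := Es k; rewrite /shear E0 => /addIr.
Qed.

Lemma bend_scale z C c g : 0 <= c -> bend z C (c *: g) = c *: bend z C g.
Proof.
move=> c0; have Es k : shear z (c *: g) k = c * shear z g k by rewrite /shear !mxlinE; ring.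
apply: rV31P => [k|]; rewrite scalemxE ?bendl ?Es // !bendr scalemxE.
under eq_bigr do rewrite Es normrM (ger0_norm c0).
by rewrite -mulr_sumr; ring.
Qed.

Lemma norm_sum_same_sign (W : finType) (K : {set {set W}}) (l : W -> R) (y : W -> R) :
  same_sign K l -> in_cone K y -> `|\sum_w y w * l w| = \sum_w y w * `|l w|.
Proof.
move=> ss [y0 [ys|ys]].
  by rewrite !big1 ?normr0 // => w _; rewrite (sp0 ys) mul0r.
have sgn w w' : y w != 0 -> y w' != 0 -> 0 <= l w * l w'.
  by move=> yw yw'; apply: (ss _ _ _ ys); rewrite inE.
have [[w0 yw0 l0]|no] := pselect (exists2 w0, y w0 != 0 & 0 < l w0).
  have lp w : y w != 0 -> 0 <= l w by move=> yw; rewrite -(pmulr_lge0 _ l0) sgn.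
  have E w : y w * `|l w| = y w * l w.
    by have [->|yw] := eqVneq (y w) 0; rewrite ?mul0r // ger0_norm ?lp.
  rewrite ger0_norm; first by apply: eq_bigr.
  by apply: sumr_ge0 => w _; rewrite -E mulr_ge0.
have ln w : y w != 0 -> l w <= 0 by move=> yw; rewrite leNgt; apply/negP => lw; apply: no; exists w.
have E w : y w * `|l w| = - (y w * l w).
  by have [->|yw] := eqVneq (y w) 0; rewrite ?mul0r ?oppr0 // ler0_norm ?ln // mulrN.
rewrite ler0_norm; first by rewrite -sumrN; apply: eq_bigr.
by rewrite -oppr_ge0 -sumrN; apply: sumr_ge0 => w _; rewrite -E mulr_ge0.
Qed.

Lemma linear_on_bend (V W : finType) (K : {set {set W}}) (q : W -> V -> R)
    (G : (V -> R) -> 'rV[R]_4) z C :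
  linear_on K q G -> (forall k, same_sign K (fun w => (G (q w) *m shear_col z k) 0 0)) ->
  linear_on K q (bend z C \o G).
Proof.
move=> lin ss y yc /=; rewrite lin //.
have Es k : shear z (\sum_w y w *: G (q w)) k = \sum_w y w * shear z (G (q w)) k.
  rewrite -shear_colE mulmx_suml summxE; apply: eq_bigr => w _.
  by rewrite -scalemxAl scalemxE shear_colE.
have ss' k : same_sign K (fun w => shear z (G (q w)) k).
  by move=> s w w' sK ws w's; rewrite -!shear_colE; apply: ss sK ws w's.
apply: rV31P => [k|].
  rewrite bendl Es summxE; apply: eq_bigr => w _; by rewrite scalemxE bendl.
rewrite bendr !summxE; under [X in _ + C * X = _]eq_bigr do rewrite Es (norm_sum_same_sign (ss' _) yc).
under [RHS]eq_bigr do rewrite scalemxE bendr mulrDr.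
rewrite big_split /=; congr (_ + _); first by apply: eq_bigr => w _; rewrite scalemxE.
rewrite exchange_big mulr_sumr; apply: eq_bigr => w _ /=.
by rewrite mulrCA; congr (_ * _); rewrite mulr_sumr.
Qed.

Lemma shear_bound z : exists2 B : R, 0 < B & forall (g g' : 'rV[R]_4) (d : R),
  (forall j, `|g 0 j - g' 0 j| < d) -> forall k, `|shear z g k - shear z g' k| < B * d.
Proof.
exists (1 + \sum_(k < 3) `|z| ^+ k.+1).
  by rewrite ltr_pwDl // sumr_ge0 // => k _; apply: exprn_ge0.
move=> g g' d H k.
have d0 : 0 < d by apply: le_lt_trans (H ord0).
have -> : shear z g k - shear z g' k =
  (g 0 (lift ord0 k) - g' 0 (lift ord0 k)) - z ^+ k.+1 * (g 0 ord0 - g' 0 ord0).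
  by rewrite /shear; ring.
apply: le_lt_trans (ler_normB _ _) _; rewrite mulrDl mul1r; apply: ltr_leD; first exact: H.
rewrite normrM normrX; apply: ler_pM; rewrite ?exprn_ge0 //; last exact: ltW (H ord0).
by rewrite (bigD1 k) //= lerDl sumr_ge0 // => j _; apply: exprn_ge0.
Qed.

Lemma bend_modulus z C : 0 <= C -> forall eps : R, 0 < eps -> exists2 d : R, 0 < d &
  forall g g' : 'rV[R]_4, (forall j, `|g 0 j - g' 0 j| < d) ->
    forall k, `|bend z C g 0 k - bend z C g' 0 k| < eps.
Proof.
move=> C0 eps eps0; have [B B0 HB] := shear_bound z.
have M0 : 0 < 1 + B + C * (B * 3).
  have : 0 <= C * (B * 3) by rewrite mulr_ge0 // mulr_ge0 // ltW.
  lra.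
exists (eps / (1 + B + C * (B * 3))); first by rewrite divr_gt0.
set d := eps / _ => g g' H k.
have d0 : 0 < d by rewrite divr_gt0.
have epsE : eps = d + B * d + C * (B * d * 3).
  have : eps = d * (1 + B + C * (B * 3)) by rewrite /d divfK // gt_eqF.
  by move=> ->; ring.
have Hs := HB g g' d H; have Bd : 0 < B * d by rewrite mulr_gt0.
have CBd : 0 <= C * (B * d * 3) by rewrite mulr_ge0 // mulr_ge0 // ltW.
case: (fintype.split_ordP (k : 'I_(3 + 1))) => j ->.
  rewrite !bendl; apply: lt_le_trans (Hs j) _; rewrite epsE; lra.
rewrite (ord1 j) !bendr.
have -> : g 0 ord0 + C * \sum_k `|shear z g k| - (g' 0 ord0 + C * \sum_k `|shear z g' k|) =
   (g 0 ord0 - g' 0 ord0) + C * \sum_k (`|shear z g k| - `|shear z g' k|).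
  by rewrite sumrB; ring.
apply: le_lt_trans (ler_normD _ _) _; rewrite normrM (ger0_norm C0).
have : `|\sum_k (`|shear z g k| - `|shear z g' k|)| <= B * d * 3.
  apply: le_trans (ler_norm_sum _ _ _) _.
  rewrite mulr_natr -[X in _ *+ X](card_ord 3) -sumr_const; apply: ler_sum => i _.
  by apply: le_trans (ler_dist_dist _ _) (ltW (Hs i)).
move=> le; have := ler_wpM2l C0 le; have := H ord0; rewrite epsE; lra.
Qed.

(** The inverse of [bend] is explicit: the shear coordinates are kept, and subtracting their
    contribution from the last coordinate recovers [g 0 ord0]. *)
Lemma bend_modulus_inv z C : 0 <= C -> forall eps : R, 0 < eps -> exists2 d : R, 0 < d &
  forall g g' : 'rV[R]_4, (forall k, `|bend z C g 0 k - bend z C g' 0 k| < d) ->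
    forall j, `|g 0 j - g' 0 j| < eps.
Proof.
move=> C0 eps eps0; pose B := \sum_(k < 3) `|z| ^+ k.+1.
have B0 : 0 <= B by rewrite sumr_ge0 // => k _; apply: exprn_ge0.
have M0 : 0 < (1 + B) * (2 + C * 3).
  by rewrite mulr_gt0 //; [lra|rewrite ltr_wpDr // mulr_ge0].
exists (eps / ((1 + B) * (2 + C * 3))); first by rewrite divr_gt0.
set d := eps / _ => g g' H j.
have d0 : 0 < d by rewrite divr_gt0.
have epsE : eps = (1 + B) * (2 * d + C * (d * 3)).
  have : eps = d * ((1 + B) * (2 + C * 3)) by rewrite /d divfK // gt_eqF.
  by move=> ->; ring.
have Hs k : `|shear z g k - shear z g' k| < d by rewrite -!(bendl z C).
have Cd : 0 <= C * (d * 3) by rewrite mulr_ge0 // mulr_ge0 // ltW.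
have H0 : `|g 0 ord0 - g' 0 ord0| < d + C * (d * 3).
  have E (u : 'rV[R]_4) : u 0 ord0 = bend z C u 0 (rshift 3 (ord0 : 'I_1)) - C * \sum_k `|shear z u k|.
    by rewrite bendr addrK.
  rewrite (E g) (E g').
  have -> : forall a b s t : R, a - C * s - (b - C * t) = (a - b) + - (C * (s - t)) by move=> *; ring.
  rewrite -sumrB; apply: le_lt_trans (ler_normD _ _) _; rewrite normrN normrM (ger0_norm C0).
  apply: ltr_leD; first exact: H.
  apply: ler_wpM2l => //; apply: le_trans (ler_norm_sum _ _ _) _.
  rewrite mulr_natr -[X in _ *+ X](card_ord 3) -sumr_const; apply: ler_sum => i _.
  by apply: le_trans (ler_dist_dist _ _) (ltW (Hs i)).
have m0 : 0 < d + C * (d * 3) by lra.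
case: (unliftP ord0 j) => [k|] ->; last first.
  apply: lt_le_trans H0 _; rewrite epsE.
  have : 0 <= B * (2 * d + C * (d * 3)) by apply: mulr_ge0 => //; lra.
  lra.
have E (u : 'rV[R]_4) : u 0 (lift ord0 k) = shear z u k + z ^+ k.+1 * u 0 ord0.
  by rewrite /shear subrK.
rewrite (E g) (E g').
have -> : forall a b c s t : R, a + c * s - (b + c * t) = (a - b) + (c * (s - t)) by move=> *; ring.
apply: le_lt_trans (ler_normD _ _) _; rewrite normrM normrX.
have zB : `|z| ^+ k.+1 <= B.
  by rewrite /B (bigD1 k) //= lerDl sumr_ge0 // => i _; apply: exprn_ge0.
have := ler_pM (exprn_ge0 k.+1 (normr_ge0 z)) (normr_ge0 _) zB (ltW H0).
have := Hs k; have : 0 <= B * d by rewrite mulr_ge0 // ltW.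
rewrite epsE; lra.
Qed.

End Bend.

(** * Horizontal section of the bent cone *)

Section FlatEmbedding.
Variables (R : realType) (V : finType) (L : {set {set V}}) (G : (V -> R) -> 'rV[R]_4).
Hypothesis cL : is_complex L.
Hypothesis G_inj : forall x x', in_cone L x -> in_cone L x' -> G x = G x' -> x = x'.

Lemma linear_on0 (W : finType) (K : {set {set W}}) (q : W -> V -> R) :
  linear_on K q G -> G (fun=> 0) = 0.
Proof.
move=> lin; have <- : bc q (fun=> 0) = fun=> 0.
  by apply/funext => v; rewrite /bc big1 // => w _; rewrite mul0r.
rewrite lin ?big1 //; first by move=> w _; rewrite scale0r.
exact: in_cone0.
Qed.

(** Each cone of the subdivision spans a proper subspace of R^4; some nonzero functional kills it,
    and takes on [curve z] a value that is a nonzero polynomial in [z]. In fact the whole line is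
    missed, so the shear coordinates have no common zero on the image except at the origin. *)
Lemma missed_ray (W : finType) (K : {set {set W}}) (q : W -> V -> R) :
  conic_subdiv L K q -> (forall s, s \in K -> (#|s| <= 2)%N) -> linear_on K q G ->
  exists z, forall x, in_cone L x -> forall c, G x = c *: curve z -> x = fun=> 0.
Proof.
move=> cs dimK lin; have [cK _ _ _ surj] := cs.
have [z Hz] : exists z, forall s : {set W}, s \in K -> exists2 h : 'cV[R]_4,
    (forall w, w \in s -> G (q w) *m h = 0) & (curve z *m h) 0 0 != 0.
  apply: generic_ex; apply: generic_fin => s.
  have [sK|_] := boolP (s \in K); last exact: generic_true.
  pose A : 'M[R]_(4, #|s|) := \matrix_(i, j) G (q (enum_val j)) 0 i.
  have : kermx A != 0.
    rewrite kermx_eq0 /row_free; apply: contraTneq (dimK s sK) => rA.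
    by rewrite -ltnNge; apply: leq_trans (rank_leq_col A); rewrite rA.
  case/rowV0Pn => h /sub_kermxP hA h0.
  exists (rVpoly h) => [|z hz _]; first by apply: contra_neq h0 => h00; apply: (can_inj rVpolyK); rewrite h00 linear0.
  exists h^T.
    move=> w ws; apply/matrixP => i j; rewrite !ord1 mxE [RHS]mxE.
    move/matrixP/(_ 0 (enum_rank_in ws w)): hA; rewrite !mxE => E0; rewrite -[RHS]E0.
    by apply: eq_bigr => k _; rewrite !mxE enum_rankK_in // mulrC.
  apply: contraNneq hz => hz; rewrite rootE; apply/eqP; rewrite -hz mxE.
  rewrite (@horner_coef_wide _ 4) ?size_poly //.
  by apply: eq_bigr => k _; rewrite !mxE coef_rVpoly_ord mulrC.
exists z => x xc c Gx; have [y yc xE] := surj x xc.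
have [y0 [ys|ys]] := yc.
  by rewrite xE (sp0 ys); apply/funext => v; rewrite /bc big1 // => w _; rewrite mul0r.
have [h hG hz] := Hz _ ys.
have : (G x *m h) 0 0 = 0.
  rewrite xE lin // mulmx_suml summxE big1 // => w _; rewrite -scalemxAl mxE.
  have [->|yw] := eqVneq (y w) 0; first by rewrite mul0r.
  by rewrite hG ?inE // mxE mulr0.
rewrite Gx -scalemxAl mxE => /eqP; rewrite mulf_eq0 (negbTE hz) orbF => /eqP c0.
apply: G_inj => //; first exact: in_cone0.
by rewrite Gx c0 scale0r (linear_on0 lin).
Qed.

(** [D x] is the point of the cone that lands on the hyperplane of height one, over [f x]; in
    general it is not a multiple of [x]. Its support stays in that of [x], so disjoint cycles keep
    disjoint supports, and [k0], [k1] bound its distance from the cone point on both sides. *)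
Lemma flat_cone_embedding (W0 : finType) (K0 : {set {set W0}}) (q0 : W0 -> V -> R) :
  conic_subdiv L K0 q0 -> (forall s, s \in K0 -> (#|s| <= 2)%N) -> linear_on K0 q0 G ->
  exists (z C : R) (W : finType) (K : {set {set W}}) (q : W -> V -> R)
      (f : (V -> R) -> 'rV[R]_3) (D : (V -> R) -> V -> R) (k0 k1 : R),
    [/\ 0 <= C, 0 < k0, pl_data L K q f &
     forall x, rz L x -> [/\ in_cone L (D x), sp (D x) \subset sp x,
       k0 <= mass (D x) <= k1 & bend z C (G (D x)) = up (f x)]].
Proof.
move=> cs0 dim0 lin0; have [z Hz] := missed_ray cs0 dim0 lin0.
have [W [K [q1 [cs1 dimK lin1 sg]]]] :=
  refine_signs [seq shear_col z k | k <- enum 'I_3] cL cs0 dim0 lin0.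
have {}sg k : same_sign K (fun w => (G (q1 w) *m shear_col z k) 0 0).
  by apply: sg; apply: map_f; rewrite mem_enum.
pose S (w : W) : R := \sum_(k < 3) `|shear z (G (q1 w)) k|.
have S0 w : 0 <= S w by apply: sumr_ge0.
(* Each summand is nonnegative and the one of [w] makes [C * S w] exceed the size of the original
   height, so every vertex is lifted to positive height. *)
pose C : R := \sum_w (1 + `|G (q1 w) 0 ord0|) / S w.
have C0 : 0 <= C by apply: sumr_ge0 => w _; rewrite divr_ge0 // addr_ge0.
have [cK simp1 pos1 inj1 surj1] := cs1.
have q1c w : [set w]%SET \in K -> in_cone L (q1 w).
  by move=> wK; rewrite -(bc_delta q1 w); apply: (bc_cone cL cs1); apply: delta_cone.
have Spos w : [set w]%SET \in K -> 0 < S w.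
  move=> wK; rewrite lt_def S0 andbT; apply/eqP => Sw.
  have s0 k : shear z (G (q1 w)) k = 0.
    by apply/eqP; move/eqP: Sw; rewrite psumr_eq0 // => /allP/(_ k (mem_index_enum _)); rewrite normr_eq0.
  have [_] := pos1 w wK; rewrite (Hz (q1 w) (q1c w wK) (G (q1 w) 0 ord0)) ?/mass ?big1 ?ltxx //.
  apply/matrixP => i j; rewrite ord1 mxE mxE; case: (unliftP ord0 j) => [k|] ->.
    by have /eqP := s0 k; rewrite subr_eq0 => /eqP ->; rewrite mulrC.
  by rewrite expr0 mulr1.
pose H := bend z C \o G.
have lin2 : linear_on K q1 H by apply: linear_on_bend.
have height1 w : [set w]%SET \in K -> 0 < H (q1 w) 0 (rshift 3 (ord0 : 'I_1)).
  move=> wK; rewrite /H /= bendr -/(S w).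
  have : 1 + `|G (q1 w) 0 ord0| <= C * S w.
    rewrite -ler_pdivrMr ?Spos // /C (bigD1 w) //= lerDl.
    by apply: sumr_ge0 => w' _; rewrite divr_ge0 // addr_ge0.
  have := ler_norm (- G (q1 w) 0 ord0); rewrite normrN; lra.
pose q w v := (mass (q1 w))^-1 * q1 w v.
have [cs mass1] := conic_normalize cs1.
rewrite -/q in cs mass1.
have lin : linear_on K q H by exact: (linear_on_normalize cL cs1 lin2).
have [_ simp pos inj surj] := cs.
pose tau (w : W) : R := H (q w) 0 (rshift 3 (ord0 : 'I_1)).
have tau0 w : [set w]%SET \in K -> 0 < tau w.
  move=> wK; have [_ m0] := pos1 w wK.
  rewrite /tau /q (linear_on_scale cs1 lin2) ?invr_ge0 ?(ltW m0) ?q1c //.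
  by rewrite scalemxE mulr_gt0 ?invr_gt0 ?height1.
  exact: q1c.
pose fw (u : W) : 'rV[R]_3 := \row_(k < 3) (H (q u) 0 (lshift 1 k) / tau u).
have Hw : forall w, [set w]%SET \in K -> H (q w) = tau w *: up (fw w).
  move=> w wK; apply: rV31P => [k|]; rewrite scalemxE ?upl ?upr ?mulr1 //.
  by rewrite [fw _ _ _]mxE mulrC divfK // gt_eqF // tau0.
have H_inj x x' : in_cone L x -> in_cone L x' -> H x = H x' -> x = x'.
  by move=> xc xc' /bend_inj; apply: G_inj.
have [crd crdP] : exists crd : (V -> R) -> W -> R, forall x, in_cone L x ->
    in_cone K (crd x) /\ x = bc q (crd x).
  have ex x : exists y, in_cone L x -> in_cone K y /\ x = bc q y.
    have [xc|nc] := pselect (in_cone L x); last by exists (fun=> 0).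
    by have [y yc yE] := surj x xc; exists y.
  by exists (fun x => projT1 (cid (ex x))) => x; apply: (projT2 (cid (ex x))).
have crd_bc y : in_cone K y -> crd (bc q y) = y.
  move=> yc; have [cc cE] := crdP _ (bc_cone cL cs yc).
  by apply: inj.
have mass_bcq y : in_cone K y -> mass (bc q y) = mass y.
  move=> yc; rewrite mass_bc; apply: eq_bigr => w _.
  have [->|yw] := eqVneq (y w) 0; first by rewrite mul0r.
  by rewrite mass1 ?mulr1 // (cone_vertex cK yc yw).
have rzKL y : rz K y -> rz L (bc q y).
  move=> /(rz_cone _ cK)[yc y1]; apply/(rz_cone _ cL); split; first exact: (bc_cone cL cs).
  by rewrite mass_bcq.
(* Dividing each vertex coordinate by the height [tau w] of that vertex brings its contribution to
   [up (fw w)], so that the image becomes affine in the coordinates of [x]. *)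
pose sc (y : W -> R) w := y w / tau w.
have scc y : in_cone K y -> in_cone K (sc y).
  move=> yc; have [y0 ys] := yc; split.
    move=> w; rewrite /sc; have [->|yw] := eqVneq (y w) 0; first by rewrite mul0r.
    by rewrite divr_ge0 // ltW // tau0 // (cone_vertex cK yc yw).
  rewrite (_ : sp _ = sp y) //; apply/setP => w; rewrite !inE /sc.
  have [->|yw] := eqVneq (y w) 0; first by rewrite mul0r eqxx.
  by rewrite mulf_neq0 // invr_neq0 // gt_eqF // tau0 // (cone_vertex cK yc yw).
pose f x := \sum_w crd x w *: fw w.
pose D x := bc q (sc (crd x)).
have HD x : rz L x -> H (D x) = up (f x).
  move=> /(rz_cone _ cL)[xc x1]; have [cc xE] := crdP x xc.
  have S1 : \sum_w crd x w = 1 by rewrite -x1 {2}xE mass_bcq.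
  rewrite lin; last exact: scc.
  transitivity (\sum_w crd x w *: up (fw w)).
    apply: eq_bigr => w _; rewrite /sc; have [->|yw] := eqVneq (crd x w) 0.
      by rewrite mul0r !scale0r.
    have wK := cone_vertex cK cc yw.
    by rewrite Hw // scalerA divfK // gt_eqF // tau0.
  apply: rV31P => [k|]; rewrite ?upl ?upr summxE.
    by rewrite /f summxE; apply: eq_bigr => w _; rewrite !scalemxE upl.
  by rewrite -[RHS]S1; apply: eq_bigr => w _; rewrite scalemxE upr mulr1.
have [k0 k00 Hk0] : exists2 k0 : R, 0 < k0 & forall w, [set w]%SET \in K -> k0 <= (tau w)^-1.
  apply: (@common_small R W (fun w k => [set w]%SET \in K -> k <= (tau w)^-1)).
    by move=> w d d' /andP[_ dd'] Hd wK; apply: le_trans dd' (Hd wK).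
  move=> w; have [wK|wK] := boolP ([set w]%SET \in K); last by exists 1.
  by exists (tau w)^-1; rewrite ?invr_gt0 ?tau0.
pose k1 := \sum_w `|(tau w)^-1|.
exists z, C, W, K, q, f, D, k0, k1; split=> //.
  split.
  - split=> //.
    by move=> y y' /(rz_cone _ cK)[yc _] /(rz_cone _ cK)[yc' _]; apply: inj.
  - move=> x /(rz_cone _ cL)[xc x1]; have [cc xE] := crdP x xc; exists (crd x) => //.
    by apply/(rz_cone _ cK); split=> //; rewrite -(mass_bcq _ cc) -xE.
  - move=> y /(rz_cone _ cK)[yc y1]; rewrite /f crd_bc //; apply: eq_bigr => w _.
    have [->|yw] := eqVneq (y w) 0; first by rewrite !scale0r.
    have wK := delta_cone R (cone_vertex cK yc yw).
    by rewrite -(bc_delta q w) crd_bc // sum_delta.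
  - move=> x x' rx rx' E; have HE : H (D x) = H (D x') by rewrite !HD // E.
    move: rx rx' => /(rz_cone _ cL)[xc x1] /(rz_cone _ cL)[xc' x1'].
    have [cc xE] := crdP x xc; have [cc' xE'] := crdP x' xc'.
    have Esc : sc (crd x) = sc (crd x').
      apply: inj; [exact: scc|exact: scc|]; apply: H_inj HE; apply: (bc_cone cL cs); exact: scc.
    rewrite xE xE'; congr bc; apply/funext => w.
    have := congr1 (fun g => g w) Esc; rewrite /sc.
    have [e0|yw] := eqVneq (crd x w) 0; have [e0'|yw'] := eqVneq (crd x' w) 0.
    + by rewrite e0 e0'.
    + by move/mulIf; apply; rewrite invr_neq0 // gt_eqF // tau0 // (cone_vertex cK cc' yw').
    + by move/mulIf; apply; rewrite invr_neq0 // gt_eqF // tau0 // (cone_vertex cK cc yw).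
    + by move/mulIf; apply; rewrite invr_neq0 // gt_eqF // tau0 // (cone_vertex cK cc yw).
move=> x rx; have /(rz_cone _ cL)[xc x1] := rx; have [cc xE] := crdP x xc.
have Dc : in_cone L (D x) by apply: (bc_cone cL cs); apply: scc.
have S1 : \sum_w crd x w = 1 by rewrite -x1 {2}xE mass_bcq.
have [c0 _] := cc.
split=> //; last exact: HD.
  rewrite {2}xE; apply: sp_bc => w; rewrite /sc => sw.
  have yw : crd x w != 0 by apply: contraNneq sw => ->; rewrite mul0r.
  have wK := cone_vertex cK cc yw.
  apply/fintype.subsetP => v; rewrite !inE => qv; rewrite gt_eqF // /bc (bigD1 w) //=.
  rewrite ltr_pwDl //.
    by rewrite mulr_gt0 // lt_def ?yw ?c0 ?qv //; case: (pos w wK) => ->.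
  apply: sumr_ge0 => w' _; have [->|yw'] := eqVneq (crd x w') 0; first by rewrite mul0r.
  by rewrite mulr_ge0 //; case: (pos w' (cone_vertex cK cc yw')) => ->.
rewrite mass_bcq; last exact: scc.
apply/andP; split.
  rewrite -[k0]mul1r -S1 mulr_suml; apply: ler_sum => w _; rewrite /sc.
  have [->|yw] := eqVneq (crd x w) 0; first by rewrite !mul0r.
  by apply: ler_wpM2l => //; apply: Hk0; apply: (cone_vertex cK cc yw).
apply: ler_sum => w _; rewrite /sc.
have : crd x w <= 1 by rewrite -S1 (bigD1 w) //= lerDl sumr_ge0.
move=> le1; apply: le_trans (ler_norm _) _; rewrite normrM (ger0_norm (c0 w)).
by rewrite ler_piMl.
Qed.

End FlatEmbedding.

(** * Closed polygonal lines *)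

Section PolygonEdges.

Lemma zip_map_map (T T' : Type) (f : T -> T') (s t : seq T) :
  zip (map f s) (map f t) = [seq (f a.1, f a.2) | a <- zip s t].
Proof. by elim: s t => [|x s IH] [|y t] //=; rewrite IH. Qed.

Lemma polygon_edges_map (T T' : Type) (f : T -> T') (s : seq T) :
  polygon_edges (map f s) = [seq (f a.1, f a.2) | a <- polygon_edges s].
Proof. by rewrite /polygon_edges -map_rot zip_map_map. Qed.

Lemma sum_polygon_edges (T : Type) (s : seq T) (g : T -> int) :
  \sum_(a <- polygon_edges s) g a.1 = \sum_(a <- polygon_edges s) g a.2.
Proof.
rewrite -(big_map fst xpredT g) -(big_map snd xpredT g) /polygon_edges.
rewrite -/(unzip1 _) -/(unzip2 _) unzip1_zip ?size_rot // unzip2_zip ?size_rot //.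
by rewrite [in RHS]/rot [in RHS]big_cat /= [in RHS]addrC -[in RHS]big_cat cat_take_drop.
Qed.

Lemma flatten_shift (U : eqType) (T : Type) (nx : U -> U) (a : U -> T) (b : U -> seq T) u s z :
  path (frel nx) u (rcons s z) ->
  rcons (flatten [seq a v :: b v | v <- u :: s]) (a z) =
  a u :: flatten [seq rcons (b v) (a (nx v)) | v <- u :: s].
Proof.
elim: s u => [|v s IH] u /=; first by rewrite andbT => /eqP ->; rewrite !cats0.
case/andP => /eqP nu pv; have := IH v pv; rewrite /= => E.
by rewrite rcons_cat /= E nu -cat_rcons.
Qed.

Lemma polygon_edges_flatten (U : eqType) (T : Type) (c : seq U) (a : U -> T) (b : U -> seq T) :
  uniq c ->
  polygon_edges (flatten [seq a v :: b v | v <- c]) =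
  flatten [seq zip (a v :: b v) (rcons (b v) (a (next c v))) | v <- c].
Proof.
move=> uc; have := cycle_next uc; set nx := next c; move: nx => nx; case: c {uc} => [//|u s] cyc.
have := flatten_shift a b cyc.
rewrite /polygon_edges /= rot1_cons => [[->]].
have : forall l, zip (flatten [seq a v :: b v | v <- l])
    (flatten [seq rcons (b v) (a (nx v)) | v <- l]) =
    flatten [seq zip (a v :: b v) (rcons (b v) (a (nx v))) | v <- l].
  by elim=> //= v l IH; rewrite -cat_cons zip_cat ?IH // size_rcons.
by move/(_ (u :: s)).
Qed.

End PolygonEdges.

Section CyclePolygon.
Variables (R : realType) (V : finType) (e : rel V).
Implicit Types (x y : {ffun V -> R^o}).

Definition mix (x y : V -> R) (s : R) : V -> R := fun v => (1 - s) * x v + s * y v.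

Lemma path_lt_range (s : seq R) : path <%R 0 (rcons s 1) ->
  forall t, t \in 0 :: rcons s 1 -> 0 <= t <= 1.
Proof.
move=> p; have p0 := order_path_min lt_trans p.
have /= := path_sorted p; rewrite (sorted_pairwise lt_trans) pairwise_rcons => /andP[p1 _].
have /andP[+ _] : all (fun t => 0 < t) (rcons s 1) && true by rewrite p0.
rewrite all_rcons => /andP[_ p0'] t.
rewrite inE mem_rcons inE => /or3P[/eqP->|/eqP->|ts]; rewrite ?lexx ?ler01 //.
by rewrite !ltW // ?(allP p0') ?(allP p1).
Qed.

Lemma edge_point_mix u v (t t' s : R) :
  (fun w => edge_point u v ((1 - s) * t + s * t') w : R) =
  mix (fun w => edge_point u v t w) (fun w => edge_point u v t' w) s.
Proof. by apply/funext => w; rewrite /mix !ffunE; ring. Qed.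

(** An edge of the polygon is remembered by its preimages in the realization: the whole segment
    between them lies over the cycle and is mapped affinely. *)
Definition good_edge (f : (V -> R) -> 'rV[R]_3) (c : seq V) (a : {ffun V -> R^o} * {ffun V -> R^o}) :=
  forall s, 0 <= s <= 1 ->
    [/\ rz (graph_complex e) (mix a.1 a.2 s),
      sp (mix a.1 a.2 s) \subset [set v in c]%SET &
      f (mix a.1 a.2 s) = (1 - s) *: f (fun v => a.1 v) + s *: f (fun v => a.2 v)].

Lemma rz_edge_point u v (t : R) : e u v -> u != v -> 0 <= t <= 1 ->
  rz (graph_complex e) (fun w => edge_point u v t w : R).
Proof.
move=> euv uv /andP[t0 t1]; have wE w : edge_point u v t w =
    (if w == u then 1 - t else if w == v then t else 0) :> R.
  rewrite ffunE; have [->|wu] := eqVneq w u; first by rewrite (negbTE uv) mulr1 mulr0 addr0.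
  by rewrite mulr0 add0r; case: eqP => _; rewrite ?mulr1 ?mulr0.
have vu : (v == u) = false by rewrite eq_sym (negbTE uv).
split=> [w||].
- by rewrite wE; case: ifP => _; [rewrite subr_ge0|case: ifP].
- rewrite (eq_bigr _ (fun w _ => wE w)) (bigD1 u) //= eqxx (bigD1 v) ?vu //= eqxx.
  rewrite ?vu big1 ?addr0 ?subrK // => w /andP[/negbTE -> /negbTE ->] //.
have spE : sp (fun w => edge_point u v t w : R) \subset [set u; v]%SET.
  apply/fintype.subsetP => w; rewrite !inE wE; case: (w == u) => //=; case: (w == v) => //.
  by rewrite eqxx.
rewrite inE; have [t00|tn0] := eqVneq t 0; apply/orP; [left|].
  apply/imsetP; exists u => //; apply/setP => w; rewrite !inE wE t00 subr0.
  by case: (w == u); rewrite ?oner_eq0 // if_same eqxx.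
have [t11|tn1] := eqVneq t 1; [left|right].
  apply/imsetP; exists v => //; apply/setP => w; rewrite !inE wE t11 subrr.
  have [->|_] := eqVneq w u; first by rewrite eqxx (negbTE uv).
  by case: (w == v); rewrite ?oner_eq0 ?eqxx.
apply/imsetP; exists (u, v); first by rewrite inE.
apply/setP => w; rewrite !inE wE /=; have [->|_] := eqVneq w u.
  by rewrite subr_eq0 eq_sym tn1.
by case: (w == v); rewrite ?tn0 ?eqxx.
Qed.

Lemma cycle_polygon_edges (f : (V -> R) -> 'rV[R]_3) (c : seq V) (P : seq 'rV[R]_3) :
  irreflexive e -> graph_cycle e c ->
  polygon_of_cycle (fun x : {ffun V -> R^o} => f (fun v => x v : R)) c P ->
  exists XE : seq ({ffun V -> R^o} * {ffun V -> R^o}),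
  [/\ polygon_edges P = [seq (f (fun v => a.1 v : R), f (fun v => a.2 v : R))
       | a : {ffun V -> R^o} * {ffun V -> R^o} <- XE],
    forall g : {ffun V -> R^o} -> int, \sum_(a <- XE) g a.1 = \sum_(a <- XE) g a.2 &
    forall a, a \in XE -> good_edge f c a].
Proof.
move=> irr /andP[/andP[cyc uc] _] [ts [Hts PE]].
pose xs := flatten [seq [seq (edge_point u (next c u) t : {ffun V -> R^o}) | t <- 0 :: ts u] | u <- c].
have Pxs : P = map (fun x : {ffun V -> R^o} => f (fun v => x v : R)) xs.
  rewrite PE /xs map_flatten -map_comp; congr flatten; apply: eq_map => u /=.
  by rewrite -map_comp.
exists (polygon_edges xs); split.
- by rewrite Pxs polygon_edges_map.
- by move=> g; exact: sum_polygon_edges.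
move=> a; rewrite /xs /= (polygon_edges_flatten (fun u => edge_point u (next c u) 0)
  (fun u => [seq edge_point u (next c u) t | t <- ts u]) uc).
(* The last piece of an edge ends at parameter 0 of the next edge, which is parameter 1 of the
   present one; each edge can thus be treated by itself. *)
have vertexE u w : edge_point (next c u) w 0 = edge_point u (next c u) 1 :> {ffun V -> R^o}.
  by apply/ffunP => v; rewrite !ffunE; ring.
case/flattenP => z /mapP[u ucc ->].
rewrite vertexE -map_rcons -[_ :: _]/(map _ (0 :: ts u)) zip_map_map => /mapP[[t t'] tt ->] s s01 /=.
have [pts aff] := Hts u ucc.
have t01 : 0 <= t <= 1.
  apply: (path_lt_range pts); have := map_f fst tt; rewrite -/(unzip1 _) unzip1_zip ?size_rcons //=.
  by rewrite !inE mem_rcons inE => /orP[->//|->]; rewrite !orbT.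
have t'01 : 0 <= t' <= 1.
  apply: (path_lt_range pts); have := map_f snd tt; rewrite -/(unzip2 _) unzip2_zip ?size_rcons //=.
  by rewrite inE => ->; rewrite orbT.
have eu : e u (next c u) by apply: next_cycle.
have un : u != next c u by apply/eqP => E; rewrite -E irr in eu.
have m01 : 0 <= (1 - s) * t + s * t' <= 1.
  case/andP: s01 => s0 s1; case/andP: t01 => t0 t1; case/andP: t'01 => t'0 t'1.
  have s1' : 0 <= 1 - s by rewrite subr_ge0.
  apply/andP; split; first by rewrite addr_ge0 // mulr_ge0.
  have := ler_wpM2l s1' t1; have := ler_wpM2l s0 t'1; lra.
rewrite -edge_point_mix; split.
- exact: rz_edge_point.
- apply/fintype.subsetP => w; rewrite !inE ffunE; apply: contraR => wc.
  have [/eqP wu /eqP wn] : w != u /\ w != next c u.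
    by split; apply: contraNneq wc => ->; rewrite ?mem_next.
  by rewrite (introF eqP wu) (introF eqP wn) !mulr0 addr0.
- by have := aff (t, t') tt s s01.
Qed.

End CyclePolygon.

(** * Discs bounded by the cycles *)

Section GraphComplex.
Variables (V : finType) (e : rel V).

Lemma graph_complex_card (t : {set V}) : t \in graph_complex e -> (#|t| <= 2)%N.
Proof.
rewrite inE => /orP[/imsetP[v _ ->]|/imsetP[[u v] _ ->]]; first by rewrite cards1.
by rewrite cards2; case: (_ != _).
Qed.

Lemma is_complex_graph : is_complex (graph_complex e).
Proof.
have vertex v : [set v]%SET \in graph_complex e by rewrite inE imset_f.
split.
  rewrite inE negb_or; apply/andP; split; apply/negP => /imsetP[u _ /setP].
    by move/(_ u); rewrite !inE eqxx.
  by move/(_ u.1); rewrite !inE eqxx.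
move=> s t; rewrite inE => /orP[/imsetP[v _ ->]|/imsetP[[u v] euv ->]] ts t0.
  by move: ts; rewrite finset.subset1 (negbTE t0) orbF => /eqP ->.
have tE w : w \in t -> w = u \/ w = v.
  by move=> /(fintype.subsetP ts); rewrite !inE => /orP[/eqP|/eqP]; [left|right].
have [ut|ut] := boolP (u \in t); have [vt|vt] := boolP (v \in t).
- suff -> : t = [set u; v]%SET.
    by rewrite inE; apply/orP; right; apply/imsetP; exists (u, v).
  by apply/eqP; rewrite finset.eqEsubset ts; apply/fintype.subsetP => w /set2P[] ->.
- suff -> : t = [set u]%SET by exact: vertex.
  apply/setP => w; rewrite inE; apply/idP/eqP => [wt|->//].
  by case: (tE w wt) => // wv; rewrite -wv wt in vt.
- suff -> : t = [set v]%SET by exact: vertex.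
  apply/setP => w; rewrite inE; apply/idP/eqP => [wt|->//].
  by case: (tE w wt) => // wv; rewrite -wv wt in ut.
case/set0Pn: t0 => w wt; case: (tE w wt) => wE; rewrite -wE wt // in ut vt.
Qed.

End GraphComplex.

Section Moduli.
Variables (R : realType) (V W : finType) (K : {set {set V}}) (K' : {set {set W}})
  (p : W -> V -> R) (F : (V -> R) -> 'rV[R]_4) (z C : R) (g0 : 'rV[R]_4).
Hypothesis data : pl_data K K' p F.
Hypothesis C0 : 0 <= C.

Let Fb x := bend z C (F x - g0).

Lemma pl_coord y k : rz K' y -> F (bc p y) 0 k = \sum_w y w * F (p w) 0 k.
Proof.
have [_ _ lin _] := data; move=> ry; rewrite lin // summxE.
by apply: eq_bigr => w _; rewrite scalemxE.
Qed.

Lemma bend_pl_modulus (eps : R) : 0 < eps -> exists2 d : R, 0 < d &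
  forall x x', rz K x -> rz K x' -> (forall t, `|x t - x' t| < d) ->
    forall k, `|Fb x 0 k - Fb x' 0 k| < eps.
Proof.
have [[cK' _ _ inj] surj lin _] := data; have [K'0 K'd] := cK'.
move=> eps0; have [d d0 Hd] := bend_modulus z C0 eps0.
have [|d' d'0 Hd'] := @rz_modulus R W V 'I_4 K' (fun v w => p w v) (fun k w => F (p w) 0 k)
  K'0 K'd _ d d0.
  by move=> y y' ry ry' E k; have -> : y = y' by apply: inj => //; apply/funext; exact: E.
exists d' => // x x' /surj[y ry ->] /surj[y' ry' ->] Hx k; apply: Hd => j.
rewrite !addmxE opprD addrACA subrr addr0 !pl_coord //; exact: Hd'.
Qed.

(** The inverse of the embedding is uniformly continuous: points a definite distance apart in the
    join have images a definite distance apart. *)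
Lemma bend_pl_modulus_inv (eps : R) : 0 < eps -> exists2 d : R, 0 < d &
  forall x x', rz K x -> rz K x' -> (forall k, `|Fb x 0 k - Fb x' 0 k| < d) ->
    forall t, `|x t - x' t| < eps.
Proof.
have [[cK' _ sub inj] surj lin injF] := data; have [K'0 K'd] := cK'.
move=> eps0.
have [|d d0 Hd] := @rz_modulus R W 'I_4 V K' (fun k w => F (p w) 0 k) (fun v w => p w v)
  K'0 K'd _ eps eps0.
  move=> y y' ry ry' E k; have : bc p y = bc p y'.
    apply: injF; [exact: sub|exact: sub|].
    by apply/matrixP => i j; rewrite ord1 !pl_coord.
  by move/(congr1 (fun f => f k)).
have [d' d'0 Hd'] := bend_modulus_inv z C0 d0.
exists d' => // x x' /surj[y ry ->] /surj[y' ry' ->] Hx; apply: Hd => // k.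
have := Hd' _ _ Hx k; rewrite !addmxE opprD addrACA subrr addr0 !pl_coord //.
Qed.

End Moduli.

Lemma invn_small (R : realType) (d : R) : 0 < d -> exists2 m : nat, (0 < m)%N & m%:R^-1 < d.
Proof.
move=> d0; have di : 0 < d^-1 by rewrite invr_gt0.
exists (Num.bound d^-1).+1 => //; rewrite -[d]invrK ltf_pV2 ?posrE // invrK.
apply: lt_trans (archi_boundP (ltW di)) _.
by rewrite ltr_nat.
Qed.

Section RealBounds.
Variable R : realType.
Implicit Types x y c t M d mu : R.

Lemma norm_mul_le1 c x M : `|c| <= 1 -> `|x| <= M -> `|c * x| <= M.
Proof.
by move=> c1 xM; rewrite normrM -[M]mul1r ler_pM.
Qed.

Lemma dist_unit x y : 0 <= x <= 1 -> 0 <= y <= 1 -> `|x - y| <= 1.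
Proof.
by move=> /andP[x0 x1] /andP[y0 y1]; rewrite ler_norml; apply/andP; split; lra.
Qed.

Lemma norm_compl_le1 t : 0 <= t <= 1 -> `|1 - t| <= 1.
Proof.
by move=> t01; apply: dist_unit => //; rewrite ler01 lexx.
Qed.

Lemma norm_unit_le1 t : 0 <= t <= 1 -> `|t| <= 1.
Proof. by case/andP=> t0 t1; rewrite ger0_norm. Qed.

Lemma sum3_small x y t d mu : `|x| <= d / 2 -> `|y| <= mu -> `|t| <= mu -> mu < d / 4 ->
  `|x + y + t| < d.
Proof.
move=> hx hy ht hm; have := ler_normD (x + y) t; have := ler_normD x y; lra.
Qed.

Lemma barycentric_range c1 c2 x y : 0 <= c1 -> 0 <= c2 -> c1 + c2 <= 1 ->
  0 <= x <= 1 -> 0 <= y <= 1 -> 0 <= c1 * x + c2 * y <= 1.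
Proof.
move=> c10 c20 c12 /andP[x0 x1] /andP[y0 y1].
rewrite addr_ge0 ?mulr_ge0 //=; have := ler_wpM2l c10 x1; have := ler_wpM2l c20 y1; lra.
Qed.

Lemma mix_bounds c x M : 0 <= c <= 1 -> M <= x <= 1 -> M <= 1 ->
  M <= (1 - c) * x + c <= 1.
Proof.
move=> /andP[c0 c1] /andP[Mx x1] M1; have c1' : 0 <= 1 - c by rewrite subr_ge0.
have := ler_wpM2l c1' x1; have := ler_wpM2l c1' Mx; have := ler_wpM2l c0 M1.
by move=> h1 h2 h3; apply/andP; split; lra.
Qed.

End RealBounds.

Section Discs.
Variables (R : realType) (V : finType) (e : rel V).
Let L := graph_complex e.
Let K := join_complex L (points_complex 3).
Variables (W : finType) (K' : {set {set W}}) (p : W -> V + 'I_3 -> R)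
  (F : (V + 'I_3 -> R) -> 'rV[R]_4).
Hypotheses (cL : is_complex L) (data : pl_data K K' p F).
Variables (z C : R) (G : (V -> R) -> 'rV[R]_4) (rho : R).
Hypothesis C0 : 0 <= C.
Hypothesis G_scale : forall c x, 0 <= c -> in_cone L x -> G (fun v => c * x v) = c *: G x.
Hypothesis F_cone : forall x, in_cone L x -> mass x < rho ->
  F (jp ord0 x) = F (jp ord0 (fun=> 0)) + G x.
Variables (f : (V -> R) -> 'rV[R]_3) (D : (V -> R) -> V -> R) (eta kap : R).
Hypotheses (eta0 : 0 < eta) (kap0 : 0 < kap) (kap1 : kap <= 2^-1).
Hypothesis DP : forall x, rz L x -> [/\ in_cone L (D x), sp (D x) \subset sp x,
  eta * mass (D x) < rho /\ eta * mass (D x) <= 1, kap <= eta * mass (D x) &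
  bend z C (G (D x)) = up (f x)].

Definition disc_map (i : 'I_3) (x : V -> R) : 'rV[R]_4 :=
  bend z C (F (jp i x) - F (jp ord0 (fun=> 0))).

(* Domain of the disc filling the cycle on the vertex set [B] inside the cones
   with apices [ord0] and [i], without a neighbourhood of the apex [ord0]. *)
Definition outer_dom (B : {set V}) (i k : 'I_3) (x : V -> R) : Prop :=
  [/\ (k == ord0) || (k == i), in_cone L x, mass x <= 1, sp x \subset B &
   k = ord0 -> kap <= mass x].

Definition full_dom (B : {set V}) (i k : 'I_3) (x : V -> R) : Prop :=
  [/\ (k == ord0) || (k == i), in_cone L x, mass x <= 1 & sp x \subset B].

Lemma outer_full B i k x : outer_dom B i k x -> full_dom B i k x.
Proof. by case=> *; split. Qed.

(** If [x] has mass at least [kap], one of its coordinates over [B] is large, while [x'] vanishes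
    there. Otherwise [k = i], and the coordinate at the cone point [i] is at least one half at the
    first point and zero at the second. *)
Lemma domains_apart (B B' : {set V}) i i' k k' x x' :
  i != ord0 -> i != i' -> [disjoint B & B'] ->
  outer_dom B i k x -> full_dom B' i' k' x' ->
  exists t, kap / #|V|.+1%:R <= `|jp k x t - jp k' x' t|.
Proof.
move=> i0 ii' dis [ki [x0 _] x1 xB kx] [ki' _ _ x'B].
have n1 : 1 <= #|V|.+1%:R :> R by rewrite ler1n.
have n0 : 0 < #|V|.+1%:R :> R by rewrite ltr0n.
have [mx|mx] := leP kap (mass x).
  apply: contrapT => no; have lt v : x v <= kap / #|V|.+1%:R.
    have [->|xv] := eqVneq (x v) 0; first by rewrite divr_ge0 ?ltW.
    rewrite leNgt; apply/negP => lt; apply: no; exists (inl v) => /=.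
    have vB : v \in B by apply: (fintype.subsetP xB); rewrite inE.
    rewrite (notin_sp (x := x')) ?subr0 ?ger0_norm ?ltW //.
      by rewrite lt_def xv x0.
    by apply/negP => /(fintype.subsetP x'B) vB'; have := disjointFr dis vB; rewrite vB'.
  have : mass x <= \sum_(v : V) kap / #|V|.+1%:R by apply: ler_sum.
  rewrite sumr_const -[X in _ <= X]mulr_natr => le.
  have : kap / #|V|.+1%:R * #|V|%:R < kap.
    by rewrite mulrAC ltr_pdivrMr // ltr_pM2l // ltr_nat.
  by move=> lt'; have := le_lt_trans (le_trans mx le) lt'; rewrite ltxx.
have kE : k = i.
  by case/orP: ki => /eqP // k0; have := kx k0; rewrite leNgt mx.
exists (inr i) => /=; rewrite kE eqxx.
have -> : (i == k') = false.
  by apply/negbTE; case/orP: ki' => /eqP ->.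
rewrite subr0 ger0_norm ?subr_ge0 //.
apply: (@le_trans _ _ kap); first by rewrite ler_pdivrMr // ler_peMr // ltW.
have := kap1; have := mx; lra.
Qed.

Lemma mass_scale_D x c : mass (fun v => c * (eta * D x v)) = c * (eta * mass (D x)).
Proof. by rewrite mass_scale mass_scale. Qed.

(** The point lies where [F] is exactly conical, so the part of the disc near [O] consists of true
    straight triangles. *)
Lemma disc_map_cone x c : rz L x -> 0 <= c <= 1 ->
  disc_map ord0 (fun v => c * (eta * D x v)) = (c * eta) *: up (f x).
Proof.
move=> rx /andP[c0 c1]; have [Dc _ [Dr _] _ HD] := DP rx.
have ce : 0 <= c * eta by rewrite mulr_ge0 // ltW.
have -> : (fun v => c * (eta * D x v)) = (fun v => (c * eta) * D x v).
  by apply/funext => v; rewrite mulrA.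
rewrite /disc_map F_cone.
- by rewrite addrC addKr G_scale // bend_scale // HD.
- exact: in_cone_scale.
rewrite mass_scale -mulrA; apply: le_lt_trans Dr.
by rewrite ler_piMl //; apply: mulr_ge0; [exact: ltW|apply: mass_ge0; case: Dc].
Qed.

Lemma outer_dom_D (B : {set V}) (i : 'I_3) (x : V -> R) : rz L x -> sp x \subset B ->
  outer_dom B i ord0 (fun v => eta * D x v).
Proof.
move=> rx xB; have [Dc Ds [_ D1] Dk _] := DP rx; split=> //.
- by apply: in_cone_scale => //; apply: ltW.
- by rewrite mass_scale.
- by rewrite sp_scale ?gt_eqF //; apply: fintype.subset_trans xB.
- by rewrite mass_scale.
Qed.

Section Edge.
Variables (B : {set V}) (c : seq V) (i : 'I_3) (a : {ffun V -> R^o} * {ffun V -> R^o}).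
Hypothesis BE : B = [set v in c]%SET.
Hypothesis a_good : good_edge e f c a.

Let a1 : V -> R := fun v => a.1 v.
Let a2 : V -> R := fun v => a.2 v.

Lemma up_edge s : 0 <= s <= 1 ->
  up (f (mix a1 a2 s)) = (1 - s) *: up (f a1) + s *: up (f a2).
Proof. by move=> s01; have [_ _ ->] := a_good s01; rewrite upD ?subrK. Qed.

Lemma inner_points x : tri (cone_triangle eta (f a1, f a2)) x ->
  exists2 y, full_dom B i ord0 y & x = disc_map ord0 y.
Proof.
case=> [x0 [x1 [x2 [x00 x10 x20 s1 ->]]]]; set l := x1 + x2.
have l0 : 0 <= l by rewrite addr_ge0.
have l1 : l <= 1 by rewrite /l; lra.
(* [l] and [s] are polar coordinates on the triangle: the weight off the apex and the position along
   the opposite edge. At the apex [s] is arbitrary. *)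
have [s [s01 sE]] : exists s, 0 <= s <= 1 /\ l * s = x2.
  have [ll|ln] := eqVneq l 0.
    by exists 0; rewrite lexx ler01 mulr0; split=> //; move: ll; rewrite /l; lra.
  have lp : 0 < l by rewrite lt_def ln.
  exists (x2 / l); split; last by rewrite mulrC divfK.
  by rewrite divr_ge0 //= ler_pdivrMr // mul1r /l lerDr.
have [ry yB _] := a_good s01; have [Dc Ds [Dr D1] _ _] := DP ry.
exists (fun v => l * (eta * D (mix a1 a2 s) v)).
  split=> //.
  - by do 2!apply: in_cone_scale => //; first exact: ltW.
  - by rewrite mass_scale_D mulr_ile1 //; apply: mulr_ge0; [exact: ltW|apply: mass_ge0; case: Dc].
  apply: fintype.subset_trans (fintype.subset_trans Ds _); last by rewrite BE.
  by apply: sp_sub => v ->; rewrite !mulr0.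
rewrite disc_map_cone ?l0 // up_edge // /cone_triangle /= scaler0 add0r.
have x1E : x1 = l * (1 - s) by rewrite mulrBr mulr1 sE /l addrK.
rewrite x1E -sE; apply/matrixP => j k; rewrite !mxlinE; ring.
Qed.

Lemma edge_points s : 0 <= s <= 1 ->
  exists2 y, outer_dom B i ord0 y & eta *: ((1 - s) *: up (f a1) + s *: up (f a2)) = disc_map ord0 y.
Proof.
move=> s01; have [ry yB _] := a_good s01.
exists (fun v => eta * D (mix a1 a2 s) v); first by apply: outer_dom_D; rewrite ?BE.
rewrite -up_edge //; have := disc_map_cone (c := 1) ry; rewrite lexx ler01 => /(_ isT).
by rewrite mul1r => <-; congr disc_map; apply/funext => v; rewrite mul1r.
Qed.

End Edge.

Lemma jp_close i (x x' : V -> R) d : 0 < d -> (forall v, `|x v - x' v| < d) ->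
  forall t, `|jp i x t - jp i x' t| < #|V|.+1%:R * d.
Proof.
move=> d0 H.
have n1 : 1 <= #|V|.+1%:R :> R by rewrite ler1n.
case=> [v|j] /=; first by apply: lt_le_trans (H v) _; rewrite ler_peMl // ltW.
case: ifP => _; last by rewrite subrr normr0 mulr_gt0.
rewrite opprB addrCA addrAC subrr add0r distrC.
apply: (@le_lt_trans _ _ (\sum_(v : V) d)).
  by rewrite /mass -sumrB; apply: le_trans (ler_norm_sum _ _ _) _; apply: ler_sum => v _; apply: ltW.
by rewrite sumr_const -[X in X < _]mulr_natl ltr_pM2r // ltr_nat.
Qed.

Lemma tri_near (s : 'rV[R]_4 * 'rV[R]_4 * 'rV[R]_4) (q : 'rV[R]_4) eps :
  (forall j, [/\ `|s.1.1 0 j - q 0 j| < eps, `|s.1.2 0 j - q 0 j| < eps &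
    `|s.2 0 j - q 0 j| < eps]) ->
  forall x, tri s x -> forall j, `|x 0 j - q 0 j| < eps.
Proof.
move=> H x [x0 [x1 [x2 [x00 x10 x20 s1 ->]]]] j; have [h0 h1 h2] := H j.
have -> : (x0 *: s.1.1 + x1 *: s.1.2 + x2 *: s.2) 0 j - q 0 j =
    x0 * (s.1.1 0 j - q 0 j) + x1 * (s.1.2 0 j - q 0 j) + x2 * (s.2 0 j - q 0 j).
  have -> : x0 = 1 - x1 - x2 by lra.
  by rewrite !mxlinE; ring.
apply: (@le_lt_trans _ _ (x0 * `|s.1.1 0 j - q 0 j| + x1 * `|s.1.2 0 j - q 0 j|
    + x2 * `|s.2 0 j - q 0 j|)).
  apply: le_trans (ler_normD _ _) _; rewrite lerD //; last by rewrite normrM ger0_norm.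
  apply: le_trans (ler_normD _ _) _; rewrite !normrM (ger0_norm x00) (ger0_norm x10) lexx //.
have epsE : x0 * eps + x1 * eps + x2 * eps = eps by rewrite -!mulrDl s1 mul1r.
have l0 := ler_wpM2l x00 (ltW h0); have l1 := ler_wpM2l x10 (ltW h1).
have l2 := ler_wpM2l x20 (ltW h2).
have strict t u : u < eps -> 0 < t -> t * u < t * eps by move=> lt t0; rewrite ltr_pM2l.
have [x0p|x0n] := ltP 0 x0; first by have := strict _ _ h0 x0p; lra.
have [x1p|x1n] := ltP 0 x1; first by have := strict _ _ h1 x1p; lra.
have x2p : 0 < x2 by lra.
by have := strict _ _ h2 x2p; lra.
Qed.

(** The complement of the conical part is swept by two homotopies: from the curve at height [eta]
    out to the cycle in the base, then up to the cone point [i]. The triangles have their vertices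
    on the image and need only stay within [eps] of it. *)
Lemma outer_disc (B : {set V}) (c : seq V) (i : 'I_3) (XE : seq ({ffun V -> R^o} * {ffun V -> R^o}))
    (eps : R) :
  B = [set v in c]%SET -> i != ord0 -> 0 < eps ->
  (forall g : {ffun V -> R^o} -> int, \sum_(a <- XE) g a.1 = \sum_(a <- XE) g a.2) ->
  (forall a, a \in XE -> good_edge e f c a) ->
  exists2 A, closed2 ([seq cone_triangle eta (f (fun v => a.1 v : R), f (fun v => a.2 v : R))
      | a : {ffun V -> R^o} * {ffun V -> R^o} <- XE] ++ A) &
    forall s, s \in A -> forall x, tri s x ->
      exists k y, outer_dom B i k y /\ forall j, `|x 0 j - disc_map k y 0 j| < eps.
Proof.
move=> BE i0 eps0 closed good.
have kap_le1 : kap <= 1 by have := kap1; lra.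
pose n1 : R := #|V|.+1%:R.
have n1_gt0 : 0 < n1 by rewrite ltr0n.
have [d1 d10 Hd1] := bend_pl_modulus z (F (jp ord0 (fun=> 0))) data C0 eps0.
(* [jp] may enlarge coordinate distances by the factor [n1], through the mass left at the cone
   point. *)
pose d := d1 / n1.
have d0 : 0 < d by rewrite divr_gt0.
have dh : 0 < d / 2 by rewrite divr_gt0.
(* The variation of [D] along an edge is controlled through its image: [disc_map] sends [eta * D] to
   [eta *: up (f _)], which is affine there, and the inverse modulus brings the estimate back. *)
have [d2 d20 Hd2] := bend_pl_modulus_inv z (F (jp ord0 (fun=> 0))) data C0 dh.
pose M : R := 1 + \sum_(a <- XE) \sum_(k < 4)
   `|(eta *: up (f (fun v => a.1 v : R)) - eta *: up (f (fun v => a.2 v : R))) 0 k|.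
have M0 : 0 < M by rewrite ltr_pwDl // sumr_ge0 // => a _; apply: sumr_ge0.
have [m m0 Hm] : exists2 m : nat, (0 < m)%N & m%:R^-1 < Num.min (d / 4) (d2 / M).
  by apply: invn_small; rewrite lt_min !divr_gt0.
move: Hm; rewrite lt_min => /andP[m4 mM].
set mu : R := m%:R^-1 in m4 mM.
have mr0 : 0 < m%:R :> R by rewrite ltr0n.
have mu0 : 0 < mu by rewrite invr_gt0.
have muE k : k.+1%:R * mu = k%:R * mu + mu by rewrite -natr1 mulrDl mul1r.
have mu01 k : (k <= m)%N -> 0 <= k%:R * mu <= 1.
  by move=> km; rewrite mulr_ge0 ?ler0n ?(ltW mu0) //= /mu ler_pdivrMr // mul1r ler_nat.
have mmu : m%:R * mu = 1 by rewrite mulfV // gt_eqF.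
pose pt (a : {ffun V -> R^o} * {ffun V -> R^o}) (k : nat) : V -> R :=
  mix (fun v => a.1 v) (fun v => a.2 v) (k%:R * mu).
(* [Z1] moves from the point at height [eta] to the base point [y] without its mass dropping below
   [kap]; [Z2] shrinks [y] to zero, that is, to the cone point [i]. *)
pose Z1 (y : V -> R) (j : nat) v := (1 - j%:R * mu) * (eta * D y v) + (j%:R * mu) * y v.
pose Z2 (y : V -> R) (j : nat) v := (1 - j%:R * mu) * y v.
pose S1 y j := disc_map ord0 (Z1 y j).
pose S2 y j := disc_map i (Z2 y j).
have pt0 a : pt a 0%N = (fun v => a.1 v : R).
  by apply/funext => v; rewrite /pt /mix mul0r subr0 mul1r mul0r addr0.
have ptm a : pt a m = (fun v => a.2 v : R).
  by apply/funext => v; rewrite /pt /mix mmu subrr mul0r mul1r add0r.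
have ptP a k : a \in XE -> (k <= m)%N -> rz L (pt a k) /\ sp (pt a k) \subset B.
  by move=> aX km; have [? ? _] := good a aX _ (mu01 k km); rewrite BE.
have S10 y : rz L y -> S1 y 0%N = eta *: up (f y).
  move=> ry; have := disc_map_cone (c := 1) ry; rewrite lexx ler01 mul1r => /(_ isT) <-.
  by congr disc_map; apply/funext => v; rewrite /Z1 mul0r subr0 mul0r addr0.
have up_pt a k : a \in XE -> (k <= m)%N -> up (f (pt a k)) =
    (1 - k%:R * mu) *: up (f (pt a 0%N)) + (k%:R * mu) *: up (f (pt a m)).
  by move=> aX km; rewrite pt0 ptm; apply: (up_edge (good a aX)); apply: mu01.
have Z1P y j : rz L y -> sp y \subset B -> (j <= m)%N -> outer_dom B i ord0 (Z1 y j).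
  move=> ry yB jm; have [Dc Ds [_ D1] Dk _] := DP ry; have [y0 y1 yL] := ry.
  have [Dc0 _] := Dc; have /andP[j0 j1] := mu01 j jm.
  have j1' : 0 <= 1 - j%:R * mu by rewrite subr_ge0.
  have spZ : sp (Z1 y j) \subset sp y.
    apply: sp_sub => v yv; rewrite /Z1 yv mulr0 addr0 (notin_sp (x := D y)) ?mulr0 //.
    by apply/negP => /(fintype.subsetP Ds); rewrite inE yv eqxx.
  have massZ : mass (Z1 y j) = (1 - j%:R * mu) * (eta * mass (D y)) + j%:R * mu.
    by rewrite /mass big_split /= -!mulr_sumr y1 mulr1.
  have mixZ := mix_bounds (mu01 j jm) (introT andP (conj Dk D1)) kap_le1.
  split=> //.
  - apply: (in_cone_sub cL yL) => // v; rewrite /Z1 addr_ge0 // mulr_ge0 //.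
    by rewrite mulr_ge0 // ltW.
  - by rewrite massZ; case/andP: mixZ.
  - exact: fintype.subset_trans yB.
  - by move=> _; rewrite massZ; case/andP: mixZ.
have Z2P y j : rz L y -> sp y \subset B -> (j <= m)%N -> outer_dom B i i (Z2 y j).
  move=> ry yB jm; have [y0 y1 yL] := ry; have /andP[j0 j1] := mu01 j jm.
  have j1' : 0 <= 1 - j%:R * mu by rewrite subr_ge0.
  split; first by rewrite eqxx orbT.
  - by apply: in_cone_scale => //; split=> //; right.
  - by rewrite mass_scale /mass y1 mulr1 gerBl.
  - by apply: fintype.subset_trans yB; apply: sp_sub => v yv; rewrite /Z2 yv mulr0.
  - by move=> ii; rewrite ii eqxx in i0.
have dom_rz k y : outer_dom B i k y -> rz K (jp k y) by case=> _ yc y1 _ _; apply: rz_jp.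
have close k y y' : outer_dom B i k y -> outer_dom B i k y' ->
    (forall v, `|y v - y' v| < d) -> forall j, `|disc_map k y 0 j - disc_map k y' 0 j| < eps.
  move=> yd yd' H; apply: Hd1; [exact: dom_rz|exact: dom_rz|] => t.
  by have := jp_close k d0 H t; rewrite -/n1 /d [X in _ < X]mulrC divfK // gt_eqF.
have Dclose a k k' : a \in XE -> (k <= m)%N -> (k' <= m)%N ->
    `|k%:R * mu - k'%:R * mu| <= mu ->
    forall v, `|eta * D (pt a k) v - eta * D (pt a k') v| < d / 2 /\
      `|pt a k v - pt a k' v| <= mu.
  move=> aX km k'm kk' v; have [rk sk] := ptP a k aX km; have [rk' sk'] := ptP a k' aX k'm.
  split; last first.
    have -> : pt a k v - pt a k' v = (k%:R * mu - k'%:R * mu) * (pt a m v - pt a 0%N v).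
      by rewrite pt0 ptm /pt /mix; ring.
    rewrite mulrC; apply: norm_mul_le1 => //; apply: dist_unit.
      exact: rz_le1 (proj1 (ptP a m aX (leqnn m))).
    exact: rz_le1 (proj1 (ptP a 0%N aX (leq0n m))).
  have := Hd2 (jp ord0 (fun v => eta * D (pt a k) v)) (jp ord0 (fun v => eta * D (pt a k') v)).
  move=> /(_ _ _ _ (inl v)); apply.
  - by apply: (dom_rz ord0); apply: outer_dom_D.
  - by apply: (dom_rz ord0); apply: outer_dom_D.
  move=> j; rewrite -/(disc_map ord0 (fun v => eta * D (pt a k) v)) -/(disc_map ord0 (fun v => eta * D (pt a k') v)).
  have FE l : rz L (pt a l) -> disc_map ord0 (fun v => eta * D (pt a l) v) = eta *: up (f (pt a l)).
    move=> rl; have := disc_map_cone (c := 1) rl; rewrite lexx ler01 mul1r => /(_ isT) <-.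
    by congr disc_map; apply/funext => u; rewrite mul1r.
  rewrite !FE // (up_pt a k) // (up_pt a k') //.
  have -> : (eta *: ((1 - k%:R * mu) *: up (f (pt a 0%N)) + (k%:R * mu) *: up (f (pt a m)))) 0 j -
     (eta *: ((1 - k'%:R * mu) *: up (f (pt a 0%N)) + (k'%:R * mu) *: up (f (pt a m)))) 0 j =
     (k'%:R * mu - k%:R * mu) * (eta *: up (f (pt a 0%N)) - eta *: up (f (pt a m))) 0 j.
    by rewrite !mxlinE; ring.
  rewrite normrM distrC.
  apply: (@le_lt_trans _ _ (mu * M)); last by rewrite -ltr_pdivlMr.
  apply: ler_pM => //; rewrite pt0 ptm /M.
  apply: (@le_trans _ _ (\sum_(a <- XE) \sum_(k < 4)
   `|(eta *: up (f (fun v => a.1 v : R)) - eta *: up (f (fun v => a.2 v : R))) 0 k|)); last first.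
    by rewrite lerDr.
  rewrite (big_rem a) //= (bigD1 j) //= -addrA lerDl addr_ge0 ?sumr_ge0 // => b _.
  by apply: sumr_ge0.
exists (flatten [seq fan m (S1 (pt a 0%N) 0%N) (fun k => S1 (pt a k) 0%N) ++
    (strip m pt S1 a ++ strip m pt S2 a) | a <- XE]).
  have -> : [seq cone_triangle eta (f (fun v => a.1 v : R), f (fun v => a.2 v : R))
      | a : {ffun V -> R^o} * {ffun V -> R^o} <- XE] =
      [seq (0, S1 (pt a 0%N) 0%N, S1 (pt a m) 0%N) | a <- XE].
    apply/eq_in_map => a aX.
    rewrite !S10; [|by case: (ptP a m aX (leqnn m))|by case: (ptP a 0%N aX (leq0n m))].
    by rewrite pt0 ptm.
  apply: (@disc_closed _ _ _ m pt XE S1 S2 0 (disc_map i (fun=> 0))).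
  - move=> g; have := closed (fun x => g (fun v => x v : R)).
    by under eq_bigr do rewrite -pt0; under [X in _ = X -> _]eq_bigr do rewrite -ptm.
  - move=> a k aX km; have [ry _] := ptP a k aX km.
    have Z1E : Z1 (pt a k) m = pt a k.
      by apply/funext => v; rewrite /Z1 mmu subrr mul0r mul1r add0r.
    have Z2E : Z2 (pt a k) 0%N = pt a k.
      by apply/funext => v; rewrite /Z2 mul0r subr0 mul1r.
    (* Base points have mass 1, so they do not depend on the cone in which they are seen, and the
       two homotopies fit together. *)
    have jpE : jp ord0 (pt a k) = jp i (pt a k).
      case: ry => _ y1 _; apply/funext.
      by case=> [v|l] //=; rewrite /mass y1 subrr !if_same.
    by rewrite /S1 /S2 Z1E Z2E /disc_map jpE.
  - move=> y; rewrite /S2; congr disc_map; apply/funext => v.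
    by rewrite /Z2 mmu subrr mul0r.
move=> s /flattenP[sq /mapP[a aX ->]].
rewrite !mem_cat => /or3P[/mapP[k]|/flattenP[sq']|/flattenP[sq']].
(* Fan triangles are degenerate and lie exactly on the image, so their error is zero. *)
- rewrite mem_iota => /andP[_ km] -> x [x0 [x1 [x2 [x00 x10 x20 s1 ->]]]].
  rewrite add0n in km; set t := x1 * (k%:R * mu) + x2 * (k.+1%:R * mu).
  have t01 : 0 <= t <= 1.
    apply: barycentric_range => //; first by rewrite -s1 -addrA lerDr.
      exact: mu01 (ltnW km).
    exact: mu01.
  have [y yd yE] := edge_points i BE (good a aX) t01.
  exists ord0, y; split=> // j; rewrite -yE /=.
  have [r0 _] := ptP a 0%N aX (leq0n m); have [rk _] := ptP a k aX (ltnW km).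
  have [rk' _] := ptP a k.+1 aX km.
  rewrite !S10 // (up_pt a k) ?(ltnW km) // (up_pt a k.+1) // -pt0 -ptm.
  rewrite (_ : _ - _ = 0) ?normr0 // !mxlinE /t.
  have x0E : x0 = 1 - x1 - x2 by rewrite -s1; ring.
  rewrite x0E; ring.
- case/mapP=> k; rewrite mem_iota add0n => /andP[_ km] -> /flattenP[sq2 /mapP[j]].
  rewrite mem_iota add0n => /andP[_ jm] -> sin.
  have [rk sk] := ptP a k aX (ltnW km); have [rk' sk'] := ptP a k.+1 aX km.
  have base : outer_dom B i ord0 (Z1 (pt a k) j) by apply: Z1P => //; apply: ltnW.
  have near k' j' : k' \in [:: k; k.+1] -> j' \in [:: j; j.+1] ->
      forall l, `|S1 (pt a k') j' 0 l - S1 (pt a k) j 0 l| < eps.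
    move=> k'k j'j.
    have k'm : (k' <= m)%N by move: k'k; rewrite !inE => /orP[|] /eqP -> //; exact: ltnW.
    have j'm : (j' <= m)%N by move: j'j; rewrite !inE => /orP[|] /eqP -> //; exact: ltnW.
    have [rk2 sk2] := ptP a k' aX k'm.
    apply: close => //; first exact: Z1P.
    move=> v; have kk : `|k'%:R * mu - k%:R * mu| <= mu.
      move: k'k; rewrite !inE => /orP[|] /eqP ->; first by rewrite subrr normr0 ltW.
      by rewrite muE addrAC subrr add0r gtr0_norm.
    have jj : `|j'%:R * mu - j%:R * mu| <= mu.
      move: j'j; rewrite !inE => /orP[|] /eqP ->; first by rewrite subrr normr0 ltW.
      by rewrite muE addrAC subrr add0r gtr0_norm.
    have [c1 c2] := Dclose a k' k aX k'm (ltnW km) kk v.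
    have [Dc Ds [_ D1] _ _] := DP rk; have [Dc0 _] := Dc.
    have /andP[y0 y1] := rz_le1 v rk.
    have D01 : 0 <= eta * D (pt a k) v <= 1.
      rewrite mulr_ge0 ?(ltW eta0) //=; apply: le_trans D1.
      by rewrite ler_pM2l // le_mass.
    have -> : Z1 (pt a k') j' v - Z1 (pt a k) j v =
      (1 - j'%:R * mu) * (eta * D (pt a k') v - eta * D (pt a k) v) +
      j'%:R * mu * (pt a k' v - pt a k v) +
      (j'%:R * mu - j%:R * mu) * (pt a k v - eta * D (pt a k) v).
      by rewrite /Z1; ring.
    have /andP[j0 j1] := mu01 j' j'm.
    have b1 : `|(1 - j'%:R * mu) * (eta * D (pt a k') v - eta * D (pt a k) v)| <= d / 2.
      by apply: norm_mul_le1; [apply: norm_compl_le1; apply: mu01|exact: ltW].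
    have b2 : `|j'%:R * mu * (pt a k' v - pt a k v)| <= mu.
      by apply: norm_mul_le1 => //; apply: norm_unit_le1; apply: mu01.
    have b3 : `|(j'%:R * mu - j%:R * mu) * (pt a k v - eta * D (pt a k) v)| <= mu.
      rewrite mulrC; apply: norm_mul_le1 => //; apply: dist_unit => //.
      exact: rz_le1 rk.
    exact: sum3_small b1 b2 b3 m4.
  move=> x xin; exists ord0, (Z1 (pt a k) j); split=> //; apply: (tri_near _ xin) => l.
  by move: sin; rewrite !inE => /orP[|] /eqP -> /=; split; apply: near; rewrite !inE eqxx ?orbT.
case/mapP=> k; rewrite mem_iota add0n => /andP[_ km] -> /flattenP[sq2 /mapP[j]].
rewrite mem_iota add0n => /andP[_ jm] -> sin x xin.
have [rk sk] := ptP a k aX (ltnW km); have [rk' sk'] := ptP a k.+1 aX km.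
have base : outer_dom B i i (Z2 (pt a k) j) by apply: Z2P => //; apply: ltnW.
have near k' j' : k' \in [:: k; k.+1] -> j' \in [:: j; j.+1] ->
    forall l, `|S2 (pt a k') j' 0 l - S2 (pt a k) j 0 l| < eps.
  move=> k'k j'j.
  have k'm : (k' <= m)%N by move: k'k; rewrite !inE => /orP[|] /eqP -> //; exact: ltnW.
  have j'm : (j' <= m)%N by move: j'j; rewrite !inE => /orP[|] /eqP -> //; exact: ltnW.
  have [rk2 sk2] := ptP a k' aX k'm.
  apply: close => //; first exact: Z2P.
  move=> v; have kk : `|k'%:R * mu - k%:R * mu| <= mu.
    move: k'k; rewrite !inE => /orP[|] /eqP ->; first by rewrite subrr normr0 ltW.
    by rewrite muE addrAC subrr add0r gtr0_norm.
  have jj : `|j'%:R * mu - j%:R * mu| <= mu.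
    move: j'j; rewrite !inE => /orP[|] /eqP ->; first by rewrite subrr normr0 ltW.
    by rewrite muE addrAC subrr add0r gtr0_norm.
  have [_ c2] := Dclose a k' k aX k'm (ltnW km) kk v.
  have /andP[y0 y1] := rz_le1 v rk.
  have -> : Z2 (pt a k') j' v - Z2 (pt a k) j v =
    (1 - j'%:R * mu) * (pt a k' v - pt a k v) + - ((j'%:R * mu - j%:R * mu) * pt a k v).
    by rewrite /Z2; ring.
  have /andP[j0 j1] := mu01 j' j'm.
  have b2 : `|(1 - j'%:R * mu) * (pt a k' v - pt a k v)| <= mu.
    by apply: norm_mul_le1 => //; apply: norm_compl_le1; apply: mu01.
  have b3 : `|(j'%:R * mu - j%:R * mu) * pt a k v| <= mu.
    rewrite mulrC; apply: norm_mul_le1 => //; apply: norm_unit_le1; exact: rz_le1 rk.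
  have b3' : `|- ((j'%:R * mu - j%:R * mu) * pt a k v)| <= mu by rewrite normrN.
  have z2 : `|0 : R| <= d / 2 by rewrite normr0 ltW.
  by have := sum3_small z2 b2 b3' m4; rewrite add0r.
exists i, (Z2 (pt a k) j); split=> //; apply: (tri_near _ xin) => l.
by move: sin; rewrite !inE => /orP[|] /eqP -> /=; split; apply: near; rewrite !inE eqxx ?orbT.
Qed.

End Discs.

(** * Vanishing of the linking numbers *)

Theorem theorem1 (R : realType) (V : finType) (e : rel V)
    (e_sym : symmetric e) (e_irr : irreflexive e)
    (embed_join :
       PL_embeddable R (join_complex (graph_complex e) (points_complex 3)) 4) :
  exists f : {ffun V -> R^o} -> 'rV[R]_3,
    PL_embedding (graph_complex e) f /\
    forall beta gamma : seq V,
      graph_cycle e beta -> graph_cycle e gamma -> [disjoint beta & gamma] ->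
      forall P Q : seq 'rV[R]_3,
        polygon_of_cycle f beta P -> polygon_of_cycle f gamma Q ->
        linking_number P Q = 0.
Proof.
have cL := is_complex_graph e.
have [W [K' [p [F data]]]] := PL_embeddable_data embed_join.
have [K1 [q [rho [G [cs lin1 /andP[rho0 rho1] F_cone G_inj]]]]] := link_conic data.
have dimK := conic_dim cs (@graph_complex_card V e).
have [z [C [W2 [K2 [q2 [f [D [k0 [k1 [C0 k00 fdata HD]]]]]]]]]] :=
  flat_cone_embedding cL G_inj cs dimK lin1.
have G_scale c x := linear_on_scale (c := c) (x := x) cs lin1.
(* Since the mass of [D x] is at most [k1], this keeps [eta * mass (D x)] at most [rho / 2], inside
   the conical region of [F]. *)
pose eta : R := rho / 2 / (1 + `|k1|).
have k1p : 0 < 1 + `|k1| by rewrite ltr_pwDl.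
have eta0 : 0 < eta by rewrite !divr_gt0.
(* The first bound keeps the curve at height [eta] outside the removed neighbourhood of the cone
   point; the bound by one half is the one required in [domains_apart]. *)
pose kap : R := Num.min (eta * k0) 2^-1.
have kap0 : 0 < kap by rewrite lt_min mulr_gt0 //= invr_gt0.
have kap1 : kap <= 2^-1 by rewrite ge_min lexx orbT.
have DP x : rz (graph_complex e) x -> [/\ in_cone (graph_complex e) (D x), sp (D x) \subset sp x,
    eta * mass (D x) < rho /\ eta * mass (D x) <= 1, kap <= eta * mass (D x) &
    bend z C (G (D x)) = up (f x)].
  move=> /HD[Dc Ds /andP[m0 m1] HDx].
  have le : eta * mass (D x) <= rho / 2.
    rewrite /eta -mulrA ler_piMr //; first by rewrite divr_ge0 // ltW.
    rewrite mulrC ler_pdivrMr // mul1r; apply: le_trans m1 _.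
    by apply: le_trans (ler_norm _) _; rewrite lerDr.
  split=> //; first by split; lra.
  by rewrite ge_min ler_pM2l // m0.
exists (fun x => f (fun v => x v : R)); split; first exact: pl_data_embedding fdata.
move=> beta gamma cb cg dis P Q Pb Qg.
have [XP [PE closedP goodP]] := cycle_polygon_edges e_irr cb Pb.
have [XQ [QE closedQ goodQ]] := cycle_polygon_edges e_irr cg Qg.
pose B := [set v in beta]%SET; pose B' := [set v in gamma]%SET.
have disB : [disjoint B & B'].
  by apply/pred0P => v /=; rewrite !inE; have := pred0P dis v.
have disB' : [disjoint B' & B] by rewrite disjoint_sym.
have edges_disj a b : a \in polygon_edges P -> b \in polygon_edges Q ->
    (segment a.1 a.2 `&` segment b.1 b.2 = set0)%classic.
  rewrite PE QE => /mapP[a' aX ->] /mapP[b' bX ->] /=.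
  apply/seteqP; split=> // y [[t t01 ->] [s s01 E]] /=.
  have [ra aB fa] := goodP a' aX t t01; have [rb bB fb] := goodQ b' bX s s01.
  have [_ _ _ f_inj] := fdata.
  have Elin : mix (fun v => a'.1 v) (fun v => a'.2 v) t = mix (fun v => b'.1 v) (fun v => b'.2 v) s.
    have linE (u w : 'rV[R]_3) (c : R) : (1 - c) *: u + c *: w = u + c *: (w - u).
      by apply/matrixP => i j; rewrite !mxE; ring.
    by apply: f_inj => //; rewrite fa fb !linE.
  have [K0 _] := cL; have [_ _ raL] := ra.
  have /set0Pn[v va] : sp (mix (fun v => a'.1 v : R) (fun v => a'.2 v : R) t) != finset.set0.
    by apply: contraNneq K0 => <-.
  have := fintype.subsetP aB v va; have := fintype.subsetP bB v; rewrite -Elin => /(_ va) vB' vB.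
  by have := disjointFr disB vB; rewrite vB'.
(* The apex chosen in [linking_number] is generic as soon as some generic apex exists; its default
   value is then never taken. *)
have gen := xgetPex 0 (generic_apex_exists edges_disj).
have sep0 : 0 < kap / #|V|.+1%:R by rewrite divr_gt0 // ltr0n.
have [d d0 Hd] := bend_pl_modulus_inv z (F (jp ord0 (fun=> 0))) data C0 sep0.
(* Both discs are approximated within [d / 3], which leaves a third of the separation [d]. *)
have d3 : 0 < d / 3 by rewrite divr_gt0.
(* Distinct second cone points for the two cycles, so that only the cone point [ord0] is shared. *)
pose i1 : 'I_3 := inord 1; pose i2 : 'I_3 := inord 2.
have i10 : i1 != ord0 by rewrite -val_eqE /= inordK.
have i20 : i2 != ord0 by rewrite -val_eqE /= inordK.
have i12 : i1 != i2 by rewrite -val_eqE /= !inordK.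
have i21 : i2 != i1 by rewrite eq_sym.
have [A cA nearA] := outer_disc cL data C0 G_scale F_cone eta0 kap1 DP
  (erefl B) i10 d3 closedP goodP.
have [A' cA' nearA'] := outer_disc cL data C0 G_scale F_cone eta0 kap1 DP
  (erefl B') i20 d3 closedQ goodQ.
have apart (U U' : {set V}) i i' k k' x x' : i != ord0 -> i != i' -> [disjoint U & U'] ->
    outer_dom e kap U i k x -> full_dom e U' i' k' x' ->
    exists j, d <= `|disc_map F z C k x 0 j - disc_map F z C k' x' 0 j|.
  move=> i0 ii' dU ox fx'; have [t Ht] := domains_apart kap0 kap1 i0 ii' dU ox fx'.
  apply: contrapT => no.
  have lt j : `|disc_map F z C k x 0 j - disc_map F z C k' x' 0 j| < d.
    by rewrite ltNge; apply/negP => le; apply: no; exists j.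
  have rx : rz (join_complex (graph_complex e) (points_complex 3)) (jp k x).
    by case: ox => _ ? ? _ _; apply: rz_jp.
  have rx' : rz (join_complex (graph_complex e) (points_complex 3)) (jp k' x').
    by case: fx' => _ ? ? _; apply: rz_jp.
  by have := Hd _ _ rx rx' lt t; rewrite ltNge Ht.
apply: (cone_intersection_eq0 gen eta0 d3 (A := A) (B := A')).
- by rewrite PE -map_comp.
- by rewrite QE -map_comp.
- move=> s t sA; rewrite mem_cat QE -map_comp => tB x y xs yt.
  have [k [u [ud uE]]] := nearA s sA x xs.
  have [k' [v [vd vE]]] : exists k' v, full_dom e B' i2 k' v /\
      forall j, `|y 0 j - disc_map F z C k' v 0 j| < d / 3.
    case/orP: tB => [/mapP[b bX tE]|tA'].
      have yt' : tri (cone_triangle eta (f (fun v => b.1 v), f (fun v => b.2 v))) y.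
        by move: yt; rewrite tE.
      have [v vd ->] := inner_points G_scale F_cone eta0 DP i2 (erefl B') (goodQ b bX) yt'.
      by exists ord0, v; split=> // j; rewrite subrr normr0.
    have [k' [v [vd vE]]] := nearA' t tA' y yt.
    by exists k', v; split=> //; apply: outer_full vd.
  have [j dj] := apart B B' i1 i2 k k' u v i10 i12 disB ud vd.
  exists j; have := uE j; have := vE j.
  have := ler_normD (disc_map F z C k u 0 j - x 0 j) ((x 0 j - y 0 j) + (y 0 j - disc_map F z C k' v 0 j)).
  have := ler_normD (x 0 j - y 0 j) (y 0 j - disc_map F z C k' v 0 j).
  rewrite (distrC (x 0 j) (disc_map F z C k u 0 j)) addrA subrK addrA subrK; lra.
(* The roles are exchanged: now the outer part over [gamma] is compared with the whole disc over
   [beta]. *)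
- move=> s t; rewrite mem_cat PE -map_comp => sA tB x y xs yt.
  have [k' [v [vd vE]]] := nearA' t tB y yt.
  have [k [u [ud uE]]] : exists k u, full_dom e B i1 k u /\
      forall j, `|x 0 j - disc_map F z C k u 0 j| < d / 3.
    case/orP: sA => [/mapP[a aX sE]|sA].
      have xs' : tri (cone_triangle eta (f (fun v => a.1 v), f (fun v => a.2 v))) x.
        by move: xs; rewrite sE.
      have [u ud ->] := inner_points G_scale F_cone eta0 DP i1 (erefl B) (goodP a aX) xs'.
      by exists ord0, u; split=> // j; rewrite subrr normr0.
    have [k [u [ud uE]]] := nearA s sA x xs.
    by exists k, u; split=> //; apply: outer_full ud.
  have [j dj] := apart B' B i2 i1 k' k v u i20 i21 disB' vd ud.
  exists j; have := uE j; have := vE j; move: dj; rewrite distrC.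
  have := ler_normD (disc_map F z C k u 0 j - x 0 j) ((x 0 j - y 0 j) + (y 0 j - disc_map F z C k' v 0 j)).
  have := ler_normD (x 0 j - y 0 j) (y 0 j - disc_map F z C k' v 0 j).
  rewrite (distrC (x 0 j) (disc_map F z C k u 0 j)) addrA subrK addrA subrK; lra.
move=> a b; rewrite PE QE => /mapP[a' aX ->] /mapP[b' bX ->] x y xs y01.
have [u ud ->] := inner_points G_scale F_cone eta0 DP i1 (erefl B) (goodP a' aX) xs.
have [v vd ->] := edge_points G_scale F_cone eta0 DP i2 (erefl B') (goodQ b' bX) y01.
have [j dj] := apart B' B i2 i1 ord0 ord0 v u i20 i21 disB' vd ud.
exists j; rewrite distrC; apply: le_trans dj; lra.
Qed.
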